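(* Let $p>q\ge2$ be integers. There are a region $U\subset\mathbb{C}$ containing $0$ and $K\ge1$ such that, for every $\tau\in\Sigma_q$, the family $$\gamma^\tau:U\times\mathbb{R}\to\mathbb{C},\qquad \gamma^\tau(c,t)=\pi\circ h_c\circ\ell_\tau(t),$$ is a $K$-quasiconformal deformation of the universal cover of $\mathbb{S}^1$ parameterized on $U$, and, writing $\gamma^\tau_c(t)=\gamma^\tau(c,t)$, $$J(\mathbf f_c)=\bigcup_{\tau\in\Sigma_q}\gamma^\tau_c(\mathbb{R})\qquad\text{for every } c\in U.$$ Moreover, for every $c\in U$, $J(\mathbf f_c)$ is a hyperbolic repeller of $\mathbf f_c$ on which $\mathbf f_c$ is leo, and $\mathcal B(J(\mathbf f_c))=J(f_c)$.
   Context: Region means connected open set. For $c\in\mathbb{C}$ let $\mathbf f_c(z)=\{w\in\mathbb{C}:(w-c)^q=z^p\}$; $z\to w$ means $w\in\mathbf f_c(z)$ ($w$ image of $z$, $z$ pre-image of $w$); $\mathbf f_c^{-1}(w)$ is the set of pre-images. A branch of $\mathbf f_c$ is a holomorphic $\varphi$ on an open set with $\varphi(z)\in\mathbf f_c(z)$. A cycle $z_0\to\cdots\to z_n=z_0$ avoiding $0,\infty$ is repelling if $|(\varphi_n\circ\cdots\circ\varphi_1)'(z_0)|>1$, with $\varphi_k$ the local branch taking $z_{k-1}$ to $z_k$. $J_c=J(\mathbf f_c)$ is the closure of the union of all repelling cycles; $J_0=\mathbb{S}^1$. A compact $\Lambda\subset\mathbb{C}\setminus\{0\}$ each of whose points has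 an image and a pre-image in $\Lambda$ is semi-invariant; with $A_r=\{r<|z|<\frac1{2r}\}$, $\operatorname{inv}(A_r,c)$ is the class of such sets contained in $A_r\cap(c+A_r)$. It is an expanding hyperbolic set if there is a conformal metric $\mu(z)|dz|$ on a region $V\supset\Lambda$ with $\inf\|\varphi'(z)\|_\mu>1$ over all $z\in V$ and branches $\varphi$ of $\mathbf f_c$ at $z$ with $\varphi(z)\in V$ ($\|\varphi'(z)\|_\mu=|\varphi'(z)|\mu(\varphi(z))/\mu(z)$), and an attracting hyperbolic set if $\sup\|\varphi'(z)\|_\mu<1$ instead. An expanding hyperbolic set is a hyperbolic repeller if $\mathbf f_c^{-1}(\Lambda)=\Lambda$. With $\mathbf f_{c,\Lambda}(z)=\mathbf f_c(z)\cap\Lambda$, $\mathbf f_c$ is leo on a hyperbolic repeller $\Lambda$ if for every $z\in\Lambda$ and every neighbourhood $O$ of $z$ there is $n>0$ with $\mathbf f_{c,\Lambda}^n(O\cap\Lambda)=\Lambda$. Cantor bundle of an expanding hyperbolic set $\Lambda\in\operatorname{inv}(A_r,c)$: here $0<r<\min\{1/\sqrt2,(4|c|)^{-1}\}$ and $\delta>0$ is such that for all $\Lambda'\in\operatorname{inv}(A_r,c)$, $z\in\Lambda'$, the closed disks of radius $\delta$ centred at the points of $r(\mathbf f_c(z)\cap\Lambda')$ are disjoint and contained in the closed unit disk, likewise for $r(\mathbf f_c^{-1}(z)\cap\Lambda')$. $\mathcal B(\Lambda)$ is the set of all $(z,s)$, $z\in\Lambda$, $s=r\sum_{n\ge1}\delta^{n-1}z_n$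 with $z\to z_1\to z_2\to\cdots$ in $\Lambda$; $\pi(z,s)=z$. The same $(r,\delta)$ is used for all $c\in U$. The bundle map is the holomorphic map $f_c(z,w)=(\varphi(z),\delta^{-1}w-r\delta^{-1}\varphi(z))$ on a small neighbourhood of $\mathcal B(\Lambda)$ in $\mathbb{C}^2$, $\varphi$ being the local branch of $\mathbf f_c$ with $\varphi(x)=x_1$ for any $(x,r\sum\delta^{n-1}x_n)\in\mathcal B(\Lambda)$ sufficiently close to $(z,w)$. $J(f_c)$ is the closure of the periodic points of the bundle map $f_c$ (here with $\Lambda=J_c$). Curves $\ell_\tau$: let $\Sigma_q=\{0,\dots,q-1\}^{\mathbb{N}_0}$, $\mathbb N_0=\{0,1,\dots\}$, $\theta_k(t)=pt/q+2\pi k/q$ for $0\le k<q$. For $\tau=(k_n)\in\Sigma_q$ let $\ell_\tau:\mathbb{R}\to\mathcal B(\mathbb{S}^1)$ (bundle for $c=0$) be $\ell_\tau(t)=\big(e^{it},\,r\sum_{n\ge1}\delta^{n-1}e^{i\theta_{k_{n-1}}\circ\cdots\circ\theta_{k_0}(t)}\big)$. The motion $h$: $h:U\times\mathcal B(\mathbb{S}^1)\to\mathbb{C}^2$ is the unique holomorphic motion based at $0$ (i.e. $h_0=\mathrm{id}$, each $h_c=h(c,\cdot)$ injective, $c\mapsto h_c(x)$ holomorphic) such that, for $c\in U$, $\Lambda_c=\pi h_c(\mathcal B(\mathbb{S}^1))$ is a hyperbolic set of $\mathbf f_c$, varying continuously with $c$ in the Hausdorff metric; $\Lambda_c$ is expanding;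 $h_c(\mathcal B(\mathbb{S}^1))\subset\mathcal B(\Lambda_c)$ is invariant under the bundle map $f_c$ of $\mathcal B(\Lambda_c)$ and $h_c\circ f_0=f_c\circ h_c$; and $|h_u(x)-h_v(x)|\le C_0|u-v|$ for a constant $C_0$ and all $u,v\in U$, $x\in\mathcal{B}(\mathbb S^1)$. (Such $h$ exists for suitable $U$.) A topological embedding $\varphi:L\to\mathbb{C}$, $\emptyset\ne L\subset\mathbb{C}$, is $K$-quasiconformal if $\sup_{z\in L}\limsup_{\epsilon\to0}\frac{\sup_{|z-w|=\epsilon}|\varphi(z)-\varphi(w)|}{\inf_{|z-w|=\epsilon}|\varphi(z)-\varphi(w)|}\le K$ ($w\in L$). A family $\gamma_c:\mathbb{R}\to\mathbb{C}$, $c\in U$, is a $K$-quasiconformal deformation of the universal cover of $\mathbb{S}^1$ if (a) $\gamma_0(t)=e^{it}$; (b) $c\mapsto\gamma_c(t)$ is holomorphic on $U$ for each $t$; (c) for every $c\in U$ and $t_0\in\mathbb{R}$ there are an open interval $I\ni t_0$ and a $K$-quasiconformal homeomorphism $\varphi:e^{iI}\to L\subset\mathbb{C}$, where $e^{iI}=\{e^{it}:t\in I\}$, with $\gamma_c(t)=\varphi(e^{it})$ on $I$. *)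

(* Defs.v *)
From HB Require Import structures.
From mathcomp Require Import all_boot all_order all_algebra.
From mathcomp Require Import all_classical all_reals all_analysis.
From mathcomp Require Import complex.

Set Implicit Arguments.
Unset Strict Implicit.
Unset Printing Implicit Defensive.

Import Order.TTheory GRing.Theory Num.Theory numFieldNormedType.Exports.
Local Open Scope classical_set_scope.
Local Open Scope ring_scope.
Local Open Scope complex_scope.

(* The bare type [R[i]] carries no topology; naming the complex numbers as a
   [numClosedFieldType] gives access to the generic topological and normed
   module structures of numeric fields. *)
Definition C (R : realType) : numClosedFieldType := R[i].

(* The library norm of [C R] takes its values in [C R]; this one is real. *)
Definition cabs (R : realType) (z : C R) : R := Normc.normc z.

(* [x%:C], at type [C R]. *)
Definition ofR (R : realType) (x : R) : C R := x%:C.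

Definition eit (R : realType) (t : R) : C R := cos t +i* sin t.

Definition unit_circle (R : realType) : set (C R) := [set z | cabs z = 1].

Definition region (T : topologicalType) (U : set T) : Prop :=
  open U /\ connected U.

Definition holomorphic_on (R : realType) (V : normedModType (C R))
    (D : set (C R)) (f : C R -> V) : Prop :=
  forall z, D z -> derivable f z 1.

Definition closed_disk (R : realType) (a : C R) (d : R) : set (C R) :=
  [set w | cabs (w - a) <= d].

Definition annulus (R : realType) (r : R) : set (C R) :=
  [set z | r < cabs z < (2 * r)^-1].

Definition hausdorff_dist (R : realType) (A B : set (C R)) : \bar R :=
  Order.max
    (ereal_sup [set ereal_inf [set (cabs (a - b))%:E | b in B] | a in A])
    (ereal_sup [set ereal_inf [set (cabs (a - b))%:E | a in A] | b in B]).

Section Correspondence.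
Variables (R : realType) (p q : nat).
Local Notation C := (C R).

Definition corr (c z : C) : set C := [set w | (w - c) ^+ q = z ^+ p].

Definition preimages (c w : C) : set C := [set z | corr c z w].

Definition branch (c : C) (D : set C) (phi : C -> C) : Prop :=
  [/\ open D, holomorphic_on D phi & forall z, D z -> corr c z (phi z)].

Definition branch_at (c z : C) (phi : C -> C) : Prop :=
  exists2 D : set C, D z & branch c D phi.

(* [comp_branches phi n] is phi_(n-1) \o ... \o phi_0. *)
Fixpoint comp_branches (phi : nat -> C -> C) (n : nat) : C -> C :=
  if n is m.+1 then phi m \o comp_branches phi m else id.

Definition repelling_cycle (c : C) (n : nat) (z : nat -> C) : Prop :=
  [/\ (0 < n)%N, z n = z 0%N,
      forall k, (k < n)%N -> z k != 0 /\ corr c (z k) (z k.+1) &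
      exists phi : nat -> C -> C,
        (forall k, (k < n)%N ->
           branch_at c (z k) (phi k) /\ phi k (z k) = z k.+1) /\
        1 < cabs (derive1 (comp_branches phi n) (z 0%N))].

Definition julia (c : C) : set C :=
  closure [set x | exists n z, repelling_cycle c n z /\
                   exists2 k, (k < n)%N & x = z k].

Definition semi_invariant (c : C) (L : set C) : Prop :=
  [/\ compact L, ~ L 0 &
      forall z, L z -> (exists2 w, L w & corr c z w) /\
                       (exists2 w, L w & corr c w z)].

Definition inv_class (r : R) (c : C) (L : set C) : Prop :=
  semi_invariant c L /\
  L `<=` annulus r `&` [set c + a | a in annulus r].

Definition conformal_metric (V : set C) (mu : C -> R) : Prop :=
  (forall z, V z -> 0 < mu z) /\ {within V, continuous mu}.

(* The values of the norm of phi'(z) relative to the metric mu, for z in V and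
   phi a branch at z with phi(z) in V. *)
Definition derivative_norms (c : C) (V : set C) (mu : C -> R) : set (\bar R) :=
  [set x | exists z phi, [/\ V z, branch_at c z phi, V (phi z) &
     x = (cabs (derive1 phi z) * mu (phi z) / mu z)%:E]].

Definition expanding_hyperbolic (c : C) (L : set C) : Prop :=
  semi_invariant c L /\
  exists V mu, [/\ region V, L `<=` V, conformal_metric V mu &
    (1 < ereal_inf (derivative_norms c V mu))%E].

Definition hyperbolic_repeller (c : C) (L : set C) : Prop :=
  expanding_hyperbolic c L /\ \bigcup_(w in L) preimages c w = L.

Definition image_in (c : C) (L A : set C) : set C :=
  \bigcup_(z in A) (corr c z `&` L).

Definition leo (c : C) (L : set C) : Prop :=
  forall z, L z -> forall O : set C, nbhs z O ->
    exists2 n, (0 < n)%N & iter n (image_in c L) (O `&` L) = L.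

Definition disks_fit (d : R) (S : set C) : Prop :=
  trivIset S (fun a => closed_disk a d) /\
  forall a, S a -> closed_disk a d `<=` closed_disk 0 1.

(* As [0^-1 = 0] in the library, r < (4|c|)^-1 is only required for [c != 0];
   for c = 0 it is void. *)
Definition bundle_params (r d : R) (c : C) : Prop :=
  [/\ 0 < r, r < (Num.sqrt 2)^-1, (c != 0 -> r < (4 * cabs c)^-1), 0 < d &
      forall L, inv_class r c L -> forall z, L z ->
        disks_fit d [set ofR r * w | w in corr c z `&` L] /\
        disks_fit d [set ofR r * w | w in preimages c z `&` L]].

Definition orbit_in (c : C) (L : set C) (u : nat -> C) : Prop :=
  forall n, L (u n) /\ corr c (u n) (u n.+1).

Definition orbit_code (r d : R) (u : nat -> C) : C :=
  ofR r * limn (series (fun n => ofR d ^+ n * u n.+1)).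

Definition cantor_bundle (r d : R) (c : C) (L : set C) : set (C * C) :=
  [set (u 0%N, orbit_code r d u) | u in orbit_in c L].

(* F is the bundle map of L on the neighbourhood W of its Cantor bundle; e is
   the scale that makes "sufficiently close" precise. *)
Definition bundle_map (r d : R) (c : C) (L : set C)
    (W : set (C * C)) (F : C * C -> C * C) : Prop :=
  [/\ inv_class r c L /\ expanding_hyperbolic c L,
      open W, cantor_bundle r d c L `<=` W,
      forall x, W x -> differentiable F x &
      exists2 e : R, 0 < e & forall x : C * C, W x ->
        (exists2 y, cantor_bundle r d c L y & ball x (ofR e) y) /\
        exists phi : C -> C,
          [/\ branch c (ball x.1 (ofR e)) phi,
              F x = (phi x.1,
                     (ofR d)^-1 * x.2 - ofR r * (ofR d)^-1 * phi x.1) &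
              forall u, orbit_in c L u ->
                ball x (ofR e) (u 0%N, orbit_code r d u) ->
                phi (u 0%N) = u 1%N]].

Definition periodic_points (W : set (C * C)) (F : C * C -> C * C) :
    set (C * C) :=
  [set x | exists n, [/\ (0 < n)%N, iter n F x = x &
                         forall k, (k < n)%N -> W (iter k F x)]].

(* J is the closure of the set of periodic points of the bundle map of L: the
   bundle map being defined only on an unspecified small neighbourhood, the
   closure is required to be J on every sufficiently small one. *)
Definition bundle_julia (r d : R) (c : C) (L : set C) (J : set (C * C)) :
    Prop :=
  exists W F, bundle_map r d c L W F /\
    forall W', open W' -> cantor_bundle r d c L `<=` W' -> W' `<=` W ->
      closure (periodic_points W' F) = J.

Definition theta (k : 'I_q) (t : R) : R :=
  p%:R * t / q%:R + 2 * pi * k%:R / q%:R.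

Fixpoint angle (tau : nat -> 'I_q) (t : R) (n : nat) : R :=
  if n is m.+1 then theta (tau m) (angle tau t m) else t.

Definition ell (r d : R) (tau : nat -> 'I_q) (t : R) : C * C :=
  (eit t, orbit_code r d (fun n => eit (angle tau t n))).

Definition motion_base (r d : R) : set (C * C) :=
  cantor_bundle r d 0 (@unit_circle R).

Definition motion_set (r d : R) (h : C -> C * C -> C * C) (c : C) : set C :=
  fst @` (h c @` motion_base r d).

Record bundle_motion (r d : R) (U : set C) (h : C -> C * C -> C * C) :
    Prop := BundleMotion {
  motion_id : forall x, motion_base r d x -> h 0 x = x ;
  motion_inj : forall c, U c ->
    {in motion_base r d &, injective (h c)} ;
  motion_holo : forall x, motion_base r d x ->
    holomorphic_on U (fun c => h c x) ;
  motion_expanding : forall c, U c ->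
    inv_class r c (motion_set r d h c) /\
    expanding_hyperbolic c (motion_set r d h c) ;
  motion_hausdorff : forall c, U c ->
    hausdorff_dist (motion_set r d h c') (motion_set r d h c)
      @[c' --> c] --> 0%E ;
  motion_sub : forall c, U c ->
    h c @` motion_base r d `<=` cantor_bundle r d c (motion_set r d h c) ;
  motion_conj : exists (W : C -> set (C * C)) (F : C -> C * C -> C * C),
    forall c, U c ->
      [/\ bundle_map r d c (motion_set r d h c) (W c) (F c),
          F c @` (h c @` motion_base r d) `<=` h c @` motion_base r d &
          forall x, motion_base r d x -> h c (F 0 x) = F c (h c x)] ;
  motion_lipschitz : exists C0 : R, forall u v x, U u -> U v ->
    motion_base r d x -> `|h u x - h v x| <= ofR C0 * `|u - v|
}.

Definition the_bundle_motion (r d : R) (U : set C)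
    (h : C -> C * C -> C * C) : Prop :=
  bundle_motion r d U h /\
  forall h', bundle_motion r d U h' ->
    forall c x, U c -> motion_base r d x -> h' c x = h c x.

Definition gamma (r d : R) (h : C -> C * C -> C * C) (tau : nat -> 'I_q)
    (c : C) (t : R) : C :=
  (h c (ell r d tau t)).1.

End Correspondence.

Section Quasiconformal.
Variable R : realType.
Local Notation C := (C R).

Definition embedding_on (L : set C) (phi : C -> C) : Prop :=
  {within L, continuous phi} /\
  exists psi : C -> C, {within phi @` L, continuous psi} /\
    forall z, L z -> psi (phi z) = z.

Definition distortion (L : set C) (phi : C -> C) (z : C) (e : R) : \bar R :=
  let circle := L `&` [set w | cabs (z - w) = e] in
  (ereal_sup [set (cabs (phi z - phi w))%:E | w in circle]
   / ereal_inf [set (cabs (phi z - phi w))%:E | w in circle])%E.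

Definition quasiconformal (K : R) (L : set C) (phi : C -> C) : Prop :=
  [/\ L !=set0, embedding_on L phi &
      (ereal_sup [set limf_esup (distortion L phi z) (0 : R)^'+ | z in L]
       <= K%:E)%E].

Definition qc_deformation (K : R) (U : set C) (g : C -> R -> C) : Prop :=
  [/\ forall t, g 0 t = eit t,
      forall t, holomorphic_on U (fun c => g c t) &
      forall c t0, U c -> exists (I : set R) (phi : C -> C),
        [/\ open I, is_interval I, I t0,
            quasiconformal K (@eit R @` I) phi &
            forall t, I t -> g c t = phi (eit t)]].

End Quasiconformal.

(* Main.v *)
Require Import Defs.
From HB Require Import structures.
From mathcomp Require Import all_boot all_order all_algebra.
From mathcomp Require Import all_classical all_reals all_analysis.
From mathcomp Require Import complex.
From mathcomp Require Import ring lra zify.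

(** Write a step [w -> W] of f_c as (W - c) ^ q = w ^ p. Near the unit circle the
    right side varies p times as fast as w and the left side q times as fast as
    W - c, so, p being larger than q, the step is contracting when it is read
    backwards: nearby steps of f_c and f_c' satisfy
    |w - w'| <= lam |(W - c) - (W' - c')| with a fixed lam < 1 ([step_contr]).
    Everything follows from this inequality, used on orbits instead of branches.

    Pulling an orbit of f_c back along f_c' and passing to the limit gives the
    only orbit of f_c' that stays near it, at a distance of order |c - c'|
    ([shadow_orbit], [shadow_close], [orbit_unique]). The shadows in f_c of the
    orbits of f_0 on the unit circle are all the orbits of f_c in an annulus
    ([deform_onto]). Since the images of a point are separated, an orbit is
    determined by its starting point and its code ([code_inj]), and sending the
    point of the bundle that belongs to an orbit to the one that belongs to its
    shadow is the motion. Its difference quotients satisfy the linearised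
    recursion, which contracts as well, so they are Cauchy ([deform_quot]). Any
    other motion sends the successive tails of an orbit to the points of an orbit
    of f_c; by the Lipschitz bound and expansivity it agrees with the first one
    for nearby parameters, and then along a chain of them ([motion_unique]).

    The starting points of the orbits in the annulus form the Julia set. A cycle
    either stays in the annulus, where branches expand by 1 / lam, or is trapped
    near 0, where its multiplier is at most 1 ([periodic_dichotomy]). On the unit
    circle an orbit is an angle with an itinerary, and the angle after N steps is
    an expanding affine function of the starting angle; solving an equation for
    that angle closes orbits up ([close_up]), whence the density of periodic
    orbits, and steers them to any target ([steer]), whence the leo property. The
    bundle map is the shift on codes; as it expands the second coordinate, the
    orbits that remain near the bundle lie in it ([fmap_orbit_bundle]), which
    makes the bundle closed and confines the periodic points to it.

    The curves deform the circle slightly at a fixed scale and are determined at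
    smaller scales by iterating up to that scale. Two equal chords of the circle
    reach it at the same time; on the way back each step multiplies the two
    corresponding chords of the curve by the same factor, up to an error
    proportional to their length, and these lengths form a geometric series. So
    the ratio of the two remains bounded ([gap_compare]), by a constant that does
    not depend on the itinerary or on c. *)

Set Implicit Arguments.
Unset Strict Implicit.
Unset Printing Implicit Defensive.

Import Order.TTheory GRing.Theory Num.Theory numFieldNormedType.Exports.
Local Open Scope classical_set_scope.
Local Open Scope ring_scope.

(** * The complex modulus *)

Section ComplexNumbers.
Variable R : realType.
Local Notation C := (C R).
Implicit Types (z w : C) (x y e : R).

Lemma normE z : `|z| = ofR (cabs z).
Proof. by []. Qed.

Lemma ofR0 : ofR (0 : R) = 0. Proof. by []. Qed.
Lemma ofR1 : ofR (1 : R) = 1. Proof. by []. Qed.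
Lemma ofRD x y : ofR (x + y) = ofR x + ofR y. Proof. exact: rmorphD. Qed.
Lemma ofRB x y : ofR (x - y) = ofR x - ofR y. Proof. exact: rmorphB. Qed.
Lemma ofRM x y : ofR (x * y) = ofR x * ofR y. Proof. exact: rmorphM. Qed.
Lemma ofRX x n : ofR (x ^+ n) = ofR x ^+ n. Proof. exact: rmorphXn. Qed.
Lemma ofRV x : ofR x^-1 = (ofR x)^-1. Proof. exact: fmorphV. Qed.
Lemma ofR_nat n : ofR (n%:R : R) = n%:R. Proof. exact: rmorph_nat. Qed.

Lemma ofR_inj : injective (@ofR R).
Proof. by move=> x y []. Qed.

Lemma le_ofR x y : (ofR x <= ofR y) = (x <= y).
Proof. exact: lecR. Qed.
Lemma lt_ofR x y : (ofR x < ofR y) = (x < y).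
Proof. exact: ltcR. Qed.

Lemma cabs_ge0 z : 0 <= cabs z.
Proof. by rewrite -le_ofR -normE ofR0. Qed.
Lemma cabs0 : cabs (0 : C) = 0.
Proof. by apply: ofR_inj; rewrite -normE normr0. Qed.
Lemma cabs1 : cabs (1 : C) = 1.
Proof. by apply: ofR_inj; rewrite -normE normr1. Qed.
Lemma cabs_eq0 z : (cabs z == 0) = (z == 0).
Proof. by rewrite -(normr_eq0 z) normE -ofR0 (inj_eq ofR_inj). Qed.
Lemma cabs_gt0 z : (0 < cabs z) = (z != 0).
Proof. by rewrite lt0r cabs_eq0 cabs_ge0 andbT. Qed.
Lemma cabsM z w : cabs (z * w) = cabs z * cabs w.
Proof. by apply: ofR_inj; rewrite ofRM -!normE normrM. Qed.
Lemma cabsX z n : cabs (z ^+ n) = cabs z ^+ n.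
Proof. by apply: ofR_inj; rewrite ofRX -!normE normrX. Qed.
Lemma cabsV z : cabs z^-1 = (cabs z)^-1.
Proof. by apply: ofR_inj; rewrite ofRV -!normE normfV. Qed.
Lemma cabsN z : cabs (- z) = cabs z.
Proof. by apply: ofR_inj; rewrite -!normE normrN. Qed.
Lemma cabsC z w : cabs (z - w) = cabs (w - z).
Proof. by rewrite -cabsN opprB. Qed.
Lemma cabsD z w : cabs (z + w) <= cabs z + cabs w.
Proof. by rewrite -le_ofR ofRD -!normE ler_normD. Qed.
Lemma cabsB z w : cabs (z - w) <= cabs z + cabs w.
Proof. by rewrite -(cabsN w) cabsD. Qed.
Lemma cabs_dist z w : cabs z - cabs w <= cabs (z - w).
Proof. by have := cabsD (z - w) w; rewrite subrK => h; lra. Qed.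
Lemma cabs_tri w z1 z2 : cabs (z1 - z2) <= cabs (z1 - w) + cabs (w - z2).
Proof.
by rewrite -[X in cabs X <= _](_ : (z1 - w) + (w - z2) = _) ?cabsD // addrA subrK.
Qed.
Lemma cabs_ofR x : cabs (ofR x) = `|x|.
Proof. by rewrite /cabs /= expr0n /= addr0 sqrtr_sqr. Qed.
Lemma cabs_nat n : cabs (n%:R : C) = n%:R.
Proof. by rewrite -ofR_nat cabs_ofR normr_nat. Qed.
Lemma cabs_sum (I : Type) (s : seq I) (P : pred I) (F : I -> C) :
  cabs (\sum_(i <- s | P i) F i) <= \sum_(i <- s | P i) cabs (F i).
Proof.
elim/big_ind2: _ => //[|a b c d ab cd]; first by rewrite cabs0.
by apply: le_trans (cabsD _ _) _; apply: lerD.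
Qed.
Lemma cabs_sub0 z w : (cabs (z - w) == 0) = (z == w).
Proof. by rewrite cabs_eq0 subr_eq0. Qed.

Lemma cabs_Re z : `|complex.Re z| <= cabs z.
Proof.
case: z => a b; rewrite /cabs /= -sqrtr_sqr.
by apply: ler_wsqrtr; rewrite lerDl sqr_ge0.
Qed.
Lemma cabs_Im z : `|complex.Im z| <= cabs z.
Proof.
case: z => a b; rewrite /cabs /= -sqrtr_sqr.
by apply: ler_wsqrtr; rewrite lerDr sqr_ge0.
Qed.
Lemma cabs_le_ReIm z : cabs z <= `|complex.Re z| + `|complex.Im z|.
Proof.
case: z => a b; rewrite /cabs /= -[leRHS]ger0_norm ?addr_ge0 //.
rewrite -sqrtr_sqr; apply: ler_wsqrtr; rewrite sqrrD !real_normK ?num_real //.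
by rewrite lerD2r lerDl mulrn_wge0 // mulr_ge0.
Qed.

(** * Convergence in terms of the real modulus *)

Lemma posC (e : C) : 0 < e -> exists2 x : R, 0 < x & e = ofR x.
Proof.
case: e => a b; rewrite ltcE /= => /andP[/eqP -> a0].
by exists a.
Qed.

Lemma ballE z e w : ball z (ofR e) w = (cabs (z - w) < e) :> Prop.
Proof. by rewrite -ball_normE /ball_ /= normE lt_ofR. Qed.

Lemma cnbhsP z (A : set C) :
  nbhs z A <-> exists2 e : R, 0 < e & forall w, cabs (z - w) < e -> A w.
Proof.
split=> [/nbhs_ballP[e e0 eA]|[e e0 eA]].
  have [x x0 ex] := posC e0; exists x => // w zw; apply: eA.
  by rewrite ex ballE.
by apply/nbhs_ballP; exists (ofR e) => [|w]; rewrite /= ?ballE ?lt_ofR //; apply: eA.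
Qed.

Lemma ccvgP (T : Type) (F : set_system T) (FF : Filter F) (f : T -> C) (l : C) :
  f @ F --> l <-> forall e : R, 0 < e -> \forall x \near F, cabs (l - f x) < e.
Proof.
split=> [/cvgrPdist_lt fl e e0|fl].
  have /fl : 0 < ofR e by rewrite lt_ofR.
  by apply: filterS => x; rewrite normE lt_ofR.
apply/cvgrPdist_lt => e /posC[x x0 ->].
by apply: filterS (fl _ x0) => y; rewrite normE lt_ofR.
Qed.

Lemma cball_open z e : open [set w | cabs (z - w) < e].
Proof.
rewrite openE => w /= zw; apply/cnbhsP; exists (e - cabs (z - w)) => [|v wv].
  by rewrite subr_gt0.
by apply: le_lt_trans (cabs_tri w _ _) _; lra.
Qed.

Lemma ccvg_seqP (u : nat -> C) (l : C) :
  u @ \oo --> l <->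
  forall e : R, 0 < e -> exists N, forall n, (N <= n)%N -> cabs (l - u n) < e.
Proof.
split=> [/ccvgP ul e e0|ul].
  by have [N _ NP] := ul _ e0; exists N => n; apply: NP.
by apply/ccvgP => e /ul[N NP]; exists N.
Qed.

Lemma geometric_lt (l B e : R) : 0 <= l -> l < 1 -> 0 < e ->
  exists N, forall n, (N <= n)%N -> B * l ^+ n < e.
Proof.
move=> l0 l1 e0.
have : (fun n => B * l ^+ n) @ \oo --> B * (0 : R).
  by apply: cvgMr; apply: cvg_expr; rewrite ger0_norm.
rewrite mulr0 => /cvgrPdist_lt/(_ _ e0)[N _ NP].
exists N => n /NP /=; rewrite sub0r normrN; apply: le_lt_trans; exact: ler_norm.
Qed.

Lemma ccvg_re_im (u : nat -> C) :
  cvgn (fun n => complex.Re (u n)) -> cvgn (fun n => complex.Im (u n)) ->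
  cvgn u.
Proof.
move=> /cvg_ex[a ua] /cvg_ex[b ub]; apply/cvg_ex; exists (a +i* b)%C.
apply/ccvg_seqP => e e0.
have e2 : 0 < e / 2 by rewrite divr_gt0.
have [Na _ NPa] := (iffLR (cvgrPdist_lt _ _) ua) _ e2.
have [Nb _ NPb] := (iffLR (cvgrPdist_lt _ _) ub) _ e2.
exists (maxn Na Nb) => n; rewrite geq_max => /andP[na nb].
apply: le_lt_trans (cabs_le_ReIm _) _.
have := NPa _ na; have := NPb _ nb; rewrite /=.
by case: (u n) => x y /=; lra.
Qed.

(** The increments are summed on real and imaginary parts separately, where
    the comparison test for real series applies. *)
Lemma geometric_cvg (u : nat -> C) (B l : R) : 0 <= l -> l < 1 ->
  (forall n, cabs (u n.+1 - u n) <= B * l ^+ n) -> cvgn u.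
Proof.
move=> l0 l1 uB.
have key (f : C -> R) : (forall z w, f (z - w) = f z - f w) ->
    (forall z, `|f z| <= cabs z) -> cvgn (fun n => f (u n)).
  move=> fB fle.
  have -> : (fun n => f (u n)) =
      (fun n => f (u 0%N) + series (fun k => f (u k.+1) - f (u k)) n).
    apply/funext => n; rewrite /series /= telescope_sumr // addrC subrK //.
  apply: is_cvgD; first exact: is_cvg_cst.
  apply: normed_cvg; apply: (@series_le_cvg _ _ (geometric B l)) => [n|n|n|].
  - exact: normr_ge0.
  - by rewrite /geometric /=; apply: le_trans (uB n); exact: cabs_ge0.
  - by rewrite /geometric /= -fB; apply: le_trans (fle _) (uB n).
  - by apply: is_cvg_geometric_series; rewrite ger0_norm.
apply: ccvg_re_im; apply: key.
- by case=> a b [a' b'].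
- exact: cabs_Re.
- by case=> a b [a' b'].
- exact: cabs_Im.
Qed.

Lemma ccvgX (T : Type) (F : set_system T) (FF : Filter F) (f : T -> C) (l : C) n :
  f @ F --> l -> (fun t => f t ^+ n) @ F --> l ^+ n.
Proof.
move=> fl; elim: n => [|n IH].
  rewrite expr0 (_ : (fun t => _) = fun=> 1); first exact: cvg_cst.
  by apply/funext => t; rewrite expr0.
have E : (fun t => f t ^+ n.+1) = f \* (fun t => f t ^+ n).
  by apply/funext => t; rewrite exprS.
have H := cvgM fl IH; rewrite exprS E; exact: (H FF).
Qed.

Lemma ccvg_le (u : nat -> C) (l z : C) (e : R) : u @ \oo --> l ->
  (exists N, forall n, (N <= n)%N -> cabs (z - u n) <= e) -> cabs (z - l) <= e.
Proof.
move=> /ccvg_seqP ul [N NP]; apply/ler_addgt0Pr => x x0.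
have [M MP] := ul _ x0.
apply: le_trans (cabs_tri (u (maxn N M)) _ _) _.
by apply: lerD; [exact/NP/leq_maxl | rewrite cabsC ltW //; exact/MP/leq_maxr].
Qed.

End ComplexNumbers.

(** * Powers, roots and contracting recursions *)

Section Powers.
Variable R : realType.
Local Notation C := (C R).

Lemma prod_ltr_seq (Y : R) (s : seq C) (f : C -> R) : 0 <= Y -> (0 < size s)%N ->
  (forall z, z \in s -> Y < f z) -> Y ^+ size s < \prod_(z <- s) f z.
Proof.
move=> Y0; elim: s => // a s IH _ H; rewrite big_cons /= exprS.
have Ya : Y < f a by apply: H; rewrite mem_head.
case: s IH H => [_ _|b s IH H]; first by rewrite big_nil expr0 !mulr1.
apply: ltr_pM => //; first exact: exprn_ge0.
by apply: IH => // z zs; apply: H; rewrite inE zs orbT.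
Qed.

(** The product of the distances from [b] to the [m] roots of [X ^ m - y] is
    [|y - b ^+ m|], so the nearest root is at most the geometric mean away.
    This replaces any choice of a holomorphic root. *)
Lemma root_near (m : nat) (b y : C) : (0 < m)%N ->
  exists2 a : C, a ^+ m = y & cabs (a - b) ^+ m <= cabs (y - b ^+ m).
Proof.
move=> m0; have [s sP] := closed_field_poly_normal ('X^m - y%:P : {poly C}).
have mon : 'X^m - y%:P \is @monic C by apply: monicXnsubC.
move: sP; rewrite (monicP mon) scale1r => sP.
have szs : size s = m.
  have := congr1 (fun u : {poly C} => size u) sP.
  by rewrite size_XnsubC // size_prod_XsubC; case.
have rootP z : z \in s -> z ^+ m = y.
  rewrite -root_prod_XsubC -sP rootE !hornerE => /eqP/eqP.
  by rewrite subr_eq0 => /eqP.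
have [//|none] := pselect (exists2 a, a ^+ m = y & cabs (a - b) ^+ m <= cabs (y - b ^+ m)).
have lt z : z \in s -> cabs (y - b ^+ m) < cabs (b - z) ^+ m.
  move=> zs; rewrite ltNge; apply/negP => le; apply: none.
  by exists z; [rewrite (rootP _ zs) | rewrite (cabsC z b); exact: le].
have := congr1 (fun u : {poly C} => cabs u.[b]) sP.
rewrite !hornerE horner_prod => E.
have := prod_ltr_seq (cabs_ge0 _) _ lt; rewrite szs => /(_ m0).
rewrite prodrXl; suff -> : \prod_(z <- s) cabs (b - z) = cabs (y - b ^+ m) by rewrite ltxx.
rewrite cabsC E; elim: (s) => [|a t IH]; first by rewrite !big_nil cabs1.
by rewrite !big_cons cabsM IH !hornerE.
Qed.

Lemma pow_lip (m : nat) (M : R) (a b : C) : cabs a <= M -> cabs b <= M ->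
  cabs (a ^+ m - b ^+ m) <= m%:R * M ^+ m.-1 * cabs (a - b).
Proof.
move=> aM bM; rewrite subrXX cabsM mulrC; apply: ler_wpM2r; first exact: cabs_ge0.
apply: le_trans (cabs_sum _ _ _) _.
apply: (@le_trans _ _ (\sum_(i < m) M ^+ m.-1)); last first.
  by rewrite sumr_const card_ord mulr_natl.
apply: ler_sum => i _; rewrite cabsM !cabsX.
have -> : m.-1 = (m.-1 - i + i)%N by have := ltn_ord i; lia.
rewrite exprD addnK -(_ : (m - i.+1)%N = (m.-1 - i)%N); last by have := ltn_ord i; lia.
by apply: ler_pM; rewrite ?exprn_ge0 ?cabs_ge0 //; apply: lerXn2r; rewrite ?nnegrE ?cabs_ge0 // (le_trans (cabs_ge0 _) aM).
Qed.

(** Only its dependence on [m] alone matters: the remainder in [taylor2] is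
    quadratic, uniformly on the disk of radius 2. *)
Definition taylor_bound (m : nat) : R := m%:R ^+ 2 * 2 ^+ m.

Lemma taylor_bound_ge0 m : 0 <= taylor_bound m.
Proof. by rewrite mulr_ge0 ?exprn_ge0. Qed.

Lemma taylor2 (m : nat) (a b : C) : cabs a <= 2 -> cabs b <= 2 ->
  cabs (a ^+ m - b ^+ m - m%:R * b ^+ m.-1 * (a - b)) <= taylor_bound m * cabs (a - b) ^+ 2.
Proof.
move=> a2 b2; elim: m => [|m IH].
  by rewrite !expr0 subrr !mul0r subr0 cabs0 /taylor_bound expr0n !mul0r.
have -> : a ^+ m.+1 - b ^+ m.+1 - m.+1%:R * b ^+ m.+1.-1 * (a - b) =
  a * (a ^+ m - b ^+ m - m%:R * b ^+ m.-1 * (a - b)) + m%:R * b ^+ m.-1 * (a - b) ^+ 2.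
  by case: m {IH} => [|m] /=; rewrite ?exprS ?expr0 -?natr1; ring.
apply: le_trans (cabsD _ _) _.
apply: (@le_trans _ _ (2 * (taylor_bound m * cabs (a - b) ^+ 2) + m%:R * 2 ^+ m.-1 * cabs (a - b) ^+ 2)).
  rewrite !cabsM !cabsX cabs_nat; apply: lerD.
    by apply: ler_pM => //; rewrite ?cabs_ge0.
  apply: ler_wpM2r; first by rewrite mulr_ge0 ?cabs_ge0.
  by apply: ler_wpM2l => //; apply: lerXn2r; rewrite ?nnegrE ?cabs_ge0.
rewrite mulrA -mulrDl; apply: ler_wpM2r; first by apply: exprn_ge0; exact: cabs_ge0.
rewrite /taylor_bound; case: m {IH} => [|m]; first by rewrite /=; nra.
rewrite -![m.+2%:R]natr1 /= !exprS.
have h : 0 < (2 : R) ^+ m by exact: exprn_gt0.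
have m0 : 0 <= (m.+1%:R : R) by [].
by move: (_ ^+ m) (m.+1%:R : R) h m0 => X Y h m0; nra.
Qed.

(** [k] applications of the recursion give [D n <= B * l ^+ k + b / (1 - l)].
    The recursion runs from the future to the past, so a bound for all times
    plays the part of an initial value. *)
Lemma sup_contraction (D : nat -> R) (l b B : R) : 0 <= l -> l < 1 -> 0 <= b ->
  (forall n, D n <= B) -> (forall n, D n <= l * D n.+1 + b) ->
  forall n, D n <= b / (1 - l).
Proof.
move=> l0 l1 b0 DB Dl.
have l1' : 0 < 1 - l by rewrite subr_gt0.
have H k : forall n, D n <= B * l ^+ k + b / (1 - l).
  elim: k => [|k IH] n.
    by rewrite expr0 mulr1; apply: le_trans (DB n) _; rewrite lerDl divr_ge0 // ltW.
  have E : B * l ^+ k.+1 + b / (1 - l) = l * (B * l ^+ k + b / (1 - l)) + b.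
    by rewrite exprS; field; rewrite gt_eqF.
  by rewrite E; apply: le_trans (Dl n) _; rewrite lerD2r; apply: ler_wpM2l.
move=> n; apply/ler_addgt0Pr => x x0.
have [N NP] := geometric_lt B l0 l1 x0.
by apply: le_trans (H N n) _; have := NP N (leqnn N); lra.
Qed.

(** The same with a finite horizon: what is known at time [N] reaches time [n]
    damped by [l ^+ (N - n)]. *)
Lemma finite_contraction (D : nat -> R) (l B : R) (N : nat) : 0 <= l ->
  (forall n, (n < N)%N -> D n <= l * D n.+1) -> D N <= B ->
  forall n, (n <= N)%N -> D n <= B * l ^+ (N - n).
Proof.
move=> l0 Dl DN n nN; have -> : n = (N - (N - n))%N by rewrite subKn.
have := leq_subr n N; move: (N - n)%N => k kN; rewrite subKn //.
elim: k kN => [|k IH] kN; first by rewrite subn0 expr0 mulr1.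
apply: le_trans (Dl _ _) _; first by rewrite ltn_subrL (leq_trans _ kN).
rewrite -subSn // subSS exprS mulrCA; apply: ler_wpM2l => //; exact/IH/ltnW.
Qed.

End Powers.

(** * Shadowing of orbits near the unit circle *)

Section Shadowing.
Variables (R : realType) (p q : nat).
Local Notation C := (C R).

Definition ann (e : R) (z : C) := 1 - e <= cabs z <= 1 + e.

Definition orbit (c : C) (u : nat -> C) := forall n, corr p q c (u n) (u n.+1).

(** [par_contr] says q < lam * p with room for the error made in the annulus of
    width 8 e: on its left is a bound for the derivative of the q-th power, on
    its right lam times one for the p-th power, less a quadratic term.
    [par_root] makes the first guess of a preimage accurate to 2 e, and
    [par_shadow] keeps shadows within e of the orbit that they follow. *)
Record shadow_params (lam e rho : R) : Prop := ShadowParams {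
  par_q : (2 <= q)%N;
  par_pq : (q < p)%N;
  par_lam0 : 0 < lam;
  par_lam1 : lam < 1;
  par_e0 : 0 < e;
  par_e1 : 16 * e <= 1;
  par_rho0 : 0 < rho;
  par_rhoe : rho <= e;
  par_contr : q%:R * (1 + 8 * e) ^+ q.-1
    <= lam * (p%:R * (1 - 8 * e) ^+ p.-1 - taylor_bound R p * (8 * e));
  par_root : q%:R * 2 ^+ q.-1 * (2 * rho / (1 - lam)) <= (2 * e) ^+ p;
  par_shadow : 2 * rho / (1 - lam) <= e }.

Variables (lam e rho : R).
Hypothesis G : shadow_params lam e rho.

Let lam0 := par_lam0 G.
Let lam1 := par_lam1 G.
Let e0 := par_e0 G.
Let e1 := par_e1 G.
Let rhoe := par_rhoe G.

Lemma par_p0 : (0 < p)%N.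
Proof. exact: leq_ltn_trans (par_pq G). Qed.
Lemma par_q0 : (0 < q)%N.
Proof. exact: leq_trans (par_q G). Qed.
Lemma par_lamB : 0 < 1 - lam.
Proof. by rewrite subr_gt0. Qed.

(** The sum lam + lam ^ 2 + ... : replacing c by c' displaces every later point
    by c' - c, and each displacement is damped by lam per step backwards. *)
Definition kap := lam / (1 - lam).

Lemma kap_ge0 : 0 <= kap.
Proof. by rewrite /kap divr_ge0 // ltW ?par_lamB. Qed.

Lemma kapD1 : kap + 1 = (1 - lam)^-1.
Proof. by rewrite /kap; field; rewrite gt_eqF // par_lamB. Qed.

Lemma kap_fix x : lam * (kap * x + x) = kap * x.
Proof. by rewrite /kap; field; rewrite gt_eqF // par_lamB. Qed.

Lemma kap_rho c c' : cabs c <= rho -> cabs c' <= rho -> kap * cabs (c - c') <= e.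
Proof.
move=> cr cr'; apply: le_trans (par_shadow G).
rewrite /kap mulrAC ler_pM2r ?invr_gt0 ?par_lamB //.
apply: (@le_trans _ _ (cabs (c - c'))); first by apply: ler_piMl; rewrite ?cabs_ge0 ?ltW.
by apply: le_trans (cabsB _ _) _; lra.
Qed.

Lemma ann_le a b z : a <= b -> ann a z -> ann b z.
Proof. by move=> ab /andP[h1 h2]; apply/andP; split; lra. Qed.

Lemma ann_close a d z w : ann a z -> cabs (z - w) <= d -> ann (a + d) w.
Proof.
move=> /andP[h1 h2] zw; apply/andP.
by have := cabs_dist z w; have := cabs_dist w z; rewrite (cabsC w z); split; lra.
Qed.

Lemma contr_pos : 0 < p%:R * (1 - 8 * e) ^+ p.-1 - taylor_bound R p * (8 * e).
Proof.
rewrite -(pmulr_rgt0 _ lam0); apply: lt_le_trans (par_contr G); rewrite mulr_gt0 ?ltr0n ?par_q0 // exprn_gt0 //.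
by have := e0; lra.
Qed.

(** The heart of the matter. A step is a solution of (W - c) ^ q = w ^ p; near
    the unit circle the right side varies p times as fast as w, the left side
    q times as fast as W - c, and q < lam * p. The bounds by 2 e ensure that
    the two steps belong to the same branch. *)
Lemma step_contr c c' w W w' W' :
  corr p q c w W -> corr p q c' w' W' ->
  ann (4 * e) w -> ann (4 * e) W -> cabs (w - w') <= 2 * e -> cabs (W - W') <= 2 * e ->
  cabs c <= e -> cabs c' <= e ->
  cabs (w - w') <= lam * cabs ((W - c) - (W' - c')).
Proof.
rewrite /corr /= => E E' /andP[w1 w2] /andP[W1 W2] ww WW ce ce'.
have := e0; have := e1 => e1' e0'.
have W8 : cabs (W - c) <= 1 + 8 * e by apply: le_trans (cabsB _ _) _; lra.
have W8' : cabs (W' - c') <= 1 + 8 * e.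
  by apply: le_trans (cabsB _ _) _; have := cabs_dist W' W; rewrite cabsC; lra.
have L := pow_lip q W8 W8'.
have w2' : cabs w <= 2 by lra.
have w2'' : cabs w' <= 2 by have := cabs_dist w' w; rewrite cabsC; lra.
have T := taylor2 p w2'' w2'.
have := cabs_dist (p%:R * w ^+ p.-1 * (w' - w)) (w' ^+ p - w ^+ p).
rewrite (cabsC _ (w' ^+ p - w ^+ p)) => H.
rewrite -E' -E in T H; rewrite (cabsC ((W - c) ^+ q)) in L.
have X := contr_pos.
have M : p%:R * (1 - 8 * e) ^+ p.-1 * cabs (w' - w) <= cabs (p%:R * w ^+ p.-1 * (w' - w)).
  rewrite !cabsM cabsX cabs_nat; apply: ler_wpM2r; first exact: cabs_ge0.
  by apply: ler_wpM2l => //; apply: lerXn2r; rewrite ?nnegrE ?cabs_ge0 //; lra.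
have B := taylor_bound_ge0 R p.
have Q : taylor_bound R p * cabs (w' - w) ^+ 2 <= taylor_bound R p * (8 * e) * cabs (w' - w).
  rewrite expr2 mulrA; apply: ler_wpM2r; first exact: cabs_ge0.
  by apply: ler_wpM2l => //; rewrite cabsC; lra.
have P := par_contr G; rewrite cabsC.
have K := ler_wpM2r (cabs_ge0 (W - c - (W' - c'))) P.
rewrite -(ler_pM2l X) [leRHS]mulrCA [leRHS]mulrA; apply: le_trans K.
by rewrite mulrBl; lra.
Qed.

(** A p-th root of A ^ q near w, in the sense of [root_near]. *)
Definition pull (w A : C) : C :=
  xget w [set a | a ^+ p = A ^+ q /\ cabs (a - w) ^+ p <= cabs (A ^+ q - w ^+ p)].

Lemma pullP w A : pull w A ^+ p = A ^+ q /\
  cabs (pull w A - w) ^+ p <= cabs (A ^+ q - w ^+ p).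
Proof.
have [a a1 a2] := root_near w (A ^+ q) par_p0.
by rewrite /pull; case: xgetP => [x ->|/(_ a)[]].
Qed.

(** The bound on the p-th power gives only a Hoelder estimate, but this suffices
    to apply [step_contr], which improves it to a linear one. *)
Lemma pull_close c w W A : corr p q c w W -> cabs (W - c) <= 2 -> cabs A <= 2 ->
  cabs (W - c - A) <= 2 * rho / (1 - lam) -> cabs (w - pull w A) <= 2 * e.
Proof.
rewrite /corr /= => E W2 A2 WA; have [_] := pullP w A.
rewrite -E (cabsC w) => H.
rewrite -(@ler_pXn2r _ p) ?nnegrE ?cabs_ge0 ?par_p0 //; last by have := e0; lra.
apply: le_trans H _; apply: le_trans (par_root G).
rewrite cabsC; apply: le_trans (pow_lip q W2 A2) _.
by apply: ler_wpM2l => //; rewrite mulr_ge0 // exprn_ge0.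
Qed.

(** The orbit itself is taken as the first guess at time [n + k] and pulled back
    [k] times along f_c'. *)
Fixpoint pullback (c' : C) (w : nat -> C) (k n : nat) : C :=
  if k is k'.+1 then pull (w n) (pullback c' w k' n.+1 - c') else w n.

Definition shadow (c' : C) (w : nat -> C) (n : nat) : C :=
  limn (fun k => pullback c' w k n).

Section Pullback.
Variables (c c' : C) (w : nat -> C).
Hypotheses (cr : cabs c <= rho) (cr' : cabs c' <= rho).
Hypothesis wo : orbit c w.
Hypothesis wa : forall n, ann (2 * e) (w n).

Let ce : cabs c <= e. Proof. exact: le_trans rhoe. Qed.
Let ce' : cabs c' <= e. Proof. exact: le_trans rhoe. Qed.

Lemma pullback_corr k n : corr p q c' (pullback c' w k.+1 n) (pullback c' w k n.+1).
Proof. by rewrite /corr /=; case: (pullP (w n) (pullback c' w k n.+1 - c')). Qed.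

(** By [kap_fix] the bound reproduces itself under one more pullback. *)
Lemma pullback_close k n : cabs (w n - pullback c' w k n) <= kap * cabs (c - c').
Proof.
elim: k n => [|k IH] n /=.
  by rewrite subrr cabs0 mulr_ge0 ?kap_ge0 ?cabs_ge0.
have e0' := e0; have e1' := e1; have K := kap_rho cr cr'; have ce1 := ce; have ce1' := ce'.
set A := pullback c' w k n.+1 - c'.
have WA : cabs (w n.+1 - c - A) <= kap * cabs (c - c') + cabs (c - c').
  rewrite (_ : _ - A = (w n.+1 - pullback c' w k n.+1) - (c - c')); last by rewrite /A; ring.
  by apply: le_trans (cabsB _ _) _; rewrite lerD2r.
have WA' : cabs (w n.+1 - c - A) <= 2 * rho / (1 - lam).
  apply: le_trans WA _; rewrite -{2}(mul1r (cabs (c - c'))) -mulrDl kapD1 [leRHS]mulrC.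
  rewrite ler_pM2l ?invr_gt0 ?par_lamB //.
  by have := cabsB c c'; have := cr; have := cr'; lra.
have [_ W2] := andP (wa n.+1).
have cl := IH n.+1.
have P2 : cabs (w n - pull (w n) A) <= 2 * e.
  apply: pull_close (wo n) _ _ WA'; first by apply: le_trans (cabsB _ _) _; lra.
  apply: le_trans (cabsB _ _) _.
  by have := cabs_dist (pullback c' w k n.+1) (w n.+1); rewrite cabsC; lra.
rewrite -kap_fix; apply: (@le_trans _ _ (lam * cabs (w n.+1 - c - A))); last first.
  by rewrite ler_pM2l.
apply: step_contr (wo n) _ _ _ P2 _ ce ce'.
- exact: (pullback_corr k n).
- by apply: ann_le (wa n); lra.
- by apply: ann_le (wa n.+1); lra.
- by apply: le_trans cl _; lra.
Qed.

Lemma pullback_ann k n : ann (3 * e) (pullback c' w k n).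
Proof.
have H := le_trans (pullback_close k n) (kap_rho cr cr').
by have := ann_close (wa n) H; apply: ann_le; lra.
Qed.

(** One pullback more changes the guess at time [n + k] by at most e, and the
    change is damped on the way back to time [n]. *)
Lemma pullback_cauchy k n :
  cabs (pullback c' w k.+1 n - pullback c' w k n) <= e * lam ^+ k.
Proof.
have e0' := e0; have K := kap_rho cr cr'; have ce1 := ce; have ce1' := ce'.
elim: k n => [|k IH] n.
  rewrite expr0 mulr1 [X in _ - X]/= cabsC.
  exact: le_trans (pullback_close 1 n) K.
have := @step_contr c' c' _ _ _ _ (pullback_corr k.+1 n) (pullback_corr k n).
have -> a b : a - c' - (b - c') = a - b by ring.
move=> H; rewrite exprS mulrCA; apply: le_trans (H _ _ _ _ ce' ce') _ => {H}.
- by apply: ann_le (pullback_ann k.+2 n); lra.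
- by apply: ann_le (pullback_ann k.+1 n.+1); lra.
- apply: le_trans (cabs_tri (w n) _ _) _; rewrite (cabsC _ (w n)).
  by apply: le_trans (lerD (pullback_close k.+2 n) (pullback_close k.+1 n)) _; lra.
- apply: le_trans (cabs_tri (w n.+1) _ _) _; rewrite (cabsC _ (w n.+1)).
  by apply: le_trans (lerD (pullback_close k.+1 n.+1) (pullback_close k n.+1)) _; lra.
- by rewrite ler_pM2l.
Qed.

Lemma shadow_cvg n : (fun k => pullback c' w k n) @ \oo --> shadow c' w n.
Proof.
apply: (@geometric_cvg _ _ e lam); rewrite ?ltW //.
by move=> k; exact: pullback_cauchy.
Qed.

Lemma shadow_close n : cabs (w n - shadow c' w n) <= kap * cabs (c - c').
Proof.
apply: (ccvg_le (@shadow_cvg n)).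
by exists 0%N => k _; exact: pullback_close.
Qed.

Lemma shadow_orbit : orbit c' (shadow c' w).
Proof.
move=> n; rewrite /corr /=.
have H1 : (fun k => pullback c' w k.+1 n ^+ p) @ \oo --> shadow c' w n ^+ p.
  apply: ccvgX.
  by have := @shadow_cvg n; rewrite -cvg_shiftS.
have H2 : (fun k => (pullback c' w k n.+1 - c') ^+ q) @ \oo --> (shadow c' w n.+1 - c') ^+ q.
  apply: ccvgX.
  by apply: cvgB; [exact: shadow_cvg | exact: cvg_cst].
apply: (cvg_unique _ H2); first exact: norm_hausdorff.
move: H1; rewrite (_ : (fun k => pullback c' w k.+1 n ^+ p) =
  (fun k => (pullback c' w k n.+1 - c') ^+ q)) //.
by apply/funext => k; rewrite -(pullback_corr k n).
Qed.

End Pullback.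

Lemma orbit_contr c c' w w' : cabs c <= rho -> cabs c' <= rho ->
  orbit c w -> orbit c' w' -> (forall n, ann (4 * e) (w n)) ->
  (forall n, cabs (w n - w' n) <= 2 * e) ->
  forall n, cabs (w n - w' n) <= kap * cabs (c - c').
Proof.
move=> cr cr' wo wo' wa ww' n.
have e0' := e0; have rhoe' := rhoe.
have := @sup_contraction _ (fun n => cabs (w n - w' n)) lam (lam * cabs (c - c')) (2 * e).
rewrite /kap => H; rewrite mulrAC; apply: H => //.
- exact: ltW.
- by rewrite mulr_ge0 ?cabs_ge0 // ltW.
- move=> k; rewrite -mulrDr.
  have := step_contr (wo k) (wo' k) (wa k) (wa k.+1) (ww' k) (ww' k.+1) (le_trans cr rhoe) (le_trans cr' rhoe).
  move=> H; apply: le_trans H _; rewrite ler_pM2l //.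
  rewrite (_ : _ - _ - _ = (w k.+1 - w' k.+1) - (c - c')); last by ring.
  exact: cabsB.
Qed.

(** Expansivity: a difference that stays bounded for all future times is damped
    to zero on its way back to the present. *)
Lemma orbit_unique c w w' : cabs c <= rho ->
  orbit c w -> orbit c w' -> (forall n, ann (4 * e) (w n)) ->
  (forall n, cabs (w n - w' n) <= 2 * e) -> w = w'.
Proof.
move=> cr wo wo' wa ww'; apply/funext => n; apply/eqP; rewrite -cabs_sub0 eq_le cabs_ge0 andbT.
by have := orbit_contr cr cr wo wo' wa ww' n; rewrite subrr cabs0 mulr0.
Qed.

End Shadowing.

(** * Complex derivatives and the multipliers of branches *)

Section ComplexDerivative.
Variable R : realType.
Local Notation C := (C R).
Implicit Types (f g : C -> C) (z l m : C).

(** The complex derivative as a linear approximation with real error bounds,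
    which composes more easily than a limit of difference quotients. *)
Definition has_der f z l := forall e : R, 0 < e -> exists2 d : R, 0 < d &
  forall w, cabs (w - z) < d -> cabs (f w - f z - l * (w - z)) <= e * cabs (w - z).

Lemma has_der_cvg f z l :
  has_der f z l <-> h^-1 *: (f (h + z) - f z) @[h --> (0 : C)^'] --> l.
Proof.
split=> [H|/ccvgP H].
  apply/ccvgP => e e0.
  have e2 : 0 < e / 2 by rewrite divr_gt0.
  have [d d0 dP] := H _ e2.
  apply/cnbhsP; exists d => // w; rewrite sub0r cabsN => wd w0.
  have := dP (w + z); rewrite addrK => /(_ wd) B.
  rewrite /GRing.scale /= -(mulKf w0 l) -mulrBr cabsM cabsV (mulrC w l) cabsC.
  have w0' : 0 < cabs w by rewrite cabs_gt0.
  rewrite ltr_pdivrMl // [ltRHS]mulrC; apply: le_lt_trans B _; rewrite ltr_pM2r //; lra.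
move=> e e0; have /cnbhsP[d d0 dP] := H _ e0; exists d => // w wd.
have [->|wz] := eqVneq w z; first by rewrite !subrr mulr0 subr0 cabs0 mulr0.
have wz0 : w - z != 0 by rewrite subr_eq0.
have := dP (w - z); rewrite sub0r cabsN => /(_ wd wz0); rewrite subrK => B.
have w0' : 0 < cabs (w - z) by rewrite cabs_gt0.
rewrite -(mulVKf wz0 (f w - f z)) (mulrC l) -mulrBr cabsM mulrC ler_pM2r // cabsC.
exact: ltW.
Qed.

Lemma scale1C (h : C) : h *: (1 : C) = h.
Proof. exact: mulr1. Qed.

Lemma has_der_derivable f z l : has_der f z l -> derivable f z 1.
Proof.
move=> /has_der_cvg H; apply/cvg_ex; exists l.
by under eq_fun do rewrite scale1C.
Qed.

Lemma has_der1 f z l : has_der f z l -> derive1 f z = l.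
Proof. by move=> /has_der_cvg; apply: cvg_lim; exact: norm_hausdorff. Qed.

Lemma derivable_has_der f z : derivable f z 1 -> has_der f z (derive1 f z).
Proof.
move=> /cvg_ex[l H]; have Hl : has_der f z l.
  by apply/has_der_cvg; move: H; under eq_fun do rewrite scale1C.
by rewrite (has_der1 Hl).
Qed.

Lemma has_der_uniq f z l m : has_der f z l -> has_der f z m -> l = m.
Proof. by move=> /has_der1 <- /has_der1 <-. Qed.

Lemma has_der_near f g z l : (exists2 d : R, 0 < d & forall w, cabs (w - z) < d -> f w = g w) ->
  has_der f z l -> has_der g z l.
Proof.
move=> [d d0 fg] H e e0; have [d' d0' H'] := H _ e0.
exists (Num.min d d') => [|w]; first by rewrite lt_min d0.
rewrite lt_min => /andP[wd wd']; rewrite -!fg ?subrr ?cabs0 //; exact: H'.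
Qed.

Lemma has_der_lip f z l : has_der f z l ->
  exists2 d : R, 0 < d & forall w, cabs (w - z) < d ->
    cabs (f w - f z) <= (cabs l + 1) * cabs (w - z).
Proof.
move=> H; have [d d0 dP] := H _ ltr01; exists d => // w /dP B.
by have := cabs_dist (f w - f z) (l * (w - z)); rewrite cabsM mulrDl; lra.
Qed.

Lemma has_der_cont f z l : has_der f z l ->
  forall e : R, 0 < e -> exists2 d : R, 0 < d & forall w, cabs (w - z) < d -> cabs (f w - f z) < e.
Proof.
move=> /has_der_lip[d d0 H] e e0.
have c0 : 0 < cabs l + 1 by rewrite ltr_wpDl ?cabs_ge0.
exists (Num.min d (e / (cabs l + 1))) => [|w].
  by rewrite lt_min d0 divr_gt0.
rewrite lt_min => /andP[/H wd wd']; apply: le_lt_trans wd _.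
by rewrite mulrC -ltr_pdivlMr.
Qed.

Lemma has_der_cst (a z : C) : has_der (fun=> a) z 0.
Proof. by move=> e e0; exists 1 => // w _; rewrite subrr mul0r subr0 cabs0 mulr_ge0 ?cabs_ge0 ?ltW. Qed.

Lemma has_der_id z : has_der id z 1.
Proof. by move=> e e0; exists 1 => // w _; rewrite mul1r subrr cabs0 mulr_ge0 ?cabs_ge0 ?ltW. Qed.

Lemma has_der_shift f z l c : has_der f z l -> has_der (fun w => f w - c) z l.
Proof.
move=> H e e0; have [d d0 dP] := H _ e0; exists d => // w /dP.
by rewrite (_ : f w - c - (f z - c) = f w - f z) //; ring.
Qed.

Lemma has_der_mul f g z l m : has_der f z l -> has_der g z m ->
  has_der (fun w => f w * g w) z (l * g z + f z * m).
Proof.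
move=> Hf Hg e e0.
pose K := cabs (f z) + cabs (g z) + cabs l + 1.
have K0 : 0 < K by rewrite ltr_wpDl ?addr_ge0 ?cabs_ge0.
have e3 : 0 < e / 3 by rewrite divr_gt0.
have eK : 0 < e / 3 / K by rewrite divr_gt0.
have [d1 d10 H1] := Hf _ eK; have [d2 d20 H2] := Hg _ eK.
have [d3 d30 H3] := has_der_lip Hf.
have [d4 d40 H4] := has_der_cont Hg eK.
exists (Num.min (Num.min d1 d2) (Num.min d3 d4)) => [|w].
  by rewrite !lt_min d10 d20 d30.
rewrite !lt_min => /andP[/andP[w1 w2] /andP[w3 w4]].
have -> : f w * g w - f z * g z - (l * g z + f z * m) * (w - z) =
  g z * (f w - f z - l * (w - z)) + f z * (g w - g z - m * (w - z)) + (f w - f z) * (g w - g z).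
  by ring.
have E : e = e / 3 + e / 3 + e / 3 by field.
rewrite [in leRHS]E [leRHS]mulrDl [X in _ <= X + _]mulrDl.
have S x a (B : R) : 0 <= a -> a <= K -> B <= e / 3 / K * x -> 0 <= x -> a * B <= e / 3 * x.
  move=> a0 aK Bx x0; apply: le_trans (ler_wpM2l a0 Bx) _.
  rewrite (_ : a * _ = e / 3 * x * (a / K)); last by ring.
  apply: ler_piMr; last by rewrite ler_pdivrMr // mul1r.
  by apply: mulr_ge0 => //; exact: ltW.
apply: le_trans (cabsD _ _) _; apply: lerD; first apply: le_trans (cabsD _ _) _; first apply: lerD.
- rewrite cabsM; apply: S (H1 _ w1) _; rewrite ?cabs_ge0 // /K.
  by have := cabs_ge0 (f z); have := cabs_ge0 l; lra.
- rewrite cabsM; apply: S (H2 _ w2) _; rewrite ?cabs_ge0 // /K.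
  by have := cabs_ge0 (g z); have := cabs_ge0 l; lra.
- rewrite cabsM; apply: le_trans (ler_wpM2r (cabs_ge0 _) (H3 _ w3)) _.
  rewrite -[leLHS]mulrA; apply: (S _ _ _ _ _ _ (cabs_ge0 (w - z))).
  + by rewrite addr_ge0 ?cabs_ge0.
  + by rewrite /K; have := cabs_ge0 (f z); have := cabs_ge0 (g z); lra.
  + by rewrite mulrC; apply: ler_wpM2r; [exact: cabs_ge0 | exact/ltW/H4].
Qed.

Lemma has_der_pow f z l n : has_der f z l ->
  has_der (fun w => f w ^+ n) z (n%:R * f z ^+ n.-1 * l).
Proof.
move=> H; elim: n => [|n IH].
  by rewrite !mul0r; exact: has_der_cst.
have := has_der_mul H IH.
have -> : l * f z ^+ n + f z * (n%:R * f z ^+ n.-1 * l) = n.+1%:R * f z ^+ n.+1.-1 * l.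
  by case: n {IH} => [|n] /=; rewrite ?exprS ?expr0 -?natr1; ring.
apply: has_der_near; exists 1 => // w _; exact/esym/exprS.
Qed.

Lemma has_der_comp f g z l m : has_der f z l -> has_der g (f z) m ->
  has_der (g \o f) z (m * l).
Proof.
move=> Hf Hg e e0.
pose K := cabs l + 1 + cabs m.
have K0 : 0 < K by rewrite /K; have := cabs_ge0 l; have := cabs_ge0 m; lra.
have e2 : 0 < e / 2 / K by rewrite !divr_gt0.
have [d1 d10 H1] := Hf _ e2; have [d2 d20 H2] := Hg _ e2.
have [d3 d30 H3] := has_der_lip Hf.
have [d4 d40 H4] := has_der_cont Hf d20.
exists (Num.min d1 (Num.min d3 d4)) => [|w].
  by rewrite !lt_min d10 d30.
rewrite !lt_min => /andP[w1 /andP[w3 w4]] /=.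
have -> : g (f w) - g (f z) - m * l * (w - z) =
  (g (f w) - g (f z) - m * (f w - f z)) + m * (f w - f z - l * (w - z)) by ring.
have x0 := cabs_ge0 (w - z).
have e20 := ltW e2.
apply: le_trans (cabsD _ _) _; rewrite cabsM.
have A := le_trans (H2 _ (H4 _ w4)) (ler_wpM2l e20 (H3 _ w3)).
have B := ler_wpM2l (cabs_ge0 m) (H1 _ w1).
apply: le_trans (lerD A B) _.
have -> : e / 2 / K * ((cabs l + 1) * cabs (w - z)) + cabs m * (e / 2 / K * cabs (w - z)) =
  e / 2 / K * K * cabs (w - z) by rewrite /K; ring.
by rewrite divfK ?gt_eqF //; apply: ler_wpM2r => //; lra.
Qed.

End ComplexDerivative.

Section Branches.
Variables (R : realType) (p q : nat).
Local Notation C := (C R).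

(** Where phi differs from c the q-th power has an invertible derivative at
    phi - c, so the equation (phi - c) ^ q = z ^ p determines a continuous phi
    to first order. *)
Lemma branch_has_der (c z : C) (phi : C -> C) : (0 < q)%N -> phi z != c ->
  (forall e : R, 0 < e -> exists2 d : R, 0 < d & forall w, cabs (w - z) < d ->
      corr p q c w (phi w) /\ cabs (phi w - phi z) < e) ->
  has_der phi z (p%:R * z ^+ p.-1 / (q%:R * (phi z - c) ^+ q.-1)).
Proof.
move=> q0 Ac H e e0.
set A := phi z - c; set m := q%:R * A ^+ q.-1; set n := p%:R * z ^+ p.-1.
have m0 : m != 0 by rewrite mulf_neq0 ?pnatr_eq0 -?lt0n // expf_neq0 // subr_eq0.
have m0' : 0 < cabs m by rewrite cabs_gt0.
have HF := @has_der_pow R id A 1 q (@has_der_id R A).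
have HG := @has_der_pow R id z 1 p (@has_der_id R z).
rewrite mulr1 -/m in HF; rewrite mulr1 -/n in HG.
pose L := 2 * (cabs n + 1) / cabs m.
have L0 : 0 < L by rewrite /L divr_gt0 // mulr_gt0 // ltr_wpDl ?cabs_ge0.
pose e' := e * cabs m / (L + 1).
have e'0 : 0 < e' by rewrite /e' !divr_gt0 ?mulr_gt0 // ltr_wpDl // ltW.
pose e1 := Num.min (cabs m / 2) e'.
have e10 : 0 < e1 by rewrite /e1 lt_min divr_gt0.
have [d1 d10 D1] := HF _ e10; have [d2 d20 D2] := HG _ e'0.
have [d3 d30 D3] := has_der_lip HG.
have [d4 d40 D4] := H _ d10.
have [d5 d50 D5] := H _ e0.
exists (Num.min (Num.min d2 d3) (Num.min d4 d5)) => [|w].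
  by rewrite !lt_min d20 d30 d40.
rewrite !lt_min => /andP[/andP[w2 w3] /andP[w4 _]].
have /D5 : cabs (z - z) < d5 by rewrite subrr cabs0.
rewrite /corr /= -/A => -[Ez _].
have [Ew lt1] := D4 _ w4; rewrite /corr /= in Ew.
have Aw : phi w - c - A = phi w - phi z by rewrite /A; ring.
have := D1 (phi w - c); rewrite Aw => /(_ lt1) /=; rewrite Ew Ez => F1.
have /= G1 := D2 _ w2; have /= G2 := D3 _ w3.
set x := phi w - phi z in Aw F1 *; set h := w - z in G1 G2 *; set y := w ^+ p - z ^+ p in F1 G1 G2.
have xL : cabs x <= L * cabs h.
  have := cabs_dist (m * x) y; rewrite (cabsC _ y) cabsM => B.
  have e1m : e1 <= cabs m / 2 by rewrite /e1 ge_min lexx.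
  have := ler_wpM2r (cabs_ge0 x) e1m => B'.
  rewrite -(ler_pM2l m0') (_ : cabs m * (L * cabs h) = 2 * ((cabs n + 1) * cabs h)); last first.
    by rewrite /L; field; rewrite gt_eqF.
  by lra.
rewrite -(ler_pM2l m0') -cabsM.
have -> : m * (x - n / m * h) = (y - n * h) - (y - m * x) by field.
apply: le_trans (cabsB _ _) _.
have e1e : e1 <= e' by rewrite /e1 ge_min lexx orbT.
apply: le_trans (lerD G1 F1) _.
have h0 := cabs_ge0 h.
have : e1 * cabs x <= e' * (L * cabs h) by apply: ler_pM => //; rewrite ?cabs_ge0 ?ltW.
have : cabs m * (e * cabs h) = e' * (L + 1) * cabs h.
  by rewrite /e' divfK ?gt_eqF // ?ltr_wpDl // ?ltW //; ring.
by move=> -> ?; lra.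
Qed.

Lemma branch_at_has_der (c z : C) phi : branch_at p q c z phi -> has_der phi z (derive1 phi z).
Proof. by move=> [D Dz [_ hol _]]; apply: derivable_has_der; exact: hol. Qed.

(** Differentiating [(phi - c) ^+ q = z ^+ p]. *)
Lemma branch_derive1 (c z : C) phi : branch_at p q c z phi ->
  q%:R * (phi z - c) ^+ q.-1 * derive1 phi z = p%:R * z ^+ p.-1.
Proof.
move=> B; have H := has_der_pow q (has_der_shift c (branch_at_has_der B)).
have := has_der_pow p (@has_der_id R z); rewrite mulr1 => H'.
apply: has_der_uniq H'; apply: has_der_near H.
case: B => D Dz [oD _ Dc].
have /cnbhsP[e e0 eP] : nbhs z D by exact: open_nbhs_nbhs.
by exists e => // w; rewrite cabsC => /eP /Dc.
Qed.

Lemma comp_branches_has_der (c : C) (z : nat -> C) (phi : nat -> C -> C) n :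
  (forall k, (k < n)%N -> branch_at p q c (z k) (phi k) /\ phi k (z k) = z k.+1) ->
  comp_branches phi n (z 0%N) = z n /\
  has_der (comp_branches phi n) (z 0%N) (\prod_(k < n) derive1 (phi k) (z k)).
Proof.
elim: n => [|n IH] H; first by rewrite big_ord0; split=> //; exact: has_der_id.
have [|E D] := IH; first by move=> k kn; apply: H; exact: ltnW.
have [B F] := H n (ltnSn n); split; first by rewrite /= E.
rewrite big_ord_recr /= mulrC; apply: has_der_comp D _.
by rewrite E; exact: branch_at_has_der B.
Qed.

(** Eliminating |phi z - c| by |phi z - c| ^ q = |z| ^ p leaves a quantity that
    depends neither on the branch nor on c. *)
Lemma branch_cabs_derive1 (c z : C) phi : (0 < q)%N -> (q <= p)%N -> z != 0 ->
  branch_at p q c z phi ->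
  cabs (derive1 phi z) ^+ q = (p%:R / q%:R) ^+ q * cabs z ^+ (p - q).
Proof.
move=> q0 qp z0 B; have := branch_derive1 B.
have : (phi z - c) ^+ q = z ^+ p by case: B => D Dz [_ _ /(_ _ Dz)].
move=> /(congr1 (@cabs R)); rewrite !cabsX => E /(congr1 (@cabs R)).
rewrite !cabsM !cabs_nat !cabsX.
set a := cabs (phi z - c) in E *; set x := cabs z in E *; set y := cabs _ => H.
have x0 : 0 < x by rewrite cabs_gt0.
have p0 : (0 < p)%N by exact: leq_trans qp.
have a0 : 0 < a.
  rewrite lt0r cabs_ge0 andbT; apply/negP => /eqP a0; move/esym/eqP: E.
  by rewrite a0 expr0n gtn_eqF // expf_eq0 (gt_eqF x0) andbF.
have := congr1 (fun u => u ^+ q) H; rewrite !exprMn -!exprM.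
have -> : (q.-1 * q = q * q.-1)%N by rewrite mulnC.
rewrite exprM E -exprM => H'.
have X0 : x ^+ (p * q.-1) != 0 by rewrite expf_neq0 // gt_eqF.
have Q0 : (q%:R : R) ^+ q != 0 by rewrite expf_neq0 // pnatr_eq0 -lt0n.
have e1 : (p.-1 * q = p * q.-1 + (p - q))%N.
  by rewrite -!subn1 mulnBl mulnBr !muln1 mul1n; nia.
rewrite e1 exprD in H'.
rewrite exprVn; apply: (mulfI X0); apply: (mulfI Q0).
rewrite mulrA H'; field; exact: Q0.
Qed.

End Branches.

(** * The code of an orbit *)

Section Tails.
Variables (R : realType).
Local Notation C := (C R).
Implicit Types w v : nat -> C.

Definition tail (n : nat) w := fun k => w (n + k)%N.
Definition bounded_by (M : R) w := forall n, cabs (w n) <= M.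

Lemma tail_bounded M n w : bounded_by M w -> bounded_by M (tail n w).
Proof. by move=> H k; exact: H. Qed.

Lemma tailS n w : tail 1 (tail n w) = tail n.+1 w.
Proof. by apply/funext => k; rewrite /tail; congr w; lia. Qed.

Lemma tail0 w : tail 0 w = w.
Proof. by apply/funext. Qed.

End Tails.

Section Code.
Variables (R : realType) (r d : R).
Local Notation C := (C R).
Hypotheses (r0 : 0 <= r) (d0 : 0 < d) (d1 : d < 1).
Implicit Types w v : nat -> C.

Let dB : 0 < 1 - d. Proof. by rewrite subr_gt0. Qed.

Definition code_series w := series (fun n => ofR d ^+ n * w n.+1).

Lemma code_seriesS w n : code_series w n.+1 = code_series w n + ofR d ^+ n * w n.+1.
Proof. by rewrite /code_series /series /= big_nat_recr. Qed.

Lemma code_cvg M w : bounded_by M w -> code_series w @ \oo --> limn (code_series w).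
Proof.
move=> wM; apply: (@geometric_cvg _ _ M d) => //; first exact: ltW.
move=> n; rewrite code_seriesS addrC addKr cabsM cabsX cabs_ofR ger0_norm ?(ltW d0) //.
by rewrite mulrC; apply: ler_wpM2r; rewrite ?exprn_ge0 ?(ltW d0).
Qed.

Lemma code_bound M w : bounded_by M w -> cabs (orbit_code r d w) <= r * M / (1 - d).
Proof.
move=> wM; rewrite /orbit_code cabsM cabs_ofR ger0_norm // -mulrA; apply: ler_wpM2l => //.
have M0 : 0 <= M by exact: le_trans (cabs_ge0 _) (wM 0%N).
rewrite -[X in X <= _]cabsN -sub0r; apply: ccvg_le (code_cvg wM) _.
exists 0%N => n _; rewrite sub0r cabsN.
have H : cabs (code_series w n) <= M * (1 - d ^+ n) / (1 - d).
  elim: n => [|n IH].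
    by rewrite /code_series /series /= big_geq // cabs0 expr0 subrr mulr0 mul0r.
  rewrite code_seriesS; apply: le_trans (cabsD _ _) _.
  have -> : M * (1 - d ^+ n.+1) / (1 - d) = M * (1 - d ^+ n) / (1 - d) + M * d ^+ n.
    by rewrite exprS; field; rewrite gt_eqF.
  apply: lerD => //; rewrite cabsM cabsX cabs_ofR ger0_norm ?(ltW d0) // mulrC.
  by apply: ler_wpM2r; rewrite ?exprn_ge0 ?(ltW d0).
apply: le_trans H _; rewrite ler_pM2r ?invr_gt0 //.
rewrite -[leRHS]mulr1; apply: ler_wpM2l => //.
by have := exprn_ge0 n (ltW d0); lra.
Qed.

Lemma code_rec M w : bounded_by M w ->
  orbit_code r d w = ofR r * w 1%N + ofR d * orbit_code r d (tail 1 w).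
Proof.
move=> wM; rewrite /orbit_code mulrCA -mulrDr; congr (_ * _).
have E n : code_series w n.+1 = w 1%N + ofR d * code_series (tail 1 w) n.
  elim: n => [|n IH].
    by rewrite code_seriesS /code_series /series /= !big_geq // expr0 mul1r mulr0 addr0 add0r.
  by rewrite code_seriesS IH code_seriesS /tail /= exprS mulrDr addrA mulrA.
have H1 : (fun n => code_series w n.+1) @ \oo --> limn (code_series w).
  by have := code_cvg wM; rewrite -cvg_shiftS.
have H2 : (fun n => w 1%N + ofR d * code_series (tail 1 w) n) @ \oo -->
    w 1%N + ofR d * limn (code_series (tail 1 w)).
  apply: cvgD; first exact: cvg_cst.
  by apply: cvgM; [exact: cvg_cst | exact: (code_cvg (tail_bounded 1 wM))].
apply: (cvg_unique _ H1); first exact: norm_hausdorff.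
by rewrite (_ : (fun n => _) = fun n => w 1%N + ofR d * code_series (tail 1 w) n) //; apply/funext.
Qed.

Lemma code_recB M w : bounded_by M w ->
  orbit_code r d (tail 1 w) = (ofR d)^-1 * orbit_code r d w - ofR r * (ofR d)^-1 * w 1%N.
Proof.
move=> wM; have dN : ofR d != 0 by rewrite -ofR0 (inj_eq (@ofR_inj R)) gt_eqF.
by rewrite (code_rec wM); field.
Qed.

(** Three orbits are involved because the difference of two difference quotients
    with the same base point is a combination of three values. The code is not
    summed: [code_rec] and [sup_contraction] give the bound. *)
Lemma code_lincomb M w1 w2 w3 (a1 a2 a3 : C) (x : R) : 0 <= x ->
  bounded_by M w1 -> bounded_by M w2 -> bounded_by M w3 ->
  (forall n, cabs (a1 * w1 n.+1 + a2 * w2 n.+1 + a3 * w3 n.+1) <= x) ->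
  cabs (a1 * orbit_code r d w1 + a2 * orbit_code r d w2 + a3 * orbit_code r d w3)
    <= r * x / (1 - d).
Proof.
move=> x0 b1 b2 b3 H.
pose D n := cabs (a1 * orbit_code r d (tail n w1) + a2 * orbit_code r d (tail n w2)
  + a3 * orbit_code r d (tail n w3)).
have := @sup_contraction R D d (r * x) ((cabs a1 + cabs a2 + cabs a3) * (r * M / (1 - d))) (ltW d0) d1.
move=> /(_ (mulr_ge0 r0 x0)) S; have := S _ _ 0%N; rewrite /D !tail0; apply => n.
  have B (a : C) w : bounded_by M w ->
      cabs (a * orbit_code r d (tail n w)) <= cabs a * (r * M / (1 - d)).
    by move=> bw; rewrite cabsM; apply: ler_wpM2l; [exact: cabs_ge0 | exact/code_bound/tail_bounded].
  rewrite !mulrDl; apply: le_trans (cabsD _ _) _; apply: lerD; last exact: B.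
  by apply: le_trans (cabsD _ _) _; apply: lerD; exact: B.
rewrite (code_rec (tail_bounded n b1)) (code_rec (tail_bounded n b2)) (code_rec (tail_bounded n b3)) !tailS.
have -> : forall u1 u2 u3 v1 v2 v3 : C,
  a1 * (ofR r * u1 + ofR d * v1) + a2 * (ofR r * u2 + ofR d * v2) + a3 * (ofR r * u3 + ofR d * v3) =
  ofR d * (a1 * v1 + a2 * v2 + a3 * v3) + ofR r * (a1 * u1 + a2 * u2 + a3 * u3) by move=> *; ring.
apply: le_trans (cabsD _ _) _; rewrite !cabsM !cabs_ofR !ger0_norm ?(ltW d0) //.
rewrite lerD2l; apply: ler_wpM2l => //; rewrite /tail addn1; exact: H.
Qed.

Lemma code_dist M w v (x : R) : bounded_by M w -> bounded_by M v -> 0 <= x ->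
  (forall n, cabs (w n.+1 - v n.+1) <= x) ->
  cabs (orbit_code r d w - orbit_code r d v) <= r * x / (1 - d).
Proof.
move=> bw bv x0 H; have := @code_lincomb M w v w 1 (-1) 0 x x0 bw bv bw.
by rewrite mul0r addr0 mulN1r mul1r; apply => n; rewrite mul0r addr0 mulN1r mul1r.
Qed.

(** Beyond time [N] nothing is assumed, but the tails of the codes are damped by
    [d ^+ N]. *)
Lemma code_dist_fin M w v (x : R) N : bounded_by M w -> bounded_by M v -> 0 <= x ->
  (forall n, (n < N)%N -> cabs (w n.+1 - v n.+1) <= x) ->
  cabs (orbit_code r d w - orbit_code r d v) <= r * x / (1 - d) + 2 * (r * M / (1 - d)) * d ^+ N.
Proof.
move=> bw bv x0 H.
pose D n := cabs (orbit_code r d (tail n w) - orbit_code r d (tail n v)) - r * x / (1 - d).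
suff : D 0%N <= 2 * (r * M / (1 - d)) * d ^+ (N - 0) by rewrite /D !tail0 subn0 lerBlDl.
apply: (@finite_contraction R D d _ N (ltW d0) _ _ 0%N) => //; rewrite /D.
  move=> n nN.
  rewrite (code_rec (tail_bounded n bw)) (code_rec (tail_bounded n bv)) !tailS.
  have -> : forall u1 u2 v1 v2 : C,
    (ofR r * u1 + ofR d * v1) - (ofR r * u2 + ofR d * v2) =
    ofR d * (v1 - v2) + ofR r * (u1 - u2) by move=> *; ring.
  rewrite lerBlDr; apply: le_trans (cabsD _ _) _; rewrite !cabsM !cabs_ofR !ger0_norm ?(ltW d0) //.
  apply: (@le_trans _ _ (d * cabs (orbit_code r d (tail n.+1 w) - orbit_code r d (tail n.+1 v)) + r * x)).
    by rewrite lerD2l; apply: ler_wpM2l => //; rewrite /tail addn1; exact: H.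
  by rewrite le_eqVlt; apply/orP; left; apply/eqP; field; rewrite gt_eqF.
have B1 := code_bound (tail_bounded N bw); have B2 := code_bound (tail_bounded N bv).
have B3 := cabsB (orbit_code r d (tail N w)) (orbit_code r d (tail N v)).
have B4 : 0 <= r * x / (1 - d) by rewrite divr_ge0 ?mulr_ge0 ?(ltW dB).
by move: B1 B2 B3 B4; move: (cabs _) (cabs _) (cabs _) (_ / _) (_ / _) => *; lra.
Qed.

(** Read forwards, the recursion multiplies differences by 1 / d, so it has at
    most one bounded solution. *)
Lemma code_unique M B w (s : nat -> C) : bounded_by M w -> bounded_by B s ->
  (forall n, s n = ofR r * w n.+1 + ofR d * s n.+1) -> s 0%N = orbit_code r d w.
Proof.
move=> bw bs H; apply/eqP; rewrite -cabs_sub0 eq_le cabs_ge0 andbT.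
pose D n := cabs (s n - orbit_code r d (tail n w)).
have := @sup_contraction R D d 0 (B + r * M / (1 - d)) (ltW d0) d1 (lexx _).
rewrite mul0r => S; have := S _ _ 0%N; rewrite /D tail0; apply => n.
  apply: le_trans (cabsB _ _) _; apply: lerD; first exact: bs.
  by apply: code_bound; exact: tail_bounded.
rewrite addr0 {1}H (code_rec (tail_bounded n bw)) tailS /tail addn1.
rewrite (_ : _ - _ = ofR d * (s n.+1 - orbit_code r d (tail n.+1 w))); last by rewrite /tail; ring.
by rewrite cabsM cabs_ofR ger0_norm // ltW.
Qed.

End Code.

(** * Orbits in an annulus and their deformation *)

Section CircleOrbits.
Variables (R : realType) (p q : nat) (lam e rho : R).
Local Notation C := (C R).
Hypothesis G : shadow_params p q lam e rho.
Local Notation orbit := (orbit p q).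
Local Notation kap := (kap lam).

Let e0 := par_e0 G.
Let e1 := par_e1 G.
Let rhoe := par_rhoe G.
Let p0 := par_p0 G.
Let q0 := par_q0 G.

Definition ann_orbit (c : C) (w : nat -> C) := orbit c w /\ forall n, ann e (w n).

(** For small c this turns out to be the Julia set, see [julia_ann]. *)
Definition ann_set (c : C) : set C :=
  [set z | exists2 w, ann_orbit c w & z = w 0%N].

Lemma kap_half c : cabs c <= rho -> kap * cabs c + cabs c <= e / 2.
Proof.
move=> cr; rewrite -{2}(mul1r (cabs c)) -mulrDl (kapD1 G).
have lb := par_lamB G.
have := par_shadow G; rewrite ler_pdivrMr // ler_pdivrMl // => H.
by rewrite mulrC; lra.
Qed.

Lemma kap_half' c : cabs c <= rho -> kap * cabs c <= e / 2.
Proof. by move=> /kap_half; have := cabs_ge0 c; lra. Qed.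

Lemma ann_orbit_tail c n w : ann_orbit c w -> ann_orbit c (tail n w).
Proof.
move=> [wo wa]; split=> k; last exact: wa.
by rewrite /tail addnS; exact: wo.
Qed.

Lemma ann_set_orbit c w : orbit_in p q c (ann_set c) w <-> ann_orbit c w.
Proof.
split=> [H|[wo wa] n]; first split=> n.
- by case: (H n).
- by case: (H n) => -[v [_ va] ->].
- split; last exact: wo.
  exists (tail n w); last by rewrite /tail addn0.
  exact: ann_orbit_tail.
Qed.

(** On moduli |z| ^ p = |w - c| ^ q, and p > q moves |z| towards 1. *)
Lemma corr_ann (c z w : C) (x : R) : 0 <= x -> x <= 1 -> corr p q c z w ->
  1 - x <= cabs (w - c) <= 1 + x -> ann x z.
Proof.
move=> x0 x1; rewrite /corr /= => /(congr1 (@cabs R)); rewrite !cabsX => E /andP[h1 h2].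
have qp : (q <= p)%N by exact: ltnW (par_pq G).
apply/andP; split; rewrite -(@ler_pXn2r _ p) ?nnegrE ?cabs_ge0 ?p0 ?subr_ge0 ?addr_ge0 //.
- rewrite -E; apply: (@le_trans _ _ ((1 - x) ^+ q)); last by apply: lerXn2r; rewrite ?nnegrE ?cabs_ge0 ?subr_ge0.
  by rewrite -(subnK qp) exprD; apply: ler_piMl; rewrite ?exprn_ge0 ?exprn_ile1 ?subr_ge0 //; lra.
- rewrite -E; apply: (@le_trans _ _ ((1 + x) ^+ q)); first by apply: lerXn2r; rewrite ?nnegrE ?cabs_ge0 ?addr_ge0.
  by rewrite -(subnK qp) exprD; apply: ler_peMl; rewrite ?exprn_ge0 ?exprn_ege1 ?addr_ge0 //; lra.
Qed.

Lemma ann_orbit_unique c w w' : cabs c <= rho -> ann_orbit c w -> orbit c w' ->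
  (forall n, cabs (w n - w' n) <= 2 * e) -> w = w'.
Proof.
move=> cr [wo wa] wo' ww'; apply: (orbit_unique G cr wo wo' _ ww') => n.
by apply: ann_le (wa n); have := e0; lra.
Qed.

Lemma cabs_c0 : cabs (0 : C) <= rho.
Proof. by rewrite cabs0; exact: ltW (par_rho0 G). Qed.

(** The moduli of an orbit of f_0 form an orbit of f_0, as does the constant 1;
    expansivity identifies them. *)
Lemma orbit0_unit u : orbit 0 u -> (forall n, ann (2 * e) (u n)) -> forall n, cabs (u n) = 1.
Proof.
move=> uo ua n.
have o1 : ann_orbit 0 (fun=> 1).
  split=> k; first by rewrite /corr /= subr0 !expr1n.
  by rewrite /ann cabs1; have e0' := e0; apply/andP; split; lra.
have o2 : orbit 0 (fun k => ofR (cabs (u k))).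
  move=> k; rewrite /corr /= subr0 -!ofRX -!cabsX; congr (ofR (cabs _)).
  by have := uo k; rewrite /corr /= subr0.
have key : (fun=> 1) = (fun k => ofR (cabs (u k))).
  apply: (ann_orbit_unique cabs_c0 o1 o2) => k.
  rewrite -ofR1 -ofRB cabs_ofR ler_norml.
  by have /andP[h1 h2] := ua k; apply/andP; split; lra.
by apply: (@ofR_inj R); rewrite ofR1 (congr1 (fun f => f n) key).
Qed.

Lemma circle_orbit u : orbit_in p q 0 (@unit_circle R) u <-> ann_orbit 0 u.
Proof.
split=> [H|[uo ua] n].
  split=> n; first by case: (H n).
  by case: (H n); rewrite /unit_circle /= /ann => -> _; have e0' := e0; apply/andP; split; lra.
split; last exact: uo.
by apply: orbit0_unit => // k; apply: ann_le (ua k); have := e0; lra.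
Qed.

Lemma corr_image (c z : C) : exists w, corr p q c z w.
Proof.
have [a aP _] := root_near 0 (z ^+ p) q0; exists (c + a).
by rewrite /corr /= addrAC subrr add0r.
Qed.

Lemma corr_preimage (c w : C) : exists z, corr p q c z w.
Proof. by have [a aP _] := root_near 0 ((w - c) ^+ q) p0; exists a. Qed.

Lemma circle_ann : @unit_circle R = ann_set 0.
Proof.
apply/seteqP; split=> [z z1|z [w wo ->]]; last first.
  by have /circle_orbit/(_ 0%N)[] := wo.
pose u := fix u n := if n is m.+1 then xget 0 [set w | corr p q 0 (u m) w] else z.
have uo : orbit 0 u.
  by move=> n /=; case: xgetP => // H; have [w /H] := corr_image 0 (u n).
exists u => //; apply/circle_orbit => n; split=> //.
elim: n => [//|n IH]; rewrite /unit_circle /=.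
have := uo n; rewrite /corr /= subr0 => /(congr1 (@cabs R)); rewrite !cabsX.
rewrite (_ : cabs (u n) = 1) // expr1n => /eqP.
by rewrite pexpr_eq1 ?cabs_ge0 ?q0 // => /eqP.
Qed.

Section Motion.
Variable c : C.
Hypothesis cr : cabs c <= rho.

(** How an orbit of f_0 on the unit circle moves with the parameter. *)
Definition deform (u : nat -> C) : nat -> C := shadow p q c u.

Section Deformed.
Variable u : nat -> C.
Hypothesis uo : ann_orbit 0 u.

Let ua n : ann (2 * e) (u n).
Proof. by apply: ann_le (proj2 uo n); have := e0; lra. Qed.

Lemma deform_close n : cabs (u n - deform u n) <= kap * cabs c.
Proof.
have := shadow_close G cabs_c0 cr (proj1 uo) ua n.
by rewrite sub0r cabsN.
Qed.

Lemma deform_close2 n : cabs (u n - deform u n) <= e / 2.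
Proof. exact: le_trans (deform_close n) (kap_half' cr). Qed.

Lemma ann_unit n : cabs (u n) = 1.
Proof. exact: orbit0_unit (proj1 uo) ua n. Qed.

Lemma deform_ann : ann_orbit c (deform u).
Proof.
split; first exact: (shadow_orbit G cabs_c0 cr (proj1 uo) ua).
move=> n; have u1 : ann 0 (u n) by rewrite /ann ann_unit; apply/andP; split; lra.
by apply: ann_le (ann_close u1 (deform_close2 n)); have := e0; lra.
Qed.

Lemma deform_unique w : orbit c w -> (forall n, cabs (u n - w n) <= e) -> deform u = w.
Proof.
move=> wo uw; apply: (ann_orbit_unique cr deform_ann wo) => n.
apply: le_trans (cabs_tri (u n) _ _) _; rewrite (cabsC _ (u n)).
by have := deform_close2 n; have := uw n; have := e0; lra.
Qed.

End Deformed.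

Lemma deform_tail n u : ann_orbit 0 u -> deform (tail n u) = tail n (deform u).
Proof.
move=> uo; apply: deform_unique; first exact: ann_orbit_tail.
  by have [] := ann_orbit_tail n (deform_ann uo).
by move=> k; apply: le_trans (deform_close2 uo (n + k)) _; have := e0; lra.
Qed.

(** Shadowing works in both directions: the shadow in f_0 lies on the circle by
    [orbit0_unit], and its own shadow in f_c is the given orbit by uniqueness. *)
Lemma deform_onto w : ann_orbit c w -> exists2 u, ann_orbit 0 u & w = deform u.
Proof.
move=> [wo wa]; have e0' := e0.
have wa2 n : ann (2 * e) (w n) by apply: ann_le (wa n); lra.
have cl n : cabs (w n - shadow p q 0 w n) <= e / 2.
  apply: le_trans (shadow_close G cr cabs_c0 wo wa2 n) _.
  by rewrite subr0; exact: kap_half'.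
have so := shadow_orbit G cr cabs_c0 wo wa2.
have s1 : forall n, cabs (shadow p q 0 w n) = 1.
  apply: orbit0_unit => // n.
  by apply: ann_le (ann_close (wa n) (cl n)); lra.
have sr : ann_orbit 0 (shadow p q 0 w).
  by split=> // n; rewrite /ann s1; apply/andP; split; lra.
exists (shadow p q 0 w) => //; apply/esym/deform_unique => // n.
by rewrite cabsC; apply: le_trans (cl n) _; lra.
Qed.

Lemma deform_inj u v : ann_orbit 0 u -> ann_orbit 0 v -> deform u = deform v -> u = v.
Proof.
move=> uo vo E; apply: (ann_orbit_unique cabs_c0 uo (proj1 vo)) => n.
apply: le_trans (cabs_tri (deform u n) _ _) _; rewrite {2}E (cabsC _ (v n)).
by have := deform_close2 uo n; have := deform_close2 vo n; have := e0; lra.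
Qed.

(** Shadows of orbits that are close up to time [N] are within 2 e of each other
    up to then, and step by step backwards the distance contracts. *)
Lemma deform_finite u v N : ann_orbit 0 u -> ann_orbit 0 v ->
  (forall n, (n <= N)%N -> cabs (u n - v n) <= e) ->
  forall n, (n <= N)%N -> cabs (deform u n - deform v n) <= 2 * e * lam ^+ (N - n).
Proof.
move=> uo vo uv; have e0' := e0; have rhoe' := rhoe.
have ce : cabs c <= e by exact: le_trans rhoe.
have cl n : (n <= N)%N -> cabs (deform u n - deform v n) <= 2 * e.
  move=> nN; apply: le_trans (cabs_tri (u n) _ _) _; rewrite (cabsC _ (u n)).
  have := deform_close2 uo n; have := deform_close2 vo n; have := cabs_tri (v n) (u n) (deform v n).
  by have := uv n nN; lra.
apply: (@finite_contraction R (fun n => cabs (deform u n - deform v n))) => //.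
- exact: ltW (par_lam0 G).
- move=> n nN; have [mo ma] := deform_ann uo; have [mo' ma'] := deform_ann vo.
  have := step_contr G (mo n) (mo' n) _ _ (cl _ (ltnW nN)) (cl _ nN) ce ce.
  rewrite (_ : _ - c - _ = deform u n.+1 - deform v n.+1); last by ring.
  apply; first by apply: ann_le (ma n); lra.
  by apply: ann_le (ma n.+1); lra.
- exact: cl.
Qed.

(** A priori a preimage might leave the annulus. But an orbit in the annulus is
    a shadow, so by [kap_half] its points remain within e of modulus 1 even
    after c is subtracted, and [corr_ann] applies. *)
Lemma ann_set_preimage z w : ann_set c w -> corr p q c z w -> ann_set c z.
Proof.
move=> [v vo ->] zv; have [u uo E] := deform_onto vo; have e0' := e0; have e1' := e1.
exists (fun n => if n is m.+1 then v m else z) => //.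
have [vo1 va] := vo; split; first by case.
case=> [|n]; last exact: va.
apply: (corr_ann _ _ zv); [lra | lra |].
have h1 := deform_close uo 0; have h2 := kap_half cr; rewrite -E in h1.
have h3 := cabs_dist (u 0%N) (v 0%N - c); have h4 := cabs_dist (v 0%N - c) (u 0%N).
have := cabs_tri (v 0%N) (u 0%N) (v 0%N - c).
rewrite (cabsC (v 0%N - c)) in h4; rewrite (ann_unit uo) in h3 h4.
rewrite (_ : v 0%N - (v 0%N - c) = c); last by ring.
by move=> h5; apply/andP; split; lra.
Qed.

Lemma ann_set_semi z : ann_set c z ->
  (exists2 w, ann_set c w & corr p q c z w) /\ (exists2 w, ann_set c w & corr p q c w z).
Proof.
move=> zR; split.
  case: zR => w wo ->; exists (w 1%N); last by case: wo => + _; apply.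
  by exists (tail 1 w) => //; exact: ann_orbit_tail.
have [y yz] := corr_preimage c z; exists y => //.
exact: ann_set_preimage yz.
Qed.

End Motion.

Lemma deform_lip c c' u n : cabs c <= rho -> cabs c' <= rho -> ann_orbit 0 u ->
  cabs (deform c u n - deform c' u n) <= kap * cabs (c - c').
Proof.
move=> cr cr' uo; have e0' := e0.
have [mo ma] := deform_ann cr uo; have [mo' _] := deform_ann cr' uo.
apply: (orbit_contr G cr cr' mo mo') => [k|k].
  by apply: ann_le (ma k); lra.
apply: le_trans (cabs_tri (u k) _ _) _; rewrite (cabsC _ (u k)).
by have := deform_close2 cr uo k; have := deform_close2 cr' uo k; lra.
Qed.

Lemma move0 u : ann_orbit 0 u -> deform 0 u = u.
Proof.
move=> uo; apply: (deform_unique cabs_c0 uo (proj1 uo)) => n.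
by rewrite subrr cabs0 ltW.
Qed.

End CircleOrbits.

(** * Orbits on the unit circle *)

Section UnitCircle.
Variable R : realType.
Local Notation C := (C R).
Local Notation eit := (@eit R).
Implicit Types (s t x : R).

Lemma cabs_eit t : cabs (eit t) = 1.
Proof. by rewrite /cabs /= cos2Dsin2 sqrtr1. Qed.

Lemma eitD s t : eit (s + t) = eit s * eit t.
Proof.
apply/eqP; rewrite eq_complex /= cosD sinD eqxx /=.
by apply/eqP; ring.
Qed.

Lemma eit0 : eit 0 = 1.
Proof. by apply/eqP; rewrite eq_complex /= cos0 sin0 !eqxx. Qed.

Lemma eitX t n : eit t ^+ n = eit (n%:R * t).
Proof.
elim: n => [|n IH]; first by rewrite mul0r eit0.
by rewrite exprS IH -eitD -natr1 mulrDl mul1r addrC.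
Qed.

Lemma eitN t : eit (- t) = (eit t)^-1.
Proof.
have E : eit t * eit (- t) = 1 by rewrite -eitD subrr eit0.
have N : eit t != 0 by rewrite -cabs_gt0 cabs_eit.
by apply: (mulfI N); rewrite E divff.
Qed.

Lemma eit2pi : eit (2 * pi) = 1.
Proof.
by apply/eqP; rewrite eq_complex /= mulr_natl cos2pi sin2pi !eqxx.
Qed.

Lemma eit_period t (j : int) : eit (t + 2 * pi * j%:~R) = eit t.
Proof.
rewrite eitD; suff -> : eit (2 * pi * j%:~R) = 1 by rewrite mulr1.
have H n : eit (2 * pi * n%:R) = 1 by rewrite mulrC -eitX eit2pi expr1n.
by case: j => n; rewrite ?NegzE ?mulrNz ?mulrN ?eitN H ?invr1.
Qed.

Lemma eit_neq1 x : 0 < x -> x < 2 * pi -> eit x != 1.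
Proof.
move=> x0 x2; apply/eqP => /(congr1 (@complex.Re R)) /= H.
have := @sin_gt0_pi R (x / 2); rewrite divr_gt0 // ltr_pdivrMr // mulrC => /(_ x2) S.
have := cosD (x / 2) (x / 2); have := cos2Dsin2 (x / 2).
by rewrite -splitr H; nra.
Qed.

Lemma eit_surj (z : C) : cabs z = 1 -> exists t, z = eit t.
Proof.
case: z => a b; rewrite /cabs /= => /(congr1 (fun x => x ^+ 2)).
rewrite sqr_sqrtr ?addr_ge0 ?sqr_ge0 // expr1n => E.
have b2 : b ^+ 2 = 1 - a ^+ 2 by lra.
have a1 : -1 <= a <= 1 by rewrite -ler_norml -sqrtr_sqr -[leRHS]sqrtr1; apply: ler_wsqrtr; have := sqr_ge0 b; lra.
have sb : sin (acos a) = `|b| by rewrite sin_acos // -b2 sqrtr_sqr.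
have ca : cos (acos a) = a by rewrite acosK.
have [b0|b0] := leP 0 b.
  by exists (acos a); rewrite /Defs.eit ca sb ger0_norm.
by exists (- acos a); rewrite /Defs.eit cosN sinN ca sb ltr0_norm // opprK.
Qed.

(** The powers of eit (2 pi / q) are all the q-th roots of unity. *)
Lemma eit_root (q : nat) (b : R) (y : C) : (0 < q)%N -> y ^+ q = eit b ->
  exists k : 'I_q, y = eit (b / q%:R + 2 * pi * k%:R / q%:R).
Proof.
move=> q0 yq; have qR : (q%:R : R) != 0 by rewrite pnatr_eq0 -lt0n.
pose w := eit (2 * pi / q%:R).
have wk k : w ^+ k = eit (2 * pi * k%:R / q%:R) by rewrite eitX; congr eit; ring.
have prim : q.-primitive_root w.
  rewrite /primitive_root_of_unity q0 /=; apply/forallP => i; apply/eqP.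
  rewrite unity_rootE wk; have := ltn_ord i; rewrite leq_eqVlt => /orP[/eqP E|ltq].
    by rewrite E mulfK // eit2pi eqxx eqxx.
  rewrite (ltn_eqF ltq); apply/negbTE/eit_neq1.
    by rewrite divr_gt0 ?ltr0n // mulr_gt0 // mulr_gt0 // pi_gt0.
  by rewrite ltr_pdivrMr ?ltr0n // ltr_pM2l ?mulr_gt0 ?pi_gt0 // ltr_nat.
pose y0 := eit (b / q%:R).
have y00 : y0 != 0 by rewrite -cabs_gt0 cabs_eit.
have y0q : y0 ^+ q = eit b by rewrite eitX mulrC divfK.
have [|k yk] := prim_rootP prim (_ : (y / y0) ^+ q = 1).
  by rewrite expr_div_n yq y0q divff // -y0q expf_neq0.
by exists k; rewrite eitD -wk -/y0 -yk mulrC divfK.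
Qed.

Lemma sin_le x : 0 <= x -> `|sin x| <= x.
Proof.
move=> x0; have [c|c _] := @MVT_segment R (@sin R) (@cos R) 0 x x0 (fun y _ => is_derive_sin y).
  exact/continuous_subspaceT/continuous_sin.
rewrite sin0 !subr0 => ->; rewrite normrM (ger0_norm x0).
by apply: ler_piMl => //; exact: cos_max.
Qed.

Lemma abs_sin_le x : `|sin x| <= `|x|.
Proof.
have [x0|x0] := leP 0 x; first by rewrite (ger0_norm x0) sin_le.
by rewrite -normrN -sinN (ltr0_norm x0); apply: sin_le; lra.
Qed.

Lemma cos_ge x : 1 - x ^+ 2 / 2 <= cos x.
Proof.
have := abs_sin_le (x / 2); rewrite -ler_sqr ?nnegrE // !real_normK ?num_real // => H.
have := cosD (x / 2) (x / 2); have := cos2Dsin2 (x / 2); rewrite -splitr => H1 ->.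
have -> : x ^+ 2 / 2 = 2 * (x / 2) ^+ 2 by field.
by rewrite -!expr2; lra.
Qed.

Lemma eit_sub s t : cabs (eit s - eit t) = cabs (eit (s - t) - 1).
Proof.
rewrite eitD eitN -[in LHS](mulr1 (cabs _)) -[X in _ * X](cabs_eit (- t)) -cabsM eitN.
by rewrite mulrBl divff // -cabs_gt0 cabs_eit.
Qed.

Lemma eit_lip s t : cabs (eit s - eit t) <= 2 * `|s - t|.
Proof.
rewrite eit_sub; move: (s - t) => x; apply: le_trans (cabs_le_ReIm _) _.
rewrite /= subr0; have := abs_sin_le x.
suff : `|cos x - 1| <= `|x| by lra.
have c1 := cos_le1 x; rewrite ler0_norm ?subr_le0 // opprB.
have [x1|x1] := leP `|x| 2.
  have := cos_ge x; rewrite -[x ^+ 2]real_normK ?num_real // => H.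
  by have := normr_ge0 x; nra.
by have := cos_geN1 x; lra.
Qed.

Lemma eit_colip s t : `|s - t| <= 1 -> `|s - t| / 2 <= cabs (eit s - eit t).
Proof.
rewrite eit_sub; move: (s - t) => x x1; apply: le_trans (cabs_Im _); rewrite /= subr0.
wlog x0 : x x1 / 0 <= x.
  move=> H; have [x0|x0] := leP 0 x; first exact: H.
  by have := H (- x); rewrite !normrN sinN normrN; apply=> //; lra.
have [c|c cP] := @MVT_segment R (@sin R) (@cos R) 0 x x0 (fun y _ => is_derive_sin y).
  exact/continuous_subspaceT/continuous_sin.
rewrite sin0 !subr0 => ->; rewrite normrM [leLHS]mulrC; apply: ler_wpM2r => //.
move: cP; rewrite in_itv /= => /andP[c0 cx]; rewrite (ger0_norm x0) in x1.
by apply: le_trans (ler_norm _); have := cos_ge c; nra.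
Qed.

End UnitCircle.

Section Angles.
Variables (R : realType) (p q : nat).
Hypotheses (q0 : (0 < q)%N) (qp : (q < p)%N).
Local Notation C := (C R).
Local Notation eit := (@eit R).
Local Notation angle := (@angle R p q).
Implicit Types (tau : nat -> 'I_q) (s t : R).

Definition dil : R := p%:R / q%:R.

Let qR : (0 : R) < q%:R. Proof. by rewrite ltr0n. Qed.

Lemma dil_gt1 : 1 < dil.
Proof. by rewrite /dil ltr_pdivlMr // mul1r ltr_nat. Qed.

Lemma dil_gt0 : 0 < dil.
Proof. exact: lt_trans dil_gt1. Qed.

Lemma angle_sub tau s t n : angle tau s n - angle tau t n = dil ^+ n * (s - t).
Proof.
elim: n => [|n IH] /=; first by rewrite mul1r.
rewrite exprS -mulrA -IH /theta /dil; field; exact: lt0r_neq0.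
Qed.

Definition circle_pt tau t n : C := eit (angle tau t n).

Lemma circle_pt_orbit tau t : orbit p q 0 (circle_pt tau t).
Proof.
move=> n; rewrite /corr /= subr0 !eitX /theta.
have -> : q%:R * (p%:R * angle tau t n / q%:R + 2 * pi * (tau n)%:R / q%:R) =
   p%:R * angle tau t n + 2 * pi * (tau n : int)%:~R.
  by rewrite -pmulrn; field; exact: lt0r_neq0.
by rewrite eit_period.
Qed.

(** Every image of eit a is eit (theta k a) for some k, so an itinerary can be
    chosen one step at a time. *)
Lemma circle_ptP (u : nat -> C) t : orbit p q 0 u -> (forall n, cabs (u n) = 1) ->
  u 0%N = eit t -> exists tau, u = circle_pt tau t.
Proof.
move=> uo u1 ut.
pose pick (a : R) n : 'I_q :=
  xget (Ordinal q0) [set k : 'I_q | u n.+1 = eit (theta p k a)].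
pose a := fix a n := if n is m.+1 then theta p (pick (a m) m) (a m) else t.
exists (fun n => pick (a n) n).
have E n : angle (fun n => pick (a n) n) t n = a n by elim: n => //= n ->.
apply/funext => n; rewrite /circle_pt E.
elim: n => [//|n IH] /=.
rewrite /pick; case: xgetP => // H.
have [|k yk] := @eit_root R q (p%:R * a n) (u n.+1) q0.
  by have := uo n; rewrite /corr /= subr0 IH eitX.
by case: (H k).
Qed.

Lemma near_mod2pi (x : R) : exists j : int, `|2 * pi * j%:~R - x| <= 2 * pi.
Proof.
have P : 0 < 2 * (pi : R) by rewrite mulr_gt0 // pi_gt0.
exists (Num.floor (x / (2 * pi))).
have /andP[h1 h2] := floor_itv (x / (2 * pi)).
rewrite intrD in h2.
move: h1 h2; rewrite ler_pdivlMr // ltr_pdivrMr // => h1 h2.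
by rewrite ler_norml; apply/andP; split; lra.
Qed.

(** The angle after [N] steps depends on the starting angle with slope
    [dil ^+ N], so it can be given any value modulo 2 pi by a start very close
    to [a]. A prescribed value is the case k = 0, a return to the start the case
    k = 1. *)
Lemma angle_solve (M : nat) (x : R) : 0 < x -> exists N, (M <= N)%N /\ (0 < N)%N /\
  forall tau (k a b : R), 0 <= k -> k <= 1 -> exists t, (exists j : int,
    angle tau t N = k * (t - a) + b + 2 * pi * j%:~R) /\
    forall n, (n <= M)%N -> `|angle tau t n - angle tau a n| <= x.
Proof.
move=> x0; have D1 := dil_gt1; have D0 := dil_gt0; have pi0 := @pi_gt0 R.
have [K KP] : exists K, forall n, (K <= n)%N ->
    (dil ^+ M * (4 * pi) / x + 2) * dil^-1 ^+ n < 1.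
  apply: geometric_lt => //; first by rewrite invr_ge0 ltW.
  by rewrite invf_lt1.
exists (maxn K M.+1); set N := maxn K M.+1.
have MN : (M < N)%N by rewrite leq_max ltnSn orbT.
split; first exact: ltnW. split; first exact: leq_trans MN.
move=> tau k a b k0 k1.
have P0 : 0 < dil ^+ N by rewrite exprn_gt0.
have PB : dil ^+ M * (4 * pi) / x + 2 < dil ^+ N.
  by have := KP N (leq_maxl _ _); rewrite exprVn ltr_pdivrMr // mul1r.
have B0 : 0 < dil ^+ M * (4 * pi) / x by rewrite divr_gt0 // mulr_gt0 ?exprn_gt0 // mulr_gt0.
have Pk : 0 < dil ^+ N - k by lra.
have [j jP] := near_mod2pi (angle tau a N - b).
exists (a + (b + 2 * pi * j%:~R - angle tau a N) / (dil ^+ N - k)); split.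
  exists j; rewrite -[LHS](subrK (angle tau a N)) angle_sub.
  by rewrite addrAC subrr add0r; field; rewrite gt_eqF.
move=> n nM; rewrite angle_sub addrAC subrr add0r.
have -> : b + 2 * pi * j%:~R - angle tau a N = 2 * pi * j%:~R - (angle tau a N - b) by ring.
rewrite !normrM normfV (gtr0_norm Pk) ger0_norm ?exprn_ge0 ?(ltW D0) //.
rewrite mulrA ler_pdivrMr //.
apply: (@le_trans _ _ (dil ^+ M * (2 * pi))).
  by apply: ler_pM; rewrite ?exprn_ge0 ?(ltW D0) // ler_weXn2l // ltW.
have : dil ^+ M * (4 * pi) < x * dil ^+ N.
  by rewrite [ltRHS]mulrC -ltr_pdivrMr //; lra.
move=> H; have : x * (dil ^+ N - k) >= x * dil ^+ N / 2.
  by rewrite -mulrA; apply: ler_wpM2l; [exact: ltW | lra].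
by lra.
Qed.

(** The other orbit enters only through the angle where it starts, so
    [angle_solve] provides one time that serves for all pairs of orbits. *)
Lemma steer (M : nat) (x : R) : 0 < x -> exists N, (0 < N)%N /\
  forall u v : nat -> C, orbit p q 0 u -> (forall n, cabs (u n) = 1) ->
    orbit p q 0 v -> (forall n, cabs (v n) = 1) ->
    exists w : nat -> C, [/\ orbit p q 0 w, forall n, cabs (w n) = 1,
      forall n, (n <= M)%N -> cabs (u n - w n) <= x & tail N w = v].
Proof.
move=> x0; have x2 : 0 < x / 2 by rewrite divr_gt0.
have [N [MN [N0 S]]] := angle_solve M x2; exists N; split=> //.
move=> u v uo u1 vo v1.
have [a ua] := eit_surj (u1 0%N); have [b vb] := eit_surj (v1 0%N).
have [tau uE] := circle_ptP uo u1 ua.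
have [t [[j tN] tn]] := S tau 0 a b (lexx _) (@ler01 _).
rewrite mul0r add0r in tN.
have ptN : circle_pt tau t N = v 0%N by rewrite /circle_pt tN eit_period vb.
pose w n := if (n < N)%N then circle_pt tau t n else v (n - N)%N.
have wN n : (n <= N)%N -> w n = circle_pt tau t n.
  rewrite /w leq_eqVlt => /orP[/eqP ->|-> //].
  by rewrite ltnn subnn ptN.
exists w; split.
- move=> n; case: (ltnP n N) => nN.
    by rewrite (wN n (ltnW nN)) (wN n.+1 nN); exact: circle_pt_orbit.
  by rewrite /w ltnNge nN ltnNge (leqW nN) /= subSn //; exact: vo.
- by move=> n; rewrite /w; case: ifP => // _; exact: cabs_eit.
- move=> n nM; rewrite (wN n (leq_trans nM MN)) uE /circle_pt.
  by apply: le_trans (eit_lip _ _) _; rewrite distrC; have := tn n nM; lra.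
- by apply/funext => n; rewrite /tail /w ltnNge leq_addr /= addKn.
Qed.

(** The itinerary of the given orbit is followed for [N] steps, from a starting
    angle that returns after [N] steps, and then repeated. *)
Lemma close_up (u : nat -> C) (M : nat) (x : R) : 0 < x ->
  orbit p q 0 u -> (forall n, cabs (u n) = 1) -> exists N (w : nat -> C),
  [/\ (0 < N)%N, orbit p q 0 w, forall n, cabs (w n) = 1,
    forall n, (n <= M)%N -> cabs (u n - w n) <= x & tail N w = w].
Proof.
move=> x0 uo u1; have x2 : 0 < x / 2 by rewrite divr_gt0.
have [N [MN [N0 S]]] := angle_solve M x2.
have [a ua] := eit_surj (u1 0%N).
have [tau uE] := circle_ptP uo u1 ua.
have [t [[j tN] tn]] := S tau 1 a a ler01 (lexx _).
have ptN : circle_pt tau t N = circle_pt tau t 0.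
  by rewrite /circle_pt tN mul1r subrK eit_period.
pose w n := circle_pt tau t (n %% N)%N.
have wN n : (n <= N)%N -> w n = circle_pt tau t n.
  rewrite /w leq_eqVlt => /orP[/eqP ->|nN]; last by rewrite modn_small.
  by rewrite modnn ptN.
exists N, w; split => //.
- move=> n; have := circle_pt_orbit tau t (n %% N)%N; rewrite /w.
  suff -> : circle_pt tau t (n %% N).+1 = circle_pt tau t (n.+1 %% N) by [].
  have nN : ((n %% N).+1 <= N)%N by rewrite ltn_mod.
  rewrite -(wN _ nN) /w; congr circle_pt.
  by rewrite -addn1 modnDml addn1.
- by move=> n; exact: cabs_eit.
- move=> n nM; rewrite (wN n (leq_trans nM MN)) uE /circle_pt.
  by apply: le_trans (eit_lip _ _) _; rewrite distrC; have := tn n nM; lra.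
- by apply/funext => n; rewrite /tail /w modnDl.
Qed.

End Angles.

(** * Local branches and the bundle map *)

Lemma differentiable_near (K : numFieldType) (V W : normedModType K) (F H : V -> W) (x : V) :
  (\forall y \near x, F y = H y) -> differentiable H x -> differentiable F x.
Proof.
move=> FH dH; have Fx : F x = H x by exact: nbhs_singleton FH.
have E : F \o shift x = cst (F x) + 'd H x +o_ 0 id.
  apply/eqaddoP => eps eps0.
  have /eqaddoP/(_ eps eps0) := diff_locally dH.
  have FH' : \forall h \near (0 : V), F (h + x) = H (h + x).
    by move: FH; rewrite (near_shift 0 x) subr0.
  apply: filterS2 FH' => h /= FHh; by rewrite !fctE /= FHh Fx.
have dF : 'd F x = 'd H x :> (V -> W).
  by apply: diff_unique E; exact: diff_continuous.
by apply/diff_locallyP; rewrite dF; split=> //; exact: diff_continuous.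
Qed.

Section BundleMap.
Variables (R : realType) (p q : nat) (lam e rho r d m b : R).
Local Notation C := (C R).
Hypothesis G : shadow_params p q lam e rho.
Local Notation ann_orbit := (ann_orbit p q e).
Local Notation ann_set := (ann_set p q e).
Local Notation code := (orbit_code r d).

(** [sepP]: the images of a point near the unit circle are so far apart that the
    disks of radius d about r times these images keep a distance above [m],
    which leaves room to deform the point and c. [sep_b] bounds by e the variation
    of a branch on a disk of radius [b]. *)
Record separation : Prop := Separation {
  sep_r0 : 0 < r;
  sep_d0 : 0 < d;
  sep_rd : r + d <= 1;
  sep_m : 8 * e <= m;
  sep_b0 : 0 < b;
  sep_be : b <= e;
  sep_b : p%:R * 2 ^+ p.-1 * b <= e ^+ q;
  sepP : forall c z w w' : C, cabs c <= rho -> ann (4 * e) z ->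
    corr p q c z w -> corr p q c z w' -> r * cabs (w - w') <= 2 * d + m -> w = w' }.
Hypothesis S : separation.

Let e0 := par_e0 G.
Let e1 := par_e1 G.
Let p0 := par_p0 G.
Let q0 := par_q0 G.
Let r0 := sep_r0 S.
Let d0 := sep_d0 S.
Let rd := sep_rd S.
Let me := sep_m S.
Let b0 := sep_b0 S.
Let be := sep_be S.

Let r_ge0 : 0 <= r. Proof. exact: ltW. Qed.
Let d1 : d < 1. Proof. by have := r0; have := rd; lra. Qed.
Let r1 : r <= 1. Proof. by have := d0; have := rd; lra. Qed.

Lemma ann_bounded c w : ann_orbit c w -> bounded_by (1 + e) w.
Proof. by move=> [_ wa] n; have /andP[] := wa n. Qed.

Lemma code_le c w : ann_orbit c w -> cabs (code w) <= 1 + e.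
Proof.
move=> wo; apply: le_trans (code_bound r_ge0 d0 d1 (ann_bounded wo)) _.
rewrite ler_pdivrMr ?subr_gt0 // mulrC; apply: ler_wpM2l; first by have := e0; lra.
by have := rd; lra.
Qed.

(** In [code w = r w_1 + d code (tail 1 w)] the last term is at most d (1 + e),
    so the code determines the first image up to the tolerance of [sepP]. *)
Lemma code_step c c' w v : ann_orbit c w -> ann_orbit c' v ->
  r * cabs (w 1%N - v 1%N) <= 2 * d + 2 * e + cabs (code w - code v).
Proof.
move=> wo vo; rewrite (code_rec r d0 d1 (ann_bounded wo)) (code_rec r d0 d1 (ann_bounded vo)).
set a := code _; set a' := code _.
have ha : cabs a <= 1 + e by exact: code_le (ann_orbit_tail 1 wo).
have ha' : cabs a' <= 1 + e by exact: code_le (ann_orbit_tail 1 vo).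
have := cabs_dist (ofR r * (w 1%N - v 1%N)) (ofR d * (a' - a)).
rewrite !cabsM !cabs_ofR (ger0_norm r_ge0) (gtr0_norm d0).
have -> : ofR r * (w 1%N - v 1%N) - ofR d * (a' - a) =
  ofR r * w 1%N + ofR d * a - (ofR r * v 1%N + ofR d * a') by ring.
have : d * cabs (a' - a) <= d * (2 + 2 * e).
  by apply: ler_wpM2l; [exact: ltW | have := cabsB a' a; lra].
have : d * e <= e by apply: ler_piMl; [exact: ltW e0 | exact: ltW d1].
by lra.
Qed.

(** By [code_step] and [sepP], starting point and code determine the first
    image; hence those of the tail are equal too, and so on. *)
Lemma code_inj c w v : cabs c <= rho -> ann_orbit c w -> ann_orbit c v ->
  w 0%N = v 0%N -> code w = code v -> w = v.
Proof.
move=> cr; have H w' v' : ann_orbit c w' -> ann_orbit c v' ->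
    w' 0%N = v' 0%N -> code w' = code v' -> w' 1%N = v' 1%N.
  move=> wo vo E0 Ec; have e0' := e0; apply: (sepP S cr _ (proj1 wo 0%N)).
  - by apply: ann_le (proj2 wo 0%N); lra.
  - by rewrite E0; exact: (proj1 vo 0%N).
  - have := code_step wo vo; rewrite Ec subrr cabs0 addr0.
    by have := me; lra.
move=> wo vo E0 Ec; apply/funext => n.
have : tail n w 0%N = tail n v 0%N /\ code (tail n w) = code (tail n v).
  elim: n => [|n [IH1 IH2]]; first by rewrite !tail0.
  have won := ann_orbit_tail n wo; have von := ann_orbit_tail n vo.
  have E1 := H _ _ won von IH1 IH2; rewrite /tail !addn1 in E1.
  split; first by rewrite /tail !addn0.
  rewrite -(tailS n w) -(tailS n v) (code_recB r d0 d1 (ann_bounded won)).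
  by rewrite (code_recB r d0 d1 (ann_bounded von)) IH2 /tail !addn1 E1.
by case; rewrite /tail addn0.
Qed.

(** A branch of f_c that takes w to W, built from the roots that [root_near]
    provides. Near w the separation leaves just one candidate
    ([lbranch_unique]), and this makes the branch continuous, hence
    holomorphic. *)
Definition lbranch (c w W z : C) : C :=
  c + xget (W - c) [set a | a ^+ q = z ^+ p /\ cabs (a - (W - c)) ^+ q <= cabs (z ^+ p - (W - c) ^+ q)].

Lemma lbranchP (c w W z : C) : corr p q c z (lbranch c w W z) /\
  cabs (lbranch c w W z - W) ^+ q <= cabs (z ^+ p - (W - c) ^+ q).
Proof.
have [a a1 a2] := root_near (W - c) (z ^+ p) q0.
rewrite /lbranch; case: xgetP => [x _ [x1 x2]|/(_ a)[]//].
rewrite /corr /= addrAC subrr add0r; split=> //.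
by rewrite (_ : c + x - W = x - (W - c)) //; ring.
Qed.

Section LocalBranch.
Variables (c w W : C).
Hypotheses (cr : cabs c <= rho) (wa : ann e w) (wW : corr p q c w W).

Lemma near_ann z : cabs (z - w) <= b -> ann (2 * e) z.
Proof.
rewrite cabsC => zw; have := ann_close wa zw; apply: ann_le.
by have := be; lra.
Qed.

Lemma lbranch_close z : cabs (z - w) <= b -> cabs (lbranch c w W z - W) <= e.
Proof.
move=> zw; have [_] := lbranchP c w W z; have e0' := e0; have e1' := e1.
rewrite (_ : (W - c) ^+ q = w ^+ p) // => H.
rewrite -(@ler_pXn2r _ q) ?nnegrE ?cabs_ge0 ?q0 //; last exact: ltW.
apply: le_trans H _; apply: le_trans (sep_b S).
have /andP[_ z2] := near_ann zw; have /andP[_ w2] := wa.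
apply: le_trans (@pow_lip R p 2 _ _ _ _) _; [lra | lra |].
by apply: ler_wpM2l => //; rewrite mulr_ge0 // exprn_ge0.
Qed.

Lemma lbranch_unique z y : cabs (z - w) <= b -> corr p q c z y ->
  r * cabs (y - W) <= 2 * d + 7 * e -> y = lbranch c w W z.
Proof.
move=> zw zy yW; have e0' := e0.
apply: (sepP S cr _ zy (proj1 (lbranchP c w W z))).
  by apply: ann_le (near_ann zw); lra.
have := ler_wpM2l r_ge0 (cabs_tri W y (lbranch c w W z)).
have : r * cabs (W - lbranch c w W z) <= e.
  apply: le_trans (ler_wpM2l r_ge0 _) _; first by rewrite cabsC; exact: lbranch_close.
  by apply: ler_piMl => //; exact: ltW.
by have := me; lra.
Qed.

Lemma lbranch_has_der z : cabs (z - w) < b -> exists l, has_der (lbranch c w W) z l.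
Proof.
move=> zw; have zw' := ltW zw; exists (p%:R * z ^+ p.-1 / (q%:R * (lbranch c w W z - c) ^+ q.-1)).
apply: (@branch_has_der R p q c) => //.
  apply/negP => /eqP E; have [] := lbranchP c w W z; rewrite E /corr /mkset subrr expr0n gtn_eqF ?q0 //.
  move/esym/eqP; rewrite expf_eq0 p0 /= -cabs_eq0 => /eqP z0 _.
  by have /andP[] := near_ann zw'; rewrite z0; have := e1; have := e0; lra.
move=> x x0; have [zc _] := lbranchP c w W z.
pose y := Num.min x e; have y0 : 0 < y by rewrite /y lt_min x0 e0.
have yq : 0 < y ^+ q by rewrite exprn_gt0.
pose K : R := p%:R * 2 ^+ p.-1 + 1.
have K0 : 0 < K by rewrite /K ltr_wpDl // mulr_ge0 // exprn_ge0.
exists (Num.min (b - cabs (z - w)) (y ^+ q / K)).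
  by rewrite lt_min subr_gt0 zw divr_gt0.
move=> z'; rewrite lt_min => /andP[z1 z2]; split; first exact: (proj1 (lbranchP c w W z')).
have z'w : cabs (z' - w) <= b by apply: le_trans (cabs_tri z _ _) _; lra.
(* a root near the value at z, identified with the value at z' by uniqueness *)
have [a a1 a2] := root_near (lbranch c w W z - c) (z' ^+ p) q0.
have e1' := e1; have e0' := e0.
have az : cabs (a - (lbranch c w W z - c)) < y.
  rewrite -(@ltr_pXn2r _ q) ?nnegrE ?cabs_ge0 ?q0 ?(ltW y0) //.
  apply: le_lt_trans a2 _; rewrite (_ : (lbranch c w W z - c) ^+ q = z ^+ p) //.
  have /andP[_ h1] := near_ann zw'; have /andP[_ h2] := near_ann z'w.
  apply: le_lt_trans (@pow_lip R p 2 _ _ _ _) _; [lra | lra |].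
  rewrite ltr_pdivlMr // in z2; apply: le_lt_trans z2.
  by rewrite mulrC; apply: ler_wpM2l; [exact: cabs_ge0 | rewrite /K lerDl].
have E : c + a = lbranch c w W z'.
  apply: lbranch_unique => //; first by rewrite /corr /= addrAC subrr add0r.
  have := cabs_tri (lbranch c w W z) (c + a) W.
  rewrite (_ : c + a - lbranch c w W z = a - (lbranch c w W z - c)); last by ring.
  have := lbranch_close zw'; have ye : y <= e by rewrite /y ge_min lexx orbT.
  move=> h1 h2; have : cabs (c + a - W) <= 2 * e by lra.
  move=> h3; have := ler_wpM2l r_ge0 h3; have : r * (2 * e) <= 2 * e.
    by apply: ler_piMl => //; lra.
  by have := d0; lra.
rewrite -E (_ : c + a - lbranch c w W z = a - (lbranch c w W z - c)); last by ring.
by apply: lt_le_trans az _; rewrite /y ge_min lexx.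
Qed.

Lemma lbranch_branch z x : cabs (z - w) + x <= b -> branch p q c (ball z (ofR x)) (lbranch c w W).
Proof.
move=> zx; split; first exact: ball_open.
- move=> z'; rewrite ballE => zz'.
  have [|l /has_der_derivable //] := @lbranch_has_der z'.
  by apply: le_lt_trans (cabs_tri z _ _) _; rewrite cabsC; lra.
- by move=> z' _; case: (lbranchP c w W z').
Qed.

Lemma lbranch_at : branch_at p q c w (lbranch c w W) /\ lbranch c w W w = W.
Proof.
have b0' := b0; split.
  exists (ball w (ofR b)); first by apply: ballxx; rewrite -ofR0 lt_ofR.
  by apply: lbranch_branch; rewrite subrr cabs0 add0r.
apply/esym/lbranch_unique => //; rewrite subrr cabs0 ?mulr0; first exact: ltW.
by have := d0; have := e0; lra.
Qed.

End LocalBranch.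

(** Points within this distance of one point are within [b] of each other. *)
Definition scale := b / 2.

Let scaleE : 2 * scale = b. Proof. by rewrite /scale; field. Qed.
Let scale0 : 0 < scale. Proof. by rewrite /scale divr_gt0. Qed.

Lemma prod_ballE (x y : C * C) (s : R) :
  ball x (ofR s) y <-> cabs (x.1 - y.1) < s /\ cabs (x.2 - y.2) < s.
Proof. by rewrite -!ballE. Qed.

Definition bundle_pt (w : nat -> C) : C * C := (w 0%N, code w).

Lemma bundle_ann c y : cantor_bundle p q r d c (ann_set c) y <->
  exists2 w, ann_orbit c w & y = bundle_pt w.
Proof.
split=> [[w /ann_set_orbit wo <-]|[w wo ->]]; first by exists w.
by exists w => //; apply/ann_set_orbit.
Qed.

Definition bundle_nbhd (c : C) : set (C * C) :=
  [set x | exists2 w, ann_orbit c w & ball x (ofR scale) (bundle_pt w)].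

Definition near_orbit (c : C) (x : C * C) : nat -> C :=
  xget (fun=> 0) [set w | ann_orbit c w /\ ball x (ofR scale) (bundle_pt w)].

Lemma near_orbitP c x : bundle_nbhd c x -> ann_orbit c (near_orbit c x) /\
  ball x (ofR scale) (bundle_pt (near_orbit c x)).
Proof.
by move=> [w wo xw]; rewrite /near_orbit; case: xgetP => [y _ []//|/(_ w)[]].
Qed.

Definition fbranch (c : C) (w : nat -> C) : C -> C := lbranch c (w 0%N) (w 1%N).

Definition fmap_with (phi : C -> C) (x : C * C) : C * C :=
  (phi x.1, (ofR d)^-1 * x.2 - ofR r * (ofR d)^-1 * phi x.1).

(** The branch belongs to some orbit whose bundle point is near; the choice is
    immaterial by [fbranch_agree]. *)
Definition fmap (c : C) (x : C * C) : C * C := fmap_with (fbranch c (near_orbit c x)) x.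

Section FixedParameter.
Variable c : C.
Hypothesis cr : cabs c <= rho.

Lemma bundle_nbhd_open : open (bundle_nbhd c).
Proof.
have -> : bundle_nbhd c = \bigcup_(w in [set w | ann_orbit c w]) [set x | ball x (ofR scale) (bundle_pt w)].
  by apply/seteqP; split=> [x [w wo xw]|x [w wo xw]]; exists w.
apply: bigcup_open => w _.
rewrite (_ : [set x | _] = ball (bundle_pt w) (ofR scale)); first exact: ball_open.
by apply/seteqP; split=> x; apply: ball_sym.
Qed.

Lemma bundle_sub_nbhd : cantor_bundle p q r d c (ann_set c) `<=` bundle_nbhd c.
Proof.
move=> y /bundle_ann[w wo ->]; exists w => //.
by apply: ballxx; rewrite -ofR0 lt_ofR.
Qed.

(** At z the branches are within e of [w 1] and [v 1], which [code_step] puts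
    within the tolerance of [sepP]. *)
Lemma fbranch_agree w v z : ann_orbit c w -> ann_orbit c v ->
  cabs (w 0%N - z) <= b -> cabs (v 0%N - z) <= b -> cabs (code w - code v) <= 3 * e ->
  fbranch c w z = fbranch c v z.
Proof.
move=> wo vo wz vz wv; have e0' := e0; rewrite cabsC in wz; rewrite cabsC in vz.
have wa := proj2 wo 0%N; have va := proj2 vo 0%N.
apply: (lbranch_unique cr va (proj1 vo 0%N) vz); first exact: (proj1 (lbranchP _ _ _ _)).
have h1 := lbranch_close wa (proj1 wo 0%N) wz.
have h2 := code_step wo vo.
have h3 := ler_wpM2l r_ge0 (cabs_tri (w 1%N) (fbranch c w z) (v 1%N)).
have h4 : r * cabs (fbranch c w z - w 1%N) <= e.
  apply: le_trans (ler_wpM2l r_ge0 h1) _; apply: ler_piMl => //; exact: ltW.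
rewrite mulrDr in h3.
by apply: le_trans h3 _; lra.
Qed.

Lemma fbranch_orbit w v : ann_orbit c w -> ann_orbit c v ->
  cabs (w 0%N - v 0%N) <= b -> cabs (code w - code v) <= 3 * e ->
  fbranch c w (v 0%N) = v 1%N.
Proof.
move=> wo vo wz wv; rewrite (fbranch_agree wo vo wz _ wv); last by rewrite subrr cabs0 ltW.
by case: (lbranch_at cr (proj2 vo 0%N) (proj1 vo 0%N)).
Qed.

(** Near a point of the neighbourhood a single branch serves; differentiability
    follows from this. *)
Lemma fmap_near x w y : bundle_nbhd c y -> ann_orbit c w -> ball x (ofR scale) (bundle_pt w) ->
  ball x (ofR scale) y -> fmap c y = fmap_with (fbranch c w) y.
Proof.
move=> yN wo /prod_ballE[/= x1 x2] /prod_ballE[y1 y2].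
have [vo /prod_ballE[/= v1 v2]] := near_orbitP yN.
have be' := be; have sE := scaleE; have s0 := scale0; have e0' := e0.
rewrite /fmap /fmap_with (fbranch_agree (z := y.1) vo wo) //.
- by rewrite cabsC; lra.
- by apply: le_trans (cabs_tri x.1 _ _) _; rewrite (cabsC _ x.1); lra.
- apply: le_trans (cabs_tri y.2 _ _) _; rewrite (cabsC _ y.2).
  by have := cabs_tri x.2 y.2 (code w); rewrite (cabsC y.2 x.2); lra.
Qed.

Lemma fmap_bundle w : ann_orbit c w -> fmap c (bundle_pt w) = bundle_pt (tail 1 w).
Proof.
move=> wo; have xN : bundle_nbhd c (bundle_pt w).
  by apply: bundle_sub_nbhd; apply/bundle_ann; exists w.
have xx : ball (bundle_pt w) (ofR scale) (bundle_pt w) by apply: ballxx; rewrite -ofR0 lt_ofR.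
rewrite (fmap_near xN wo xx xx) /fmap_with /=.
rewrite (fbranch_orbit wo wo) ?subrr ?cabs0 ?(ltW b0) ?mulr_ge0 ?(ltW e0) //.
by rewrite /bundle_pt (code_recB r d0 d1 (ann_bounded wo)).
Qed.

Lemma fmap_differentiable x : bundle_nbhd c x -> differentiable (fmap c) x.
Proof.
move=> xN; have [w wo xw] := xN.
have s0 : 0 < ofR scale by rewrite -ofR0 lt_ofR.
apply: (@differentiable_near _ _ _ _ (fmap_with (fbranch c w))).
  have : \forall y \near x, bundle_nbhd c y by apply: open_nbhs_nbhs; split=> //; exact: bundle_nbhd_open.
  apply: filterS2 (nbhsx_ballx x _ s0) => y xy yN.
  exact: (fmap_near yN wo xw xy).
have [x1 _] := iffLR (prod_ballE _ _ _) xw.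
have dphi : differentiable (fbranch c w) x.1.
  apply/derivable1_diffP.
  have [|l /has_der_derivable //] := @lbranch_has_der c (w 0%N) (w 1%N) cr (proj2 wo 0%N) (proj1 wo 0%N) x.1.
  by apply: lt_trans x1 _; have := scaleE; have := scale0; lra.
have d1' : differentiable (fun y : C * C => fbranch c w y.1) x.
  apply: (@differentiable_comp _ _ _ _ fst (fbranch c w)) => //.
  by apply: linear_differentiable => -[y1 y2]; exact: cvg_fst.
have d2 : differentiable (fun y : C * C => y.2) x.
  by apply: (@linear_differentiable _ _ _ snd) => -[y1 y2]; exact: cvg_snd.
have d3 : differentiable (fun y : C * C => (ofR d)^-1 * y.2 - ofR r * (ofR d)^-1 * fbranch c w y.1) x.
  apply: differentiableB; first exact: (differentiableZ (ofR d)^-1 d2).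
  exact: (differentiableZ (ofR r * (ofR d)^-1) d1').
exact: (differentiable_pair d1' d3).
Qed.

Lemma bundle_map_fmap : inv_class p q r c (ann_set c) -> expanding_hyperbolic p q c (ann_set c) ->
  bundle_map p q r d c (ann_set c) (bundle_nbhd c) (fmap c).
Proof.
move=> ic eh; split=> //.
- exact: bundle_nbhd_open.
- exact: bundle_sub_nbhd.
- exact: fmap_differentiable.
- exists scale => // x xN; have [wo xw] := near_orbitP xN.
  have be' := be; have sE := scaleE; have s0 := scale0; have e0' := e0.
  split; first by exists (bundle_pt (near_orbit c x)) => //; apply/bundle_ann; exists (near_orbit c x).
  have [/= x1 x2] := iffLR (prod_ballE _ _ _) xw.
  exists (fbranch c (near_orbit c x)); split=> //.
    by apply: (lbranch_branch cr (proj2 wo 0%N) (proj1 wo 0%N)); lra.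
  move=> u /ann_set_orbit uo /prod_ballE[/= u1 u2].
  apply: (fbranch_orbit wo uo).
    by apply: le_trans (cabs_tri x.1 _ _) _; rewrite (cabsC _ x.1); lra.
  by apply: le_trans (cabs_tri x.2 _ _) _; rewrite (cabsC _ x.2); lra.
Qed.

End FixedParameter.
End BundleMap.

(** * Compactness and dynamics of the bundle *)

Section Compactness.
Variable R : realType.
Local Notation C := (C R).

Lemma box_compact (M : R) : compact [set z : C | `|complex.Re z| <= M /\ `|complex.Im z| <= M].
Proof.
have -> : [set z : C | `|complex.Re z| <= M /\ `|complex.Im z| <= M] =
    (fun x : R * R => (x.1 +i* x.2)%C : C) @` (`[- M, M] `*` `[- M, M]).
  apply/seteqP; split=> [[a b] /= [ha hb]|_ [[a b] [/= ha hb]] <-] /=.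
    by exists (a, b) => //; split; rewrite /= in_itv /= -ler_norml.
  by move: ha hb; rewrite !in_itv /= -!ler_norml.
apply: continuous_compact; last by apply: compact_setX; exact: segment_compact.
apply: continuous_subspaceT => -[a b]; apply/ccvgP => x x0.
have x2 : 0 < x / 2 by rewrite divr_gt0.
exists ([set a' | `|a - a'| < x / 2], [set b' | `|b - b'| < x / 2]) => /=.
  by split; apply/nbhs_ballP; exists (x / 2).
move=> [a' b'] [/= ha hb]; change (cabs ((a +i* b)%C - (a' +i* b')%C : C) < x).
by apply: le_lt_trans (cabs_le_ReIm _) _; rewrite /=; lra.
Qed.

Lemma disk2_compact (M : R) (A : set (C * C)) : closed A ->
  (forall z, A z -> cabs z.1 <= M /\ cabs z.2 <= M) -> compact A.
Proof.
move=> cA AM; apply: subclosed_compact cA (compact_setX (@box_compact M) (@box_compact M)) _ => z /AM[z1 z2].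
split; split.
- exact: le_trans (cabs_Re _) z1.
- exact: le_trans (cabs_Im _) z1.
- exact: le_trans (cabs_Re _) z2.
- exact: le_trans (cabs_Im _) z2.
Qed.

Lemma closureP2 (A : set (C * C)) (z : C * C) :
  closure A z <-> forall s : R, 0 < s -> exists2 y, A y & ball z (ofR s) y.
Proof.
split=> [H s s0|H B /nbhs_ballP[x /posC[s s0 ->] sB]].
  have [|y [Ay zy]] := H (ball z (ofR s)).
    by apply: nbhsx_ballx; rewrite -ofR0 lt_ofR.
  by exists y.
by have [y Ay zy] := H _ s0; exists y; split=> //; exact: sB.
Qed.

Lemma closureP1 (A : set C) (z : C) :
  closure A z <-> forall s : R, 0 < s -> exists2 y, A y & cabs (z - y) < s.
Proof.
split=> [H s s0|H B /cnbhsP[s s0 sB]].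
  have [|y [Ay zy]] := H [set w | cabs (z - w) < s]; first by apply/cnbhsP; exists s.
  by exists y.
by have [y Ay zy] := H _ s0; exists y; split=> //; exact: sB.
Qed.

End Compactness.

Section BundleDynamics.
Variables (R : realType) (p q : nat) (lam e rho r d m b : R).
Local Notation C := (C R).
Hypothesis G : shadow_params p q lam e rho.
Hypothesis S : separation p q e rho r d m b.
Local Notation ann_orbit := (ann_orbit p q e).
Local Notation ann_set := (ann_set p q e).
Local Notation deform := (deform p q).
Local Notation code := (orbit_code r d).
Local Notation bundle_nbhd := (bundle_nbhd p q e r d b).
Local Notation fmap := (fmap p q e r d b).
Local Notation bundle_pt := (bundle_pt r d).
Local Notation bundle c := (cantor_bundle p q r d c (ann_set c)).

Let e0 := par_e0 G.
Let e1 := par_e1 G.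
Let r0 := sep_r0 S.
Let d0 := sep_d0 S.
Let rd := sep_rd S.
Let b0 := sep_b0 S.
Let be := sep_be S.
Let r_ge0 : 0 <= r. Proof. exact: ltW. Qed.
Let d1 : d < 1. Proof. by have := r0; have := rd; lra. Qed.
Let scale0 : 0 < scale b. Proof. by rewrite /scale divr_gt0. Qed.
Let scale_e : scale b <= e / 2. Proof. by rewrite /scale; have := be; lra. Qed.

Section FixedC.
Variable c : C.
Hypothesis cr : cabs c <= rho.

Lemma ann_half w n : ann_orbit c w -> ann (e / 2) (w n).
Proof.
move=> /(deform_onto G cr)[u uo ->].
have u1 : ann 0 (u n) by rewrite /ann (ann_unit G uo); apply/andP; split; lra.
by have := ann_close u1 (deform_close2 G cr uo n); rewrite add0r.
Qed.

Lemma nbhd_ann x : bundle_nbhd c x -> ann e x.1 /\ cabs x.2 <= 2.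
Proof.
move=> [w wo /prod_ballE[/= x1 x2]]; have se := scale_e; have e0' := e0; have e1' := e1.
split; first by rewrite cabsC in x1; apply: ann_le (ann_close (ann_half 0 wo) (ltW x1)); lra.
have := code_le G S wo; have := cabs_dist x.2 (code w); lra.
Qed.

(** Since the bundle map expands the second coordinate by 1 / d, a bounded orbit
    of it is coded by its first coordinates. *)
Lemma fmap_orbit_bundle (x : nat -> C * C) : (forall n, bundle_nbhd c (x n)) ->
  (forall n, x n.+1 = fmap c (x n)) -> bundle c (x 0%N).
Proof.
move=> xN xS; pose w n := (x n).1.
have wo : ann_orbit c w.
  split=> n; last by case: (nbhd_ann (xN n)).
  by rewrite /w xS; case: (lbranchP G c (near_orbit p q e r d b c (x n) 0%N) (near_orbit p q e r d b c (x n) 1%N) (x n).1).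
apply/bundle_ann; exists w => //.
have dN : ofR d != 0 by rewrite -ofR0 (inj_eq (@ofR_inj R)) gt_eqF.
rewrite [LHS]surjective_pairing /bundle_pt; congr (_, _).
apply: (code_unique r_ge0 d0 d1 (s := fun n => (x n).2) (ann_bounded wo)) => [n|n].
  by case: (nbhd_ann (xN n)) => _; apply.
by rewrite /w xS /fmap /fmap_with /=; field.
Qed.

Lemma fmap_bundle_sub y : bundle c y -> bundle c (fmap c y).
Proof.
move=> /bundle_ann[w wo ->]; rewrite (fmap_bundle G S cr wo); apply/bundle_ann.
by exists (tail 1 w) => //; exact: ann_orbit_tail.
Qed.

Lemma closure_nbhd z : closure (bundle c) z -> bundle_nbhd c z.
Proof.
move=> /closureP2/(_ _ scale0)[y /bundle_ann[w wo ->] zy]; by exists w.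
Qed.

(** The forward orbit of a limit of bundle points consists of such limits, so it
    stays in the neighbourhood where the bundle map is defined, and
    [fmap_orbit_bundle] applies. *)
Lemma bundle_closed : closed (bundle c).
Proof.
move=> z zc; pose x n := iter n (fmap c) z.
have cl n : closure (bundle c) (x n).
  elim: n => [//|n IH]; have /differentiable_continuous dc := fmap_differentiable G S cr (closure_nbhd IH).
  move=> A; rewrite /x iterS => /dc /= /IH[y [By Ay]].
  by exists (fmap c y); split=> //; exact: fmap_bundle_sub.
apply: (fmap_orbit_bundle (x := x)) => n; last exact: iterS.
exact: closure_nbhd (cl n).
Qed.

Lemma bundle_compact : compact (bundle c).
Proof.
apply: (@disk2_compact R 2) bundle_closed _ => z /bundle_ann[w wo ->].
have e0' := e0; have e1' := e1; have := code_le G S wo; have /andP[_] := proj2 wo 0%N.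
by rewrite /=; split; lra.
Qed.

Lemma ann_set_fst : ann_set c = fst @` bundle c.
Proof.
apply/seteqP; split=> [z [w wo ->]|z [y /bundle_ann[w wo ->] <-]]; last by exists w.
by exists (bundle_pt w) => //; apply/bundle_ann; exists w.
Qed.

Lemma ann_set_compact : compact (ann_set c).
Proof.
rewrite ann_set_fst; apply: continuous_compact bundle_compact.
by apply: continuous_subspaceT => x; exact: cvg_fst.
Qed.

Lemma ann_set_closed : closed (ann_set c).
Proof. by apply: compact_closed ann_set_compact; exact: norm_hausdorff. Qed.

Lemma ann_semi_invariant : semi_invariant p q c (ann_set c).
Proof.
split; first exact: ann_set_compact.
  by move=> [w [_ wa] z0]; have /andP[] := wa 0%N; rewrite -z0 cabs0; have := e0; have := e1; lra.
by move=> z zR; exact: (ann_set_semi G cr zR).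
Qed.

(** Closeness is expressed by finitely many points of the circle orbits, which is
    what [steer] and [close_up] control. *)
Lemma deform_modulus (x : R) : 0 < x -> exists M, forall u v, ann_orbit 0 u -> ann_orbit 0 v ->
  (forall n, (n <= M)%N -> cabs (u n - v n) <= e) ->
  cabs (deform c u 0%N - deform c v 0%N) < x /\ cabs (code (deform c u) - code (deform c v)) < x.
Proof.
move=> x0; have dB : 0 < 1 - d by rewrite subr_gt0.
have x2 : 0 < x / 2 by rewrite divr_gt0.
have [K KP] := geometric_lt (2 * (r * (1 + e) / (1 - d))) (ltW d0) d1 x2.
pose y := Num.min (x / 2) (x / 2 * (1 - d) / r).
have y0 : 0 < y by rewrite /y lt_min x2 divr_gt0 // mulr_gt0.
have [L LP] := geometric_lt (2 * e) (ltW (par_lam0 G)) (par_lam1 G) y0.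
exists (K + L)%N => u v uo vo uv.
have cl n : (n <= K)%N -> cabs (deform c u n - deform c v n) < y.
  move=> nK; apply: le_lt_trans (deform_finite G cr uo vo uv _) _; first exact: leq_trans (leq_addr _ _).
  apply: LP; rewrite -addnBAC //; exact: leq_addl.
split; first by apply: lt_le_trans (cl 0%N (leq0n _)) _; rewrite /y ge_min; apply/orP; left; lra.
have mu := ann_bounded (deform_ann G cr uo); have mv := ann_bounded (deform_ann G cr vo).
apply: le_lt_trans (code_dist_fin r_ge0 d0 d1 mu mv (ltW y0) (N := K) _) _.
  by move=> n nK; apply: ltW; exact: cl.
have h1 := KP K (leqnn K).
have : r * y / (1 - d) <= x / 2.
  rewrite ler_pdivrMr // mulrC -ler_pdivlMr //.
  by rewrite /y ge_min lexx orbT.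
by lra.
Qed.

Lemma ann_close_up w (x : R) : 0 < x -> ann_orbit c w -> exists N v, [/\ (0 < N)%N, ann_orbit c v,
  tail N v = v, cabs (w 0%N - v 0%N) < x & cabs (code w - code v) < x].
Proof.
move=> x0 wo; have [u uo ->] := deform_onto G cr wo; have [M MP] := deform_modulus x0.
have [N [v [N0 vo v1 uv vN]]] := close_up (par_q0 G) (par_pq G) M e0 (proj1 uo) (ann_unit G uo).
have vr : ann_orbit 0 v.
  by split=> // n; rewrite /ann v1; have e0' := e0; apply/andP; split; lra.
exists N, (deform c v); have [h1 h2] := MP u v uo vr uv.
split; [exact: N0 | exact: (deform_ann G cr vr) | | exact: h1 | exact: h2].
by rewrite -(deform_tail G cr N vr) vN.
Qed.

Lemma iter_image_in n (A : set C) y : iter n (image_in p q c (ann_set c)) A y ->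
  ann_set c y \/ A y.
Proof. by case: n => [|n]; [right | move=> [z _ [_ yR]]; left]. Qed.

Lemma iter_image_chain n (A : set C) w : A (w 0%N) -> ann_orbit c w ->
  iter n (image_in p q c (ann_set c)) A (w n).
Proof.
move=> Aw wo; elim: n => [//|n IH]; exists (w n) => //; split; first exact: (proj1 wo n).
by exists (tail n.+1 w); [exact: ann_orbit_tail | rewrite /tail addn0].
Qed.

(** [steer] is applied on the circle and carried over to f_c by [deform_modulus];
    that its time is the same for all targets gives equality of sets. *)
Lemma ann_leo : leo p q c (ann_set c).
Proof.
move=> z [w wo ->] O /cnbhsP[x x0 xO].
have [u uo wE] := deform_onto G cr wo; have [M MP] := deform_modulus x0.
have [N [N0 NP]] := steer (par_q0 G) (par_pq G) M e0; exists N => //.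
apply/seteqP; split=> [y|y [v vo ->]].
  by move=> /iter_image_in[//|[]].
have [u' uo' ->] := deform_onto G cr vo.
have [t [to t1 ut tN]] := NP u u' (proj1 uo) (ann_unit G uo) (proj1 uo') (ann_unit G uo').
have tr : ann_orbit 0 t.
  by split=> // n; rewrite /ann t1; have e0' := e0; apply/andP; split; lra.
have -> : deform c u' 0%N = deform c t N.
  by rewrite -tN (deform_tail G cr N tr) /tail addn0.
have [h1 _] := MP u t uo tr ut.
apply: (@iter_image_chain N _ (deform c t)); last exact: (deform_ann G cr tr).
split; first by apply: xO; rewrite wE.
by exists (deform c t) => //; exact: (deform_ann G cr tr).
Qed.

(** A periodic orbit stays in the neighbourhood for ever, so it lies in the
    bundle; conversely [ann_close_up] makes the periodic points dense. *)
Lemma periodic_bundle (W : set (C * C)) : bundle c `<=` W -> W `<=` bundle_nbhd c ->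
  closure (periodic_points W (fmap c)) = bundle c.
Proof.
move=> BW WN; apply/seteqP; split.
  rewrite [X in _ `<=` X](iffLR (closure_id _) bundle_closed); apply: closureS => x [n [n0 xn xW]].
  have per k : iter k (fmap c) x = iter (k %% n) (fmap c) x.
    rewrite {1}(divn_eq k n) addnC iterD; congr (iter _ _ _).
    by elim: (k %/ n)%N => [//|i IH]; rewrite mulSn iterD IH.
  apply: (fmap_orbit_bundle (x := fun k => iter k (fmap c) x)) => k; last exact: iterS.
  by apply: WN; rewrite per; apply: xW; rewrite ltn_mod.
move=> y /bundle_ann[w wo ->]; apply/closureP2 => s s0.
have [N [v [N0 vo vN h1 h2]]] := ann_close_up s0 wo.
exists (bundle_pt v); last by apply/prod_ballE; split; [exact: h1 | exact: h2].
have it k : iter k (fmap c) (bundle_pt v) = bundle_pt (tail k v).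
  elim: k => [|k IH]; first by rewrite tail0.
  by rewrite iterS IH (fmap_bundle G S cr (ann_orbit_tail k vo)) tailS.
exists N; split=> //; first by rewrite it vN.
move=> k _; rewrite it; apply/BW/bundle_ann; exists (tail k v) => //.
exact: ann_orbit_tail.
Qed.

End FixedC.
End BundleDynamics.

(** * Expansion and the Julia set *)

Section Paths.
Variable R : realType.
Local Notation C := (C R).

Lemma path_connected (A : set C) (x0 : C) :
  (forall z, A z -> exists g : R -> C, [/\ continuous g, g 0 = x0, g 1 = z &
     forall s, 0 <= s -> s <= 1 -> A (g s)]) -> connected A.
Proof.
move=> H; pose g z := xget (fun=> x0) [set g : R -> C | [/\ continuous g, g 0 = x0, g 1 = z &
     forall s, 0 <= s -> s <= 1 -> A (g s)]].
have gP z : A z -> [/\ continuous (g z), g z 0 = x0, g z 1 = z &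
     forall s, 0 <= s -> s <= 1 -> A (g z s)].
  by move=> /H[f fP]; rewrite /g; case: xgetP => [f' _ //|/(_ f)].
have -> : A = \bigcup_(z in A) (g z @` `[0, 1]).
  apply/seteqP; split=> [z Az|z [y Ay [s]]].
    by exists z => //; exists 1; [rewrite /= in_itv /= ler01 lexx | case: (gP _ Az)].
  by rewrite /= in_itv /= => /andP[s0 s1] <-; case: (gP _ Ay) => _ _ _; apply.
apply: bigcup_connected.
  exists x0 => z Az; exists 0; first by rewrite /= in_itv /= lexx ler01.
  by case: (gP _ Az).
move=> z Az; apply: connected_continuous_connected; first exact: segment_connected.
by apply: continuous_subspaceT; case: (gP _ Az).
Qed.

Lemma lip_continuous (g : R -> C) (K : R) : (forall s t, cabs (g s - g t) <= K * `|s - t|) ->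
  continuous g.
Proof.
move=> gK s; apply/ccvgP => x x0.
pose K' := `|K| + 1; have K0 : 0 < K' by rewrite /K' ltr_wpDl.
apply/nbhs_ballP; exists (x / K') => /=; first by rewrite divr_gt0.
move=> t; rewrite /ball /= ltr_pdivlMr // => st.
apply: le_lt_trans (gK s t) _; apply: le_lt_trans st; rewrite mulrC.
by apply: ler_wpM2l => //; rewrite /K'; have := ler_norm K; lra.
Qed.

Lemma disk_region (x : R) : region [set z : C | cabs z < x].
Proof.
split.
  rewrite (_ : [set z | _] = [set z | cabs (0 - z) < x]); first exact: cball_open.
  by apply/seteqP; split=> z /=; rewrite sub0r cabsN.
apply: (@path_connected _ 0) => z /= zx; exists (fun s => ofR s * z); split.
- apply: (@lip_continuous _ (cabs z)) => s t.
  by rewrite -mulrBl -ofRB cabsM cabs_ofR mulrC.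
- by rewrite ofR0 mul0r.
- by rewrite ofR1 mul1r.
- move=> s s0 s1; rewrite cabsM cabs_ofR ger0_norm //.
  by apply: le_lt_trans zx; apply: ler_piMl => //; exact: cabs_ge0.
Qed.

Lemma polar (z : C) : exists t, z = ofR (cabs z) * eit t.
Proof.
have [->|z0] := eqVneq z 0; first by exists 0; rewrite cabs0 ofR0 mul0r.
have zN : ofR (cabs z) != 0 by rewrite -ofR0 (inj_eq (@ofR_inj R)) gt_eqF // cabs_gt0.
have [|t tE] := @eit_surj R (z / ofR (cabs z)).
  by rewrite cabsM cabsV cabs_ofR ger0_norm ?cabs_ge0 // divff // gt_eqF // cabs_gt0.
by exists t; rewrite -tE mulrC divfK.
Qed.

Lemma outside_region (x : R) : 0 <= x -> x < 1 -> region [set z : C | x < cabs z].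
Proof.
move=> x0 x1; split.
  rewrite openE => z /= zx; apply/cnbhsP; exists (cabs z - x); first by rewrite subr_gt0.
  by move=> w zw /=; have := cabs_dist z w; lra.
apply: (@path_connected _ 1) => z /= zx; have [t tE] := polar z.
set a := cabs z in zx tE.
exists (fun s => ofR (1 + s * (a - 1)) * eit (s * t)); split.
- have c1 : continuous (fun s : R => ofR (1 + s * (a - 1)) : C).
    apply: (@lip_continuous _ `|a - 1|) => u v.
    by rewrite -ofRB cabs_ofR (_ : _ - _ = (u - v) * (a - 1)) ?normrM 1?mulrC //; ring.
  have c2 : continuous (fun s : R => eit (s * t)).
    apply: (@lip_continuous _ (2 * `|t|)) => u v; apply: le_trans (eit_lip _ _) _.
    by rewrite -mulrBl normrM mulrA [leRHS]mulrAC.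
  by move=> s; exact: (cvgM (c1 s) (c2 s)).
- by rewrite !mul0r addr0 eit0 mulr1 ofR1.
- by rewrite !mul1r addrC subrK -tE.
- move=> s s0 s1; have a0 : 0 <= s * a by rewrite mulr_ge0 // cabs_ge0.
  rewrite cabsM cabs_eit mulr1 cabs_ofR ger0_norm; last by lra.
  have [a1|a1] := leP a 1.
    have H : s * (1 - a) <= 1 - a by apply: ler_piMl; lra.
    by lra.
  have H : 0 <= s * (a - 1) by apply: mulr_ge0; lra.
  by lra.
Qed.

End Paths.

Section Julia.
Variables (R : realType) (p q : nat) (lam e rho r d m b eta : R).
Local Notation C := (C R).
Hypothesis G : shadow_params p q lam e rho.
Hypothesis S : separation p q e rho r d m b.
Local Notation orbit := (orbit p q).
Local Notation ann_orbit := (ann_orbit p q e).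
Local Notation ann_set := (ann_set p q e).
Local Notation dil := (dil R p q).

(** In the disk of radius [eta] around 0 branches have derivatives of modulus at
    most 1; outside it, [rho] is too small to balance the attraction to 0 or to
    infinity at moduli off [1 - e, 1 + e]. *)
Record cycle_params : Prop := CycleParams {
  cyc_eta0 : 0 < eta;
  cyc_eta : dil ^+ q * eta ^+ (p - q) <= 1;
  cyc_rho : q%:R * rho < e * eta;
  cyc_rho1 : (1 + rho) ^+ q < 1 + e }.
Hypothesis Y : cycle_params.

Let e0 := par_e0 G.
Let e1 := par_e1 G.
Let rho0 := par_rho0 G.
Let rhoe := par_rhoe G.
Let p0 := par_p0 G.
Let q0 := par_q0 G.
Let lam0 := par_lam0 G.
Let lam1 := par_lam1 G.
Let eta0 := cyc_eta0 Y.
Let qp : (q <= p)%N. Proof. exact: ltnW (par_pq G). Qed.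

Lemma lamV_gt1 : 1 < lam^-1.
Proof. by rewrite invf_gt1. Qed.

(** With [branch_cabs_derive1], the contraction condition [par_contr] becomes a
    lower bound 1 / lam for the derivatives of branches. *)
Lemma lamV_le (x : R) : 1 - 8 * e <= x -> lam^-1 ^+ q <= dil ^+ q * x ^+ (p - q).
Proof.
move=> x8; have e1' := e1; have e0' := e0; set y := 1 - 8 * e in x8.
have y0 : 0 <= y by rewrite /y; lra.
have y1 : y <= 1 by rewrite /y; lra.
apply: (@le_trans _ _ (dil ^+ q * y ^+ (p - q))); last first.
  apply: ler_wpM2l; first by rewrite exprn_ge0 // ltW // /dil divr_gt0 // ltr0n.
  by apply: lerXn2r; rewrite ?nnegrE // (le_trans y0).
have H : lam^-1 <= dil * y ^+ p.-1.
  rewrite /dil mulrAC ler_pdivlMr ?ltr0n // ler_pdivrMl //.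
  have T0 := taylor_bound_ge0 R p; have := par_contr G; rewrite -/y => P.
  apply: le_trans (le_trans _ P) _.
    by apply: ler_peMr => //; apply: exprn_ege1; lra.
  by apply: ler_wpM2l; [exact: ltW | rewrite lerBlDr lerDl mulr_ge0 //; lra].
apply: (@le_trans _ _ ((dil * y ^+ p.-1) ^+ q)).
  by apply: lerXn2r; rewrite ?nnegrE ?invr_ge0 ?(ltW lam0) // (le_trans _ H) // invr_ge0 ltW.
rewrite exprMn -exprM; apply: ler_wpM2l; first by rewrite exprn_ge0 // ltW // /dil divr_gt0 // ltr0n.
apply: ler_wiXn2l => //.
apply: (@leq_trans p.-1); last by rewrite leq_pmulr // q0.
by rewrite -subn1; exact: leq_sub2l q0.
Qed.

Lemma branch_expands c z phi : branch_at p q c z phi -> 1 - 8 * e <= cabs z ->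
  lam^-1 <= cabs (derive1 phi z).
Proof.
move=> B z8; have e1' := e1; have e0' := e0.
rewrite -(@ler_pXn2r _ q) ?nnegrE ?cabs_ge0 ?invr_ge0 ?(ltW lam0) ?q0 //.
rewrite (branch_cabs_derive1 q0 qp _ B) ?lamV_le // -cabs_gt0; lra.
Qed.

Lemma ann_expanding c : cabs c <= rho -> expanding_hyperbolic p q c (ann_set c).
Proof.
move=> cr; split; first exact: (ann_semi_invariant G S cr).
have e1' := e1; have e0' := e0.
exists [set z | 1 - 8 * e < cabs z], (fun=> 1); split.
- by apply: outside_region; lra.
- by move=> z [w [_ wa] ->]; have /andP[] := wa 0%N; rewrite /=; lra.
- by split=> // ; apply: continuous_subspaceT; exact: cst_continuous.
- apply: (@lt_le_trans _ _ (lam^-1)%:E); first by rewrite lte_fin lamV_gt1.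
  apply: le_ereal_inf_tmp => _ [z [phi [/= zV B _ ->]]].
  by rewrite divr1 mulr1 lee_fin; apply: branch_expands B _; exact: ltW.
Qed.

Section Cycles.
Variable c : C.
Hypothesis cr : cabs c <= rho.

Lemma tail_period (z : nat -> C) n i j : tail n z = z -> z (i + j * n)%N = z i.
Proof.
move=> zn; elim: j => [|j IH]; first by rewrite addn0.
by rewrite -IH mulSn addnCA -[in RHS]zn.
Qed.

(** The index is positive so that the maximum has a predecessor on the orbit. *)
Lemma periodic_max (z : nat -> C) n : (0 < n)%N -> tail n z = z ->
  exists2 i, (0 < i)%N & forall k, cabs (z k) <= cabs (z i).
Proof.
move=> n0 zn.
have per k : z k = z (k %% n)%N.
  by rewrite {1}(divn_eq k n) addnC tail_period.
pose i := [arg max_(i > Ordinal n0) cabs (z i)]%O.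
exists (i + n)%N; first by rewrite addn_gt0 n0 orbT.
move=> k; have -> : z (i + n)%N = z i by rewrite -[in RHS]zn /tail addnC.
rewrite (per k); rewrite /i; case: Order.TotalTheory.arg_maxP => // j _ H.
by have := H (Ordinal (ltn_pmod k n0)) isT.
Qed.

Lemma bernoulli_sub (x : R) n : 0 <= x -> x <= 1 -> 1 - n%:R * x <= (1 - x) ^+ n.
Proof.
move=> x0 x1; elim: n => [|n IH]; first by rewrite mul0r subr0.
rewrite exprS -natr1; have h : 0 <= (1 - x) ^+ n by rewrite exprn_ge0 // subr_ge0.
have h2 : 0 <= (n%:R : R) by [].
have : (1 - x) * (1 - n%:R * x) <= (1 - x) * (1 - x) ^+ n by apply: ler_wpM2l => //; lra.
have h3 : 0 <= n%:R * (x * x) by rewrite !mulr_ge0.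
by lra.
Qed.

Lemma rho_eta : rho < eta.
Proof.
have := cyc_rho Y; have q1 : (1 : R) <= q%:R by rewrite ler1n q0.
have : rho <= q%:R * rho by apply: ler_peMl => //; exact: ltW.
have : e * eta <= eta by apply: ler_piMl; [exact: ltW | have := e1; have := e0; lra].
by lra.
Qed.

(** A point of modulus at most x cannot have an image of modulus x or more, which
    would lie at distance x - rho or more from c. *)
Lemma inner_gap (x : R) : eta <= x -> x <= 1 - e -> x ^+ p < (x - rho) ^+ q.
Proof.
move=> xe x1; have x0 : 0 < x by exact: lt_le_trans xe.
have re := rho_eta; have rho0' := rho0; have e0' := e0.
have -> : x - rho = x * (1 - rho / x) by field; rewrite gt_eqF.
rewrite exprMn -(subnKC qp) exprD ltr_pM2l ?exprn_gt0 //.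
have rx : rho / x <= 1 by rewrite ler_pdivrMr // mul1r; lra.
have rx0 : 0 <= rho / x by rewrite divr_ge0 // ltW.
apply: lt_le_trans (bernoulli_sub q rx0 rx).
apply: (@le_lt_trans _ _ x).
  have := par_pq G; rewrite -subn_gt0; case: (p - q)%N => // k _.
  by rewrite exprS; apply: ler_piMr; rewrite ?(ltW x0) // exprn_ile1 ?(ltW x0) //; lra.
apply: le_lt_trans x1 _; suff : q%:R * (rho / x) < e by lra.
rewrite mulrA ltr_pdivrMr //; apply: lt_le_trans (cyc_rho Y) _.
by rewrite ler_pM2l.
Qed.

(** A point of modulus x has images at distance more than x + rho from c, hence
    of modulus more than x. *)
Lemma outer_gap (x : R) : 1 + e < x -> (x + rho) ^+ q < x ^+ p.
Proof.
move=> x1; have e0' := e0; have rho0' := rho0; have x0 : 0 < x by lra.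
have -> : x + rho = x * (1 + rho / x) by field; rewrite gt_eqF.
rewrite exprMn -(subnKC qp) exprD ltr_pM2l ?exprn_gt0 //.
apply: (@le_lt_trans _ _ ((1 + rho) ^+ q)).
  apply: lerXn2r; rewrite ?nnegrE ?addr_ge0 ?divr_ge0 ?(ltW rho0) ?(ltW x0) //.
  by rewrite lerD2l ler_pdivrMr //; apply: ler_peMr; lra.
have x2 : 1 <= x by lra.
apply: lt_trans (cyc_rho1 Y) _; apply: lt_le_trans x1 _.
have := par_pq G; rewrite -subn_gt0; case: (p - q)%N => // k _.
by rewrite exprS; apply: ler_peMr; [exact: ltW | exact: exprn_ege1].
Qed.

(** By [outer_gap] the largest modulus on the orbit is at most 1 + e. Once below
    1 - e the moduli stay there, by [inner_gap]; the largest one is then itself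
    below 1 - e, and [inner_gap] at that modulus leaves only values below eta. *)
Lemma periodic_dichotomy (z : nat -> C) n : (0 < n)%N -> tail n z = z -> orbit c z ->
  (forall k, ann e (z k)) \/ (forall k, cabs (z k) < eta).
Proof.
move=> n0 zn zo; have [i i0 imax] := periodic_max n0 zn.
have e0' := e0; have e1' := e1; have rho0' := rho0; have rhoe' := rhoe; have cr' := cr.
have E k : cabs (z k.+1 - c) ^+ q = cabs (z k) ^+ p.
  by rewrite -!cabsX; congr cabs; exact: zo.
have up : cabs (z i) <= 1 + e.
  rewrite leNgt; apply/negP => /outer_gap; rewrite -E.
  apply/negP; rewrite -leNgt; apply: lerXn2r; rewrite ?nnegrE ?cabs_ge0 ?addr_ge0 ?cabs_ge0 ?(ltW rho0) //.
  by apply: le_trans (cabsB _ _) _; have := imax i.+1; lra.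
have [lo|lo] := pselect (forall k, 1 - e <= cabs (z k)).
  by left=> k; apply/andP; split; [exact: lo | exact: le_trans (imax k) up].
right; move/existsNP: lo => [k /negP]; rewrite -ltNge => kl.
have re := rho_eta.
have step j : cabs (z j) < 1 - e -> cabs (z j.+1) < 1 - e.
  move=> jl; have gap : cabs (z j) ^+ p < (1 - e - rho) ^+ q.
    apply: le_lt_trans (inner_gap (x := 1 - e) _ _) => //.
      by apply: lerXn2r; rewrite ?nnegrE ?cabs_ge0 //; lra.
    have := cyc_eta Y; rewrite leNgt => H; rewrite leNgt; apply/negP => h; move/negP: H; apply.
    have h' : 1 - 8 * e <= eta by lra.
    apply: lt_le_trans (lamV_le h').
    by rewrite exprn_egt1 ?lamV_gt1 // -lt0n q0.
  move: gap; rewrite -E ltr_pXn2r ?nnegrE ?cabs_ge0 ?q0 //; last by lra.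
  by have := cabs_dist (z j.+1) c; lra.
have low j : cabs (z (k + j)%N) < 1 - e.
  by elim: j => [|j IH]; [rewrite addn0 | rewrite addnS; exact: step].
have ilow : cabs (z i) < 1 - e.
  rewrite -(tail_period i k zn) -[(k * n)%N](@subnKC k) ?leq_pmulr // addnCA.
  exact: low.
suff : cabs (z i) < eta by move=> h j; exact: le_lt_trans (imax j) h.
rewrite ltNge; apply/negP => h.
have := inner_gap h (ltW ilow); apply/negP; rewrite -leNgt.
case: i i0 imax up ilow h => // i _ imax up ilow h.
apply: (@le_trans _ _ (cabs (z i.+1 - c) ^+ q)).
  have := cabs_dist (z i.+1) c.
  by move=> h2; apply: lerXn2r; rewrite ?nnegrE ?cabs_ge0 //; lra.
by rewrite E; apply: lerXn2r; rewrite ?nnegrE ?cabs_ge0.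
Qed.

(** Trapped in the disk of radius eta, a cycle has a multiplier of modulus at
    most 1. *)
Lemma repelling_in_ann n z : repelling_cycle p q c n z -> forall k, (k < n)%N -> ann_set c (z k).
Proof.
move=> [n0 zn zc [phi [phiP der]]].
pose w k := z (k %% n)%N.
have wS k : (k < n)%N -> w k = z k by move=> kn; rewrite /w modn_small.
have wn : tail n w = w by apply/funext => k; rewrite /tail /w modnDl.
have wo : orbit c w.
  move=> k; rewrite /w; have kn : (k %% n < n)%N by rewrite ltn_mod.
  suff -> : z (k.+1 %% n)%N = z (k %% n).+1 by case: (zc _ kn).
  rewrite -addn1 -modnDml addn1; move: kn; rewrite leq_eqVlt => /orP[/eqP ->|kn].
    by rewrite modnn zn.
  by rewrite modn_small.
have [wa|small] := periodic_dichotomy n0 wn wo.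
  move=> k kn; rewrite -(wS k kn); exists (tail k w); last by rewrite /tail addn0.
  exact: (ann_orbit_tail k (conj wo wa)).
move: der; have [_ /has_der1 ->] := comp_branches_has_der phiP.
suff : cabs (\prod_(k < n) derive1 (phi k) (z k)) <= 1 by rewrite leNgt => /negP.
elim/big_ind: _ => [|x y x1 y1|k _]; first by rewrite cabs1.
  by rewrite cabsM; apply: mulr_ile1; rewrite ?cabs_ge0.
have [B _] := phiP k (ltn_ord k); have [zk0 _] := zc k (ltn_ord k).
rewrite -(@expr_le1 _ q) ?cabs_ge0 ?q0 // (branch_cabs_derive1 q0 qp zk0 B).
apply: le_trans (cyc_eta Y); apply: ler_wpM2l; first by rewrite exprn_ge0 // ltW // /dil divr_gt0 // ltr0n.
apply: lerXn2r; rewrite ?nnegrE ?cabs_ge0 ?(ltW eta0) //.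
by apply: ltW; rewrite -(wS k (ltn_ord k)).
Qed.

Lemma periodic_repelling v n : (0 < n)%N -> ann_orbit c v -> tail n v = v ->
  repelling_cycle p q c n v.
Proof.
move=> n0 [vo va] vn; have e1' := e1; have e0' := e0; split=> //.
- by rewrite -{2}vn /tail addn0.
- move=> k _; split; last exact: vo.
  by have /andP[] := va k; rewrite -cabs_gt0; lra.
have phiP k : branch_at p q c (v k) (lbranch p q c (v k) (v k.+1)) /\
    lbranch p q c (v k) (v k.+1) (v k) = v k.+1.
  exact: (lbranch_at G S cr (va k) (vo k)).
exists (fun k => lbranch p q c (v k) (v k.+1)); split=> // .
have [_ /has_der1 ->] := @comp_branches_has_der R p q c v (fun k => lbranch p q c (v k) (v k.+1)) n (fun k _ => phiP k).
case: n n0 vn => // n _ _; rewrite big_ord_recl cabsM.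
have big k : lam^-1 <= cabs (derive1 (lbranch p q c (v k) (v k.+1)) (v k)).
  by apply: (branch_expands (proj1 (phiP k))); have /andP[] := va k; lra.
have h1 := lt_le_trans lamV_gt1 (big 0%N).
apply: lt_le_trans h1 _; apply: ler_peMr; first exact: cabs_ge0.
elim/big_ind: _ => [|x y x1 y1|k _]; first by rewrite cabs1.
  by rewrite cabsM; apply: mulr_ege1.
exact: le_trans (ltW lamV_gt1) (big _).
Qed.

(** The repelling cycles are the periodic orbits near the unit circle, and these are dense. *)
Lemma julia_ann : julia p q c = ann_set c.
Proof.
apply/seteqP; split.
  rewrite [X in _ `<=` X](iffLR (closure_id _) (ann_set_closed G S cr)); apply: closureS.
  by move=> x [n [z [zr [k kn ->]]]]; exact: repelling_in_ann zr _ kn.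
move=> z [w wo ->]; apply/closureP1 => s s0.
have [N [v [N0 vo vN h1 h2]]] := ann_close_up G S cr s0 wo.
exists (v 0%N) => //; exists N, v; split; first exact: periodic_repelling.
by exists 0%N.
Qed.

Lemma ann_repeller : hyperbolic_repeller p q c (ann_set c).
Proof.
split; first exact: ann_expanding.
apply/seteqP; split=> [z [w wR zw]|z zR]; first exact: (ann_set_preimage G cr wR zw).
by have [[w wR zw] _] := ann_set_semi G cr zR; exists w.
Qed.

End Cycles.
End Julia.

(** * Holomorphic dependence on the parameter *)

Section CauchyQuotients.
Variable R : realType.
Local Notation C := (C R).

(** The derivative is the limit along increments x / 2, x / 4, ... , and the
    hypothesis compares any other increment with these. *)
Lemma derivable_cauchy (f : C -> C) (z : C) (K x : R) : 0 < x -> 0 <= K ->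
  (forall h k, h != 0 -> k != 0 -> cabs h < x -> cabs k < x ->
     cabs (h^-1 * (f (z + h) - f z) - k^-1 * (f (z + k) - f z)) <= K * (cabs h + cabs k)) ->
  derivable f z 1.
Proof.
move=> x0 K0 H; pose Q h := h^-1 * (f (z + h) - f z).
have i0 : (0 : R) < 2^-1 by rewrite invr_gt0.
have i1 : 2^-1 < (1 : R) by lra.
pose s n : C := ofR (x / 2 * 2^-1 ^+ n).
have sp n : 0 < x / 2 * 2^-1 ^+ n by rewrite mulr_gt0 ?exprn_gt0 // divr_gt0.
have sE n : cabs (s n) = x / 2 * 2^-1 ^+ n by rewrite cabs_ofR gtr0_norm.
have sN n : s n != 0 by rewrite -cabs_gt0 sE.
have sx n : cabs (s n) < x.
  rewrite sE; apply: (@le_lt_trans _ _ (x / 2)); last by lra.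
  by apply: ler_piMr; [rewrite ltW // divr_gt0 | apply: exprn_ile1; lra].
have Qc : cvgn (Q \o s).
  apply: (@geometric_cvg _ _ (K * x) 2^-1); [exact: ltW | lra |].
  move=> n; apply: le_trans (H _ _ (sN _) (sN _) (sx _) (sx _)) _.
  rewrite -mulrA; apply: ler_wpM2l => //; rewrite !sE exprS.
  by have := exprn_gt0 n i0; move: (2^-1 ^+ n) => y y0; have := mulr_gt0 x0 y0; lra.
have Ql h : h != 0 -> cabs h < x -> cabs (Q h - limn (Q \o s)) <= K * cabs h.
  move=> hN hx; apply/ler_addgt0Pr => y y0; apply: (ccvg_le Qc).
  have [N NP] := geometric_lt (K * (x / 2)) (ltW i0) i1 y0.
  exists N => n nN; apply: le_trans (H _ _ hN (sN n) hx (sx n)) _.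
  have := NP n nN; rewrite sE mulrDr mulrA; lra.
apply: (@has_der_derivable _ _ _ (limn (Q \o s))) => y y0.
pose K' := K + 1; have K'0 : 0 < K' by rewrite /K'; lra.
exists (Num.min x (y / K')) => [|w]; first by rewrite lt_min x0 divr_gt0.
rewrite lt_min => /andP[wx wy].
have [->|wz] := eqVneq w z; first by rewrite !subrr mulr0 subr0 cabs0 mulr0.
have wN : w - z != 0 by rewrite subr_eq0.
have := Ql _ wN wx; rewrite /Q (addrC z (w - z)) subrK => B.
have -> : f w - f z - limn (Q \o s) * (w - z) = (w - z) * ((w - z)^-1 * (f w - f z) - limn (Q \o s)).
  by field.
rewrite cabsM mulrC; apply: ler_wpM2r; first exact: cabs_ge0.
apply: le_trans B _; rewrite ltr_pdivlMr // in wy.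
by rewrite /K' mulrDr in wy; have := cabs_ge0 (w - z); rewrite mulrC; lra.
Qed.

Lemma norm2_le (x : C * C) (M : R) :
  `|x| <= ofR M <-> cabs x.1 <= M /\ cabs x.2 <= M.
Proof.
rewrite prod_normE !normE /Num.max lt_ofR; case: ltP => h; rewrite le_ofR; split=> [H|[]//].
  by split=> //; apply: le_trans H; exact: ltW.
by split=> //; exact: le_trans H.
Qed.

End CauchyQuotients.

Section Holomorphy.
Variables (R : realType) (p q : nat) (lam e rho : R).
Local Notation C := (C R).
Hypothesis G : shadow_params p q lam e rho.
Local Notation ann_orbit := (ann_orbit p q e).
Local Notation deform := (deform p q).
Local Notation kap := (kap lam).

Let e0 := par_e0 G.
Let e1 := par_e1 G.
Let rhoe := par_rhoe G.
Let q0 := par_q0 G.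
Let lam0 := par_lam0 G.
Let lam1 := par_lam1 G.
Let kap0 := kap_ge0 G.

(** First order expansion of both sides of [(W - c) ^+ q = w ^+ p]. *)
Lemma step_linear c c' w W w' W' : corr p q c w W -> corr p q c' w' W' ->
  cabs w <= 2 -> cabs w' <= 2 -> cabs (W - c) <= 2 -> cabs (W' - c') <= 2 ->
  cabs (p%:R * w ^+ p.-1 * (w' - w) - q%:R * (W - c) ^+ q.-1 * (W' - c' - (W - c)))
  <= taylor_bound R p * cabs (w' - w) ^+ 2 + taylor_bound R q * cabs (W' - c' - (W - c)) ^+ 2.
Proof.
rewrite /corr /mkset => E E' w2 w2' W2 W2'.
apply: le_trans (lerD (taylor2 p w2' w2) (taylor2 q W2' W2)).
rewrite E E' addrC [leRHS]addrC; apply: le_trans (cabsB _ _).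
by rewrite le_eqVlt; apply/orP; left; apply/eqP; congr cabs; ring.
Qed.

(** The linearised step contracts by the same factor as the step itself. *)
Lemma step_coefs c w W : ann (4 * e) w -> ann (4 * e) W -> cabs c <= e ->
  q%:R * cabs (W - c) ^+ q.-1 <= lam * (p%:R * cabs w ^+ p.-1) /\ 1 <= p%:R * cabs w ^+ p.-1.
Proof.
move=> /andP[w1 _] /andP[_ W2] ce; have e0' := e0; have e1' := e1.
have T0 := taylor_bound_ge0 R p; have P := par_contr G.
have h1 : p%:R * (1 - 8 * e) ^+ p.-1 <= p%:R * cabs w ^+ p.-1.
  by apply: ler_wpM2l => //; apply: lerXn2r; rewrite ?nnegrE ?cabs_ge0 //; lra.
have h2 : lam * (p%:R * (1 - 8 * e) ^+ p.-1 - taylor_bound R p * (8 * e)) <= lam * (p%:R * cabs w ^+ p.-1).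
  have h : 0 <= taylor_bound R p * (8 * e) by apply: mulr_ge0 => //; lra.
  by apply: ler_wpM2l; [exact: ltW | lra].
split.
  apply: le_trans (le_trans P h2); apply: ler_wpM2l => //.
  apply: lerXn2r; rewrite ?nnegrE ?cabs_ge0 //; first by lra.
  by apply: le_trans (cabsB _ _) _; lra.
have h3 : 1 <= q%:R * (1 + 8 * e) ^+ q.-1.
  by apply: mulr_ege1; [rewrite ler1n q0 | apply: exprn_ege1; lra].
have h4 := le_trans h3 (le_trans P h2); apply: le_trans h4 _.
by apply: ler_piMl; [rewrite mulr_ge0 ?exprn_ge0 ?cabs_ge0 | exact: ltW].
Qed.

Definition quot_const : R := taylor_bound R p * kap ^+ 2 + taylor_bound R q * (kap + 1) ^+ 2.

Lemma quot_const_ge0 : 0 <= quot_const.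
Proof. by apply: addr_ge0; apply: mulr_ge0; rewrite ?taylor_bound_ge0 ?sqr_ge0. Qed.

(** The difference quotients of [c |-> deform c u n] satisfy the linearised
    recursion up to an error linear in the increment. Their difference satisfies
    it without inhomogeneous term, and the recursion contracts; hence they are
    Cauchy, uniformly in n. *)
Lemma deform_quot (u : nat -> C) (c h k : C) n : ann_orbit 0 u -> h != 0 -> k != 0 ->
  cabs c <= rho -> cabs (c + h) <= rho -> cabs (c + k) <= rho ->
  cabs (h^-1 * (deform (c + h) u n - deform c u n) - k^-1 * (deform (c + k) u n - deform c u n))
  <= quot_const / (1 - lam) * (cabs h + cabs k).
Proof.
move=> uo hN kN cr hr kr; have e0' := e0; have e1' := e1; have rhoe' := rhoe.
have [wo wa] := deform_ann G cr uo.
pose Q h n := h^-1 * (deform (c + h) u n - deform c u n).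
have Qb h' j : h' != 0 -> cabs (c + h') <= rho -> cabs (Q h' j) <= kap.
  move=> h'N h'r; rewrite /Q cabsM cabsV mulrC ler_pdivrMr ?cabs_gt0 //.
  by have := deform_lip G j h'r cr uo; rewrite (_ : c + h' - c = h') //; ring.
have Qlin h' j : h' != 0 -> cabs (c + h') <= rho ->
    cabs (p%:R * deform c u j ^+ p.-1 * Q h' j -
      q%:R * (deform c u j.+1 - c) ^+ q.-1 * (Q h' j.+1 - 1)) <= quot_const * cabs h'.
  move=> h'N h'r; have [wo' wa'] := deform_ann G h'r uo.
  have /andP[_ l1] := wa j; have /andP[_ l2] := wa' j.
  have /andP[_ l3] := wa j.+1; have /andP[_ l4] := wa' j.+1.
  have L := step_linear (wo j) (wo' j) _ _ _ _.
  have h0 : 0 < cabs h' by rewrite cabs_gt0.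
  rewrite -(ler_pM2l h0) -cabsM.
  have -> : h' * (p%:R * deform c u j ^+ p.-1 * Q h' j -
      q%:R * (deform c u j.+1 - c) ^+ q.-1 * (Q h' j.+1 - 1)) =
     p%:R * deform c u j ^+ p.-1 * (deform (c + h') u j - deform c u j) -
     q%:R * (deform c u j.+1 - c) ^+ q.-1 * (deform (c + h') u j.+1 - (c + h') - (deform c u j.+1 - c)).
    by rewrite /Q; field.
  apply: le_trans (L _ _ _ _) _.
  - by lra.
  - by lra.
  - by apply: le_trans (cabsB _ _) _; lra.
  - by apply: le_trans (cabsB _ _) _; lra.
  have hh : c + h' - c = h' by ring.
  have m1 := deform_lip G j h'r cr uo; rewrite hh in m1.
  have m2 := deform_lip G j.+1 h'r cr uo; rewrite hh in m2.
  have m3 : cabs (deform (c + h') u j.+1 - (c + h') - (deform c u j.+1 - c)) <= (kap + 1) * cabs h'.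
    rewrite (_ : _ - _ = (deform (c + h') u j.+1 - deform c u j.+1) - h'); last by ring.
    by apply: le_trans (cabsB _ _) _; rewrite mulrDl mul1r lerD2r.
  have -> : cabs h' * (quot_const * cabs h') = taylor_bound R p * (kap * cabs h') ^+ 2 +
     taylor_bound R q * ((kap + 1) * cabs h') ^+ 2 by rewrite /quot_const; ring.
  have k1 : 0 <= kap * cabs h' by apply: mulr_ge0 => //; exact: cabs_ge0.
  have k2 : 0 <= (kap + 1) * cabs h' by apply: mulr_ge0; [have := kap0; lra | exact: cabs_ge0].
  apply: lerD; apply: ler_wpM2l; rewrite ?taylor_bound_ge0 //; apply: lerXn2r => //;
    by rewrite nnegrE cabs_ge0.
have := @sup_contraction R (fun j => cabs (Q h j - Q k j)) lam (quot_const * (cabs h + cabs k)) (kap + kap)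
  (ltW lam0) lam1.
rewrite mulrAC => B; apply: B.
- by rewrite mulr_ge0 ?quot_const_ge0 ?addr_ge0 ?cabs_ge0.
- by move=> j; apply: le_trans (cabsB _ _) _; apply: lerD; exact: Qb.
move=> j.
have a4 i : ann (4 * e) (deform c u i) by apply: ann_le (wa i); lra.
have [|c1 c2] := step_coefs (a4 j) (a4 j.+1) (_ : cabs c <= e); first by lra.
have L := lerD (Qlin h j hN hr) (Qlin k j kN kr).
rewrite -mulrDr in L.
have L' := le_trans (cabsB _ _) L.
have L2 := le_trans (cabs_dist (p%:R * deform c u j ^+ p.-1 * (Q h j - Q k j))
  (q%:R * (deform c u j.+1 - c) ^+ q.-1 * (Q h j.+1 - Q k j.+1))) _.
have {L2} := L2 (quot_const * (cabs h + cabs k)).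
rewrite !cabsM !cabs_nat !cabsX; set P := p%:R * _ in c1 c2 *; set D := cabs (Q h j - Q k j).
set D1 := cabs (Q h j.+1 - Q k j.+1); set B := quot_const * _.
move=> /(_ _) L2; have {}L2 : P * D - q%:R * cabs (deform c u j.+1 - c) ^+ q.-1 * D1 <= B.
  apply: L2; apply: le_trans L'.
  by rewrite le_eqVlt; apply/orP; left; apply/eqP; congr cabs; ring.
have B0 : 0 <= B by rewrite mulr_ge0 ?quot_const_ge0 ?addr_ge0 ?cabs_ge0.
have D10 : 0 <= D1 by exact: cabs_ge0.
have P0 : 0 < P by exact: lt_le_trans c2.
rewrite -(ler_pM2l P0).
have h1 := ler_wpM2r D10 c1.
have h2 : B <= P * B by apply: ler_peMl.
by rewrite mulrDr mulrCA mulrA; lra.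
Qed.

End Holomorphy.

(** * The holomorphic motion and its uniqueness *)

Section Motion.
Variables (R : realType) (p q : nat) (lam e rho r d m b : R).
Local Notation C := (C R).
Hypothesis G : shadow_params p q lam e rho.
Hypothesis S : separation p q e rho r d m b.
Hypotheses (r_in : r < 1 - 2 * e) (r_out : 1 + 2 * e < (2 * r)^-1).
Local Notation orbit := (orbit p q).
Local Notation ann_orbit := (ann_orbit p q e).
Local Notation ann_set := (ann_set p q e).
Local Notation deform := (deform p q).
Local Notation code := (orbit_code r d).
Local Notation bundle_pt := (bundle_pt r d).
Local Notation kap := (kap lam).
Local Notation base := (motion_base p q r d).

Let e0 := par_e0 G.
Let rho0 := par_rho0 G.
Let r0 := sep_r0 S.
Let d0 := sep_d0 S.
Let rd := sep_rd S.
Let r_ge0 : 0 <= r. Proof. exact: ltW. Qed.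
Let d1 : d < 1. Proof. by have := r0; have := rd; lra. Qed.
Let kap0 := kap_ge0 G.
Let c0r := cabs_c0 G.

Definition disk : set C := [set c | cabs c < rho].

(** The orbit coded by x is recovered by choice; on the base it is unique by
    [code_inj]. *)
Definition motion (c : C) (x : C * C) : C * C :=
  bundle_pt (deform c (xget (fun=> 0) [set u | ann_orbit 0 u /\ bundle_pt u = x])).

Lemma baseP x : base x <-> exists2 u, ann_orbit 0 u & x = bundle_pt u.
Proof. by rewrite /motion_base (circle_ann G); exact: bundle_ann. Qed.

Lemma base_pt u : ann_orbit 0 u -> base (bundle_pt u).
Proof. by move=> uo; apply/baseP; exists u. Qed.

Lemma motionE c u : ann_orbit 0 u -> motion c (bundle_pt u) = bundle_pt (deform c u).
Proof.
move=> uo; rewrite /motion; case: xgetP => [v _ [vo E]|/(_ u)[]//].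
by rewrite (code_inj G S c0r vo uo) // ; case: E.
Qed.

Lemma motion0 x : base x -> motion 0 x = x.
Proof. by move=> /baseP[u uo ->]; rewrite motionE // (move0 G uo). Qed.

Lemma motion_setE c : cabs c <= rho -> motion_set p q r d motion c = ann_set c.
Proof.
move=> cr; apply/seteqP; split=> [_ [_ [_ /baseP[u uo ->] <-] <-]|z [w wo ->]].
  by rewrite motionE //; exists (deform c u) => //; exact: (deform_ann G cr uo).
have [u uo ->] := deform_onto G cr wo.
exists (bundle_pt (deform c u)) => //; exists (bundle_pt u); first exact: base_pt.
exact: motionE.
Qed.

Lemma ann_inv_class c : cabs c <= rho -> inv_class p q r c (ann_set c).
Proof.
move=> cr; split; first exact: (ann_semi_invariant G S cr).
move=> z [w [_ wa] ->]; have /andP[h1 h2] := wa 0%N; have e0' := e0; have := par_rhoe G => re.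
have r_in' := r_in; have r_out' := r_out; split; first by apply/andP; split; lra.
exists (w 0%N - c); last by rewrite addrC subrK.
have h3 := cabs_dist (w 0%N) c; have h4 := cabsB (w 0%N) c.
by apply/andP; split; lra.
Qed.

Lemma motion_dist c c' x : cabs c <= rho -> cabs c' <= rho -> base x ->
  cabs ((motion c x).1 - (motion c' x).1) <= kap * cabs (c - c') /\
  cabs ((motion c x).2 - (motion c' x).2) <= kap * cabs (c - c').
Proof.
move=> cr cr' /baseP[u uo ->]; rewrite !motionE //=.
have H n : cabs (deform c u n - deform c' u n) <= kap * cabs (c - c') by exact: (deform_lip G).
split=> //.
have bw := ann_bounded (deform_ann G cr uo); have bv := ann_bounded (deform_ann G cr' uo).
have k0 : 0 <= kap * cabs (c - c') by apply: mulr_ge0 => //; exact: cabs_ge0.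
apply: le_trans (code_dist r_ge0 d0 d1 bw bv k0 (fun n => H n.+1)) _.
rewrite ler_pdivrMr ?subr_gt0 // mulrC; apply: ler_wpM2l => //.
by have := rd; lra.
Qed.

Lemma pair_derivable (f g : C -> C) (z : C) : derivable f z 1 -> derivable g z 1 ->
  derivable (fun c => (f c, g c)) z 1.
Proof.
move=> /derivable1_diffP df /derivable1_diffP dg; apply/derivable1_diffP.
exact: (differentiable_pair df dg).
Qed.

Section Quotients.
Variables (u : nat -> C) (c : C).
Hypotheses (uo : ann_orbit 0 u) (cd : disk c).

Let cr : cabs c <= rho. Proof. exact: ltW. Qed.
Let K0 : 0 <= quot_const p q lam / (1 - lam).
Proof. by apply: divr_ge0; [exact: quot_const_ge0 | exact: ltW (par_lamB G)]. Qed.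
Let x0 : 0 < rho - cabs c. Proof. by rewrite subr_gt0. Qed.
Let near h : cabs h < rho - cabs c -> cabs (c + h) <= rho.
Proof. by move=> hx; apply: le_trans (cabsD _ _) _; lra. Qed.

Lemma deform_derivable n : derivable (fun c => deform c u n) c 1.
Proof.
apply: (derivable_cauchy x0 K0) => h k hN kN hx kx.
exact: (deform_quot G n uo hN kN cr (near hx) (near kx)).
Qed.

(** The code is linear in the orbit, so its difference quotients inherit the
    estimates of [deform_quot]. *)
Lemma code_derivable : derivable (fun c => code (deform c u)) c 1.
Proof.
apply: (derivable_cauchy x0 K0) => h k hN kN hx kx.
have b1 := ann_bounded (deform_ann G (near hx) uo).
have b2 := ann_bounded (deform_ann G (near kx) uo).
have b3 := ann_bounded (deform_ann G cr uo).
set X := _ * (cabs h + cabs k).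
have X0 : 0 <= X by rewrite /X; apply: mulr_ge0 => //; apply: addr_ge0; exact: cabs_ge0.
have E (f : (nat -> C) -> C) : h^-1 * (f (deform (c + h) u) - f (deform c u)) - k^-1 * (f (deform (c + k) u) - f (deform c u)) =
   h^-1 * f (deform (c + h) u) + (- k^-1) * f (deform (c + k) u) + (k^-1 - h^-1) * f (deform c u) by ring.
rewrite (E code); apply: le_trans (code_lincomb r_ge0 d0 d1 X0 b1 b2 b3 _) _.
  move=> n; rewrite -(E (fun w => w n.+1)).
  exact: (deform_quot G n.+1 uo hN kN cr (near hx) (near kx)).
rewrite ler_pdivrMr ?subr_gt0 // mulrC; apply: ler_wpM2l => //.
by have := rd; lra.
Qed.

End Quotients.

Lemma motion_holomorphic x : base x -> holomorphic_on disk (fun c => motion c x).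
Proof.
move=> /baseP[u uo ->] c cd.
have -> : (fun c => motion c (bundle_pt u)) = (fun c => (deform c u 0%N, code (deform c u))).
  by apply/funext => c'; rewrite motionE.
by apply: pair_derivable; [exact: deform_derivable | exact: code_derivable].
Qed.

Lemma hausdorff_le (A B : set C) (x : R) : 0 <= x ->
  (forall a, A a -> exists2 z, B z & cabs (a - z) <= x) ->
  (forall z, B z -> exists2 a, A a & cabs (a - z) <= x) ->
  (hausdorff_dist A B <= x%:E)%E.
Proof.
move=> x0 AB BA; rewrite /hausdorff_dist ge_max; apply/andP; split; apply: ge_ereal_sup.
  move=> _ [a Aa <-]; have [z Bz az] := AB a Aa.
  by apply: ge_ereal_inf; exists (cabs (a - z))%:E; [exists z | rewrite lee_fin].
move=> _ [z Bz <-]; have [a Aa az] := BA z Bz.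
by apply: ge_ereal_inf; exists (cabs (a - z))%:E; [exists a | rewrite lee_fin].
Qed.

Lemma hausdorff_ge0 (A B : set C) : A !=set0 -> (0 <= hausdorff_dist A B)%E.
Proof.
move=> [a Aa]; rewrite /hausdorff_dist le_max; apply/orP; left.
apply: (@le_trans _ _ (ereal_inf [set (cabs (a - z))%:E | z in B])).
  by apply: le_ereal_inf_tmp => _ [z _ <-]; rewrite lee_fin cabs_ge0.
by apply: ereal_sup_ubound; exists a.
Qed.

Lemma motion_continuous c : disk c ->
  hausdorff_dist (motion_set p q r d motion c') (motion_set p q r d motion c) @[c' --> c] --> 0%E.
Proof.
move=> cr; have cr1 : cabs c <= rho by exact: ltW.
have [one oneo _] : ann_set 0 1 by rewrite -(circle_ann G) /unit_circle /mkset cabs1.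
have cl : \forall c' \near c, cabs c' <= rho.
  apply/cnbhsP; exists (rho - cabs c); first by rewrite subr_gt0.
  by move=> w; have := cabs_dist w c; rewrite (cabsC w c); lra.
apply: (@squeeze_cvge _ (nbhs c) _ R (fun=> 0%E) _ (fun c0 => (kap * cabs (c - c0))%:E)).
- apply: filterS cl => c' cr'; rewrite !motion_setE //; apply/andP; split.
    apply: hausdorff_ge0; exists (deform c' one 0%N), (deform c' one) => //.
    exact: (deform_ann G cr' oneo).
  apply: hausdorff_le; first by apply: mulr_ge0 => //; exact: cabs_ge0.
    move=> _ [w wo ->]; have [u uo ->] := deform_onto G cr' wo.
    exists (deform c u 0%N); first by exists (deform c u) => //; exact: (deform_ann G cr1 uo).
    by rewrite cabsC; exact: (deform_lip G).
  move=> _ [w wo ->]; have [u uo ->] := deform_onto G cr1 wo.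
  exists (deform c' u 0%N); first by exists (deform c' u) => //; exact: (deform_ann G cr' uo).
  by rewrite cabsC; exact: (deform_lip G).
- exact: cvg_cst.
- apply/fine_cvgP; split; first by near=> c'.
  apply/cvgrPdist_lt => x x0 /=.
  pose K := kap + 1; have K0 : 0 < K by rewrite /K; have := kap0; lra.
  apply/cnbhsP; exists (x / K); first by rewrite divr_gt0.
  move=> w; rewrite ltr_pdivlMr // sub0r normrN => h.
  have h0 := cabs_ge0 (c - w).
  rewrite ger0_norm; last by apply: mulr_ge0.
  by apply: le_lt_trans h; rewrite /K mulrDr mulr1 mulrC lerDl.
Unshelve. all: by end_near. Qed.

Lemma motion_bundle_motion : bundle_motion p q r d disk motion.
Proof.
have cle c : disk c -> cabs c <= rho by exact: ltW.
split.
- exact: motion0.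
- move=> c /cle cr x y /set_mem/baseP[u uo ->] /set_mem/baseP[v vo ->].
  rewrite !motionE // => -[E1 E2]; congr bundle_pt.
  apply: (deform_inj G cr uo vo).
  exact: (code_inj G S cr (deform_ann G cr uo) (deform_ann G cr vo) E1 E2).
- exact: motion_holomorphic.
- move=> c /cle cr; rewrite motion_setE //; split; first exact: ann_inv_class.
  exact: (ann_expanding G S cr).
- exact: motion_continuous.
- move=> c /cle cr _ [_ /baseP[u uo ->] <-]; rewrite motion_setE // motionE //.
  by apply/bundle_ann; exists (deform c u) => //; exact: (deform_ann G cr uo).
- exists (bundle_nbhd p q e r d b), (fmap p q e r d b) => c /cle cr; rewrite motion_setE //; split.
  + by apply: (bundle_map_fmap G S cr); [exact: ann_inv_class | exact: (ann_expanding G S cr)].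
  + move=> _ [_ [_ /baseP[u uo ->] <-] <-]; rewrite motionE //.
    rewrite (fmap_bundle G S cr (deform_ann G cr uo)) -(deform_tail G cr 1 uo).
    have uo1 := ann_orbit_tail 1 uo.
    by exists (bundle_pt (tail 1 u)); [exact: base_pt | exact: motionE].
  + move=> _ /baseP[u uo ->]; rewrite (fmap_bundle G S c0r uo) !motionE //; last exact: ann_orbit_tail.
    by rewrite (fmap_bundle G S cr (deform_ann G cr uo)) (deform_tail G cr 1 uo).
- exists kap => u v x /cle ur /cle vr xb; have [h1 h2] := motion_dist ur vr xb.
  by rewrite normE -ofRM; apply/norm2_le.
Qed.

(** This needs no more than the definition of a bundle map, so it also applies to
    those that come with an arbitrary motion in the proof of uniqueness. *)
Lemma bundle_map_shift c L W F u : bundle_map p q r d c L W F -> orbit_in p q c L u ->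
  F (u 0%N, code u) = (u 1%N, code (tail 1 u)).
Proof.
move=> [[[_ Lann] _] _ BW _ [s s0 H]] uL.
have Bu : cantor_bundle p q r d c L (u 0%N, code u) by exists u.
have [_ [phi [_ -> E]]] := H _ (BW _ Bu).
have E' : phi (u 0%N) = u 1%N by apply: E => //; apply: ballxx; rewrite -ofR0 lt_ofR.
have bu : bounded_by (2 * r)^-1 u.
  by move=> n; have [/Lann[/andP[_ /ltW]]] := uL n.
by rewrite /= E' (code_recB r d0 d1 bu).
Qed.

Section Uniqueness.
Variable h : C -> C * C -> C * C.
Hypothesis H : bundle_motion p q r d disk h.

Let disk0 : disk 0. Proof. by rewrite /disk /mkset cabs0. Qed.

Lemma other_set0 : motion_set p q r d h 0 = ann_set 0.
Proof.
rewrite -(motion_setE c0r) /motion_set; congr (_ @` _).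
apply/seteqP; split=> _ [x xb <-]; exists x => //.
  by rewrite motion0 // (motion_id H xb).
by rewrite motion0 // (motion_id H xb).
Qed.

(** Conjugacy to the shift makes the images of the successive tails of [u] the
    successive points of one orbit of f_c. *)
Lemma other_orbit c u : disk c -> ann_orbit 0 u -> exists v, [/\ orbit c v,
  h c (bundle_pt u) = bundle_pt v & forall n, v n = (h c (bundle_pt (tail n u))).1].
Proof.
move=> cd uo; have [v vL vE] := motion_sub H cd (ex_intro2 _ _ _ (base_pt uo) (erefl _)).
have [W [F WF]] := motion_conj H.
have [B0 _ _] := WF 0 disk0; have [Bc _ conj] := WF c cd.
rewrite other_set0 in B0.
have T n : h c (bundle_pt (tail n u)) = bundle_pt (tail n v).
  elim: n => [|n IH]; first by rewrite !tail0.
  have uon := ann_orbit_tail n uo.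
  have -> : bundle_pt (tail n.+1 u) = F 0 (bundle_pt (tail n u)).
    have /ann_set_orbit uin := uon.
    by rewrite (bundle_map_shift B0 uin) -(tailS n u).
  rewrite (conj _ (base_pt uon)) IH.
  have vin : orbit_in p q c (motion_set p q r d h c) (tail n v).
    by move=> k; rewrite /tail addnS; exact: vL.
  by rewrite (bundle_map_shift Bc vin) -(tailS n v).
exists v; split.
- by move=> n; case: (vL n).
- by rewrite -[u in LHS]tail0 T tail0.
- by move=> n; rewrite T /= /tail addn0.
Qed.

(** Two motions agree where they agree up to 2 e, by expansivity, and both are
    Lipschitz in c. So agreement at c1 implies agreement at c2 whenever
    |c1 - c2| is small, by an amount that does not depend on c1; from 0, every
    c is reached in finitely many steps. *)
Lemma motion_unique c x : disk c -> base x -> h c x = motion c x.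
Proof.
have [C0 C0P] := motion_lipschitz H.
pose K := `|C0| + kap + 1.
have K0 : 0 < K by rewrite /K; have := kap0; have := normr_ge0 C0; lra.
have lip c1 c2 y : disk c1 -> disk c2 -> base y -> cabs ((h c1 y).1 - (h c2 y).1) <= `|C0| * cabs (c1 - c2).
  move=> h1 h2 yb; have := C0P _ _ _ h1 h2 yb; rewrite normE -ofRM => /norm2_le[+ _] => hh.
  apply: le_trans hh _; apply: ler_wpM2r; [exact: cabs_ge0 | exact: ler_norm].
have step c1 c2 : disk c1 -> disk c2 -> K * cabs (c1 - c2) <= 2 * e ->
    (forall y, base y -> h c1 y = motion c1 y) -> forall y, base y -> h c2 y = motion c2 y.
  move=> d1' d2 small agree _ /baseP[u uo ->].
  have [v [vo -> vE]] := other_orbit d2 uo; rewrite motionE //; congr bundle_pt.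
  apply/esym; apply: (ann_orbit_unique G (ltW d2) (deform_ann G (ltW d2) uo) vo) => n.
  have bn := base_pt (ann_orbit_tail n uo).
  have -> : deform c2 u n = (motion c2 (bundle_pt (tail n u))).1.
    by rewrite motionE ?(deform_tail G (ltW d2) n uo) /= /tail ?addn0 //; exact: ann_orbit_tail.
  rewrite vE; apply: le_trans (cabs_tri (motion c1 (bundle_pt (tail n u))).1 _ _) _.
  have [m1 _] := motion_dist (ltW d2) (ltW d1') bn.
  have m2 := lip _ _ _ d1' d2 bn; rewrite (agree _ bn) in m2.
  rewrite (cabsC c2) in m1; apply: le_trans (lerD m1 m2) _; apply: le_trans small.
  by rewrite /K !mulrDl mul1r; have := cabs_ge0 (c1 - c2); lra.
move=> cd; pose N := (Num.truncn (K * rho / (2 * e))).+1.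
have NP : K * rho / (2 * e) < N%:R by apply: truncnS_gt.
have N0 : (0 : R) < N%:R by rewrite ltr0n.
pose cj (j : nat) : C := ofR (j%:R / N%:R) * c.
have cjd j : (j <= N)%N -> disk (cj j).
  move=> jN; rewrite /disk /cj /mkset cabsM cabs_ofR ger0_norm ?divr_ge0 //.
  apply: le_lt_trans cd; apply: ler_piMl; first exact: cabs_ge0.
  by rewrite ler_pdivrMr // mul1r ler_nat.
have all j : (j <= N)%N -> forall y, base y -> h (cj j) y = motion (cj j) y.
  elim: j => [_|j IH jN] y yb.
    by rewrite /cj mul0r ofR0 mul0r motion0 // (motion_id H yb).
  apply: (step (cj j) (cj j.+1) (cjd _ (ltnW jN)) (cjd _ jN) _ (IH (ltnW jN)) y yb).
  rewrite /cj -mulrBl -ofRB cabsM cabs_ofR -mulrBl -natr1 opprD addNKr mulN1r normrN.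
  have NV : (0 : R) <= N%:R^-1 by rewrite invr_ge0 ltW.
  rewrite (ger0_norm NV) mulrCA ler_pdivrMl //.
  rewrite ltr_pdivrMr in NP; last by have := e0; lra.
  apply: le_trans (ltW (_ : K * cabs c < K * rho)) _; first by rewrite ltr_pM2l.
  exact: ltW.
by move=> xb; have := all N (leqnn N) x xb; rewrite /cj divff ?gt_eqF // ofR1 mul1r.
Qed.

End Uniqueness.
End Motion.

(** * Distortion of the curves *)

Section Distortion.
Variable R : realType.
Local Notation C := (C R).

(** Each step changes the ratio a / b by a factor whose logarithm is at most a
    term of a geometric series, so in all it changes by a bounded factor. *)
Lemma ratio_telescope (a b : nat -> R) (N : nat) (l k : R) : 0 <= l -> l < 1 -> 0 <= k ->
  (forall n, 0 <= a n) -> (forall n, (n <= N)%N -> 0 < b n) ->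
  (forall n, (n < N)%N -> a n * b n.+1 <= b n * a n.+1 * expR (k * l ^+ (N - n.+1))) ->
  a 0%N * b N <= b 0%N * a N * expR (k / (1 - l)).
Proof.
move=> l0 l1 k0 a0 b0 H; have lB : 0 < 1 - l by rewrite subr_gt0.
have K j : (j <= N)%N ->
    a (N - j)%N * b N <= b (N - j)%N * a N * expR (k / (1 - l) * (1 - l ^+ j)).
  elim: j => [_|j IH jN].
    by rewrite subn0 expr0 subrr mulr0 expR0 mulr1 mulrC.
  have jN' := ltnW jN; have S : (N - j.+1).+1 = (N - j)%N by rewrite -subSn // subSS.
  have nN : (N - j.+1 < N)%N by rewrite ltn_subrL (leq_trans _ jN).
  have := H _ nN; rewrite S subKn // => Hn; have {}IH := IH jN'.
  have bj : 0 < b (N - j)%N by apply: b0; exact: leq_subr.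
  have bj1 : 0 < b (N - j.+1)%N by apply: b0; exact: leq_subr.
  have bN : 0 < b N by exact: b0.
  have -> : k / (1 - l) * (1 - l ^+ j.+1) = k * l ^+ j + k / (1 - l) * (1 - l ^+ j).
    by rewrite exprS; field; rewrite gt_eqF.
  rewrite expRD -(ler_pM2l bj).
  have h1 := ler_wpM2r (ltW bN) Hn.
  have h2 := ler_wpM2l (mulr_ge0 (ltW bj1) (expR_ge0 (k * l ^+ j))) IH.
  have e1 : b (N - j)%N * (a (N - j.+1)%N * b N) = a (N - j.+1)%N * b (N - j)%N * b N by ring.
  rewrite e1; apply: le_trans h1 _; rewrite mulrACA mulrC in h2.
  move: h2; rewrite [leLHS](_ : _ = b (N - j.+1)%N * a (N - j)%N * expR (k * l ^+ j) * b N); last by ring.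
  move=> h2; apply: le_trans h2 _.
  by rewrite le_eqVlt; apply/orP; left; apply/eqP; ring.
have := K N (leqnn N); rewrite subnn => H0; apply: le_trans H0 _.
apply: ler_wpM2l.
  by apply: mulr_ge0; [exact: ltW (b0 0%N (leq0n _)) | exact: a0].
rewrite ler_expR; apply: ler_piMr; first by rewrite divr_ge0 // ltW.
by have := exprn_ge0 N l0; lra.
Qed.

Lemma exp_ratio (y : R) : 0 <= y -> y <= 2^-1 -> (1 + y) <= expR (4 * y) * (1 - y).
Proof.
move=> y0 y1; have h1 := expR_ge1Dx (4 * y).
have : (1 + 4 * y) * (1 - y) <= expR (4 * y) * (1 - y) by apply: ler_wpM2r; lra.
apply: le_trans; have : y * y <= y * 2^-1 by apply: ler_wpM2l.
by lra.
Qed.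

Lemma eit_dist_inj (s s' t : R) : `|s - t| <= 1 -> `|s' - t| <= 1 ->
  cabs (eit t - eit s) = cabs (eit t - eit s') -> `|s - t| = `|s' - t|.
Proof.
rewrite !(cabsC (eit t)) !eit_sub; move: (s - t) (s' - t) => x y x1 y1 E.
have sq z : cabs (eit z - 1) ^+ 2 = 2 - 2 * cos z.
  rewrite /cabs /= subr0 sqr_sqrtr ?addr_ge0 ?sqr_ge0 //.
  by have := cos2Dsin2 z; rewrite sqrrB; lra.
have : cabs (eit x - 1) ^+ 2 = cabs (eit y - 1) ^+ 2 by rewrite E.
rewrite !sq => {}E.
have pi2 := @pi_ge2 R.
have inj := @cos_inj R `|x| `|y|.
apply: inj; rewrite ?in_itv /= ?normr_ge0 /=; [lra | lra |].
by rewrite !cos_norm; lra.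
Qed.

Lemma distortion_le (K : R) (L : set C) (phi : C -> C) z x : 0 < K ->
  (forall w, L w -> cabs (z - w) = x -> 0 < cabs (phi z - phi w)) ->
  (forall w w', L w -> L w' -> cabs (z - w) = x -> cabs (z - w') = x ->
     cabs (phi z - phi w) <= K * cabs (phi z - phi w')) ->
  (distortion L phi z x <= K%:E)%E.
Proof.
move=> K0 pos cmp; rewrite /distortion.
set A := [set (cabs (phi z - phi w))%:E | w in _].
have [[w0 [Lw0 w0x]]|none] := pselect (exists w, L w /\ cabs (z - w) = x); last first.
  have -> : A = set0.
    by apply/seteqP; split=> // t [w [Lw wx] _]; case: none; exists w.
  (* without chords of length x the quotient is -oo / +oo, which is 0 *)
  by rewrite ereal_sup0 ereal_inf0 invey mule0 lee_fin ltW.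
set D0 := cabs (phi z - phi w0).
have D00 : 0 < D0 by exact: pos.
have AD0 : A D0%:E by exists w0.
have i1 : ((D0 / K)%:E <= ereal_inf A)%E.
  apply: le_ereal_inf_tmp => _ [w [Lw wx] <-]; rewrite lee_fin ler_pdivrMr // mulrC.
  exact: cmp.
have i2 : (ereal_inf A <= D0%:E)%E by exact: ereal_inf_lbound.
have ifin : ereal_inf A \is a fin_num.
  rewrite fin_numE; apply/andP; split.
    by apply/eqP => E; move: i1; rewrite E.
  by apply/eqP => E; move: i2; rewrite E.
rewrite -(fineK ifin) in i1 i2 *; set M := fine (ereal_inf A) in i1 i2 *.
rewrite lee_fin in i1; have M0 : 0 < M by apply: lt_le_trans i1; rewrite divr_gt0.
have s1 : (ereal_sup A <= (K * M)%:E)%E.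
  apply: ge_ereal_sup => _ [w [Lw wx] <-]; rewrite lee_fin -ler_pdivrMl //.
  rewrite -lee_fin /M fineK //; apply: le_ereal_inf_tmp => _ [w' [Lw' w'x] <-].
  by rewrite lee_fin ler_pdivrMl //; exact: cmp.
rewrite inver gt_eqF //.
apply: (@le_trans _ _ ((K * M)%:E * (M^-1)%:E)%E).
  by apply: lee_wpmul2r => //; rewrite lee_fin invr_ge0 ltW.
by rewrite -EFinM mulfK ?gt_eqF.
Qed.

(** The uniform separation in the second hypothesis yields both injectivity and
    the continuity of the inverse. *)
Lemma cembedding (L : set C) (phi : C -> C) :
  (forall z, L z -> forall x : R, 0 < x -> exists2 y : R, 0 < y & forall w, L w -> cabs (z - w) < y -> cabs (phi z - phi w) < x) ->
  (forall x : R, 0 < x -> exists2 y : R, 0 < y & forall z w, L z -> L w -> cabs (phi z - phi w) < y -> cabs (z - w) < x) ->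
  embedding_on L phi.
Proof.
move=> cont inv; split.
  apply/subspace_continuousP => z Lz; apply/ccvgP => x x0.
  have [y y0 H] := cont z Lz x x0; rewrite near_withinE; apply/cnbhsP; exists y => // w zw Lw.
  exact: H.
pose psi v := xget 0 [set z | L z /\ phi z = v].
have psiK z : L z -> psi (phi z) = z.
  move=> Lz; rewrite /psi; case: xgetP => [w _ [Lw E]|/(_ z)[]//].
  apply/eqP; rewrite -cabs_sub0 eq_le cabs_ge0 andbT leNgt; apply/negP => h.
  have [y y0 H] := inv _ h; have := H w z Lw Lz; rewrite E subrr cabs0 => /(_ y0).
  by rewrite ltxx.
exists psi; split=> //.
apply/subspace_continuousP => _ [z Lz <-]; apply/ccvgP => x x0.
have [y y0 H] := inv x x0; rewrite near_withinE; apply/cnbhsP; exists y => // v zw [w Lw E].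
rewrite -E in zw *; change (cabs (psi (phi z) - psi (phi w)) < x).
by rewrite (psiK z) // (psiK w) //; exact: H.
Qed.

End Distortion.

Lemma right_unit_nbhs (R : realType) : nbhs (0 : R)^'+ `]0, 1[%classic.
Proof.
have : \forall x \near (0 : R)^'+, x \in `]0, 1[.
  near=> x; rewrite in_itv /=; apply/andP; split; near: x; first exact: nbhs_right_gt.
  exact: nbhs_right_lt.
by apply: filterS.
Unshelve. all: by end_near. Qed.

Section Curves.
Variables (R : realType) (p q : nat) (lam e rho r d m b s1 : R).
Local Notation C := (C R).
Hypothesis G : shadow_params p q lam e rho.
Hypothesis S : separation p q e rho r d m b.
Local Notation ann_orbit := (ann_orbit p q e).
Local Notation ann_set := (ann_set p q e).
Local Notation deform := (deform p q).
Local Notation kap := (kap lam).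
Local Notation dil := (dil R p q).
Local Notation circle_pt := (@circle_pt R p q).

(** A lower bound for the modulus of the derivative of the q-th power along the
    curves. *)
Definition coef_min : R := q%:R * 2^-1 ^+ q.-1.
(** The coefficient of the quadratic error in one step. *)
Definition bend : R := taylor_bound R p + taylor_bound R q.

(** [s1] is a length at which the curves still resemble the circle: by [cur_rho]
    they are displaced from it by a small fraction of [s1]. *)
Record curve_params : Prop := CurveParams {
  cur_s0 : 0 < s1;
  cur_s1 : s1 <= 1;
  cur_e : 2 * s1 <= e;
  cur_rho : 8 * dil * (kap * rho) <= s1;
  cur_bend : bend * (2 * e) <= coef_min / 2 }.
Hypothesis V : curve_params.

Let e0 := par_e0 G.
Let e1 := par_e1 G.
Let rhoe := par_rhoe G.
Let rho0 := par_rho0 G.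
Let p0 := par_p0 G.
Let q0 := par_q0 G.
Let lam0 := par_lam0 G.
Let lam1 := par_lam1 G.
Let kap0 := kap_ge0 G.
Let s10 := cur_s0 V.
Let D1 : 1 < dil. Proof. exact: dil_gt1 q0 (par_pq G). Qed.
Let D0 : 0 < dil. Proof. exact: lt_trans D1. Qed.
Let D4 : 0 < 4 * dil. Proof. by apply: mulr_gt0 => //; exact: D0. Qed.

Lemma coef_min_gt0 : 0 < coef_min.
Proof. by rewrite /coef_min mulr_gt0 ?ltr0n ?q0 // exprn_gt0 // invr_gt0. Qed.

Lemma bend_ge0 : 0 <= bend.
Proof. by rewrite addr_ge0 ?taylor_bound_ge0. Qed.

Lemma circle_pt_ann tau t : ann_orbit 0 (circle_pt tau t).
Proof.
split; first exact: circle_pt_orbit q0 _ _.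
by move=> n; rewrite /ann cabs_eit; have e0' := e0; apply/andP; split; lra.
Qed.

Lemma ell_pt tau t : ell p r d tau t = bundle_pt r d (circle_pt tau t).
Proof. by []. Qed.

Definition curve c tau t n := deform c (circle_pt tau t) n.

Lemma gammaE c tau t : gamma p r d (motion p q e r d) tau c t = curve c tau t 0.
Proof. by rewrite /gamma ell_pt (motionE G S c (circle_pt_ann tau t)). Qed.

Lemma ann_curves c : cabs c <= rho ->
  ann_set c = \bigcup_(tau in [set: nat -> 'I_q]) range (gamma p r d (motion p q e r d) tau c).
Proof.
move=> cr; apply/seteqP; split=> [z [w wo ->]|z [tau _ [t _ <-]]].
  have [u uo ->] := deform_onto G cr wo.
  have [t ut] := eit_surj (ann_unit G uo 0%N).
  have [tau uE] := circle_ptP q0 (proj1 uo) (ann_unit G uo) ut.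
  by exists tau => //; exists t => //; rewrite gammaE /curve uE.
rewrite gammaE; exists (curve c tau t) => //.
exact: (deform_ann G cr (circle_pt_ann tau t)).
Qed.

Section FixedCurve.
Variables (c : C) (tau : nat -> 'I_q).
Hypothesis cr : cabs c <= rho.
Local Notation g := (curve c tau).

Let gap s t n := cabs (g s n - g t n).

(* moduli of the derivatives of z ^+ p and of (w - c) ^+ q along the curve *)
Let coefP t n : R := p%:R * cabs (g t n) ^+ p.-1.
Let coefQ t n : R := q%:R * cabs (g t n.+1 - c) ^+ q.-1.

Lemma curve_circle s t n :
  `|gap s t n - cabs (circle_pt tau s n - circle_pt tau t n)| <= 2 * (kap * rho).
Proof.
have cl s' := le_trans (deform_close G cr (circle_pt_ann tau s') n) (ler_wpM2l kap0 cr).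
have := cl s; have := cl t; rewrite /gap /curve.
set a := circle_pt _ _ _; set a' := circle_pt _ _ _; set v := deform _ _ _; set v' := deform _ _ _ => h1 h2.
have := cabs_dist (v' - v) (a' - a); have := cabs_dist (a' - a) (v' - v).
have -> : a' - a - (v' - v) = (a' - v') - (a - v) by ring.
rewrite (cabsC (v' - v)) (_ : a' - a - (v' - v) = (a' - v') - (a - v)); last by ring.
have := cabsB (a' - v') (a - v).
by rewrite ler_norml => *; apply/andP; split; lra.
Qed.

Lemma circle_gap s t n : dil ^+ n * `|s - t| <= 1 ->
  dil ^+ n * `|s - t| / 2 <= cabs (circle_pt tau s n - circle_pt tau t n) /\
  cabs (circle_pt tau s n - circle_pt tau t n) <= 2 * (dil ^+ n * `|s - t|).
Proof.
move=> h; have E : `|angle p tau s n - angle p tau t n| = dil ^+ n * `|s - t|.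
  by rewrite (angle_sub p q0) normrM ger0_norm // exprn_ge0 // ltW.
by split; [rewrite -E; apply: eit_colip; rewrite E | rewrite -E; exact: eit_lip].
Qed.

Section Scale.
Variables (s t : R) (N : nat).
Hypothesis stN : dil ^+ N * `|s - t| <= s1.

Lemma gap_circle n : (n <= N)%N -> cabs (circle_pt tau s n - circle_pt tau t n) <= e.
Proof.
move=> nN; have h : dil ^+ n * `|s - t| <= s1.
  by apply: le_trans stN; apply: ler_wpM2r => //; apply: ler_weXn2l => //; exact: ltW.
have [_ h2] := circle_gap (le_trans h (cur_s1 V)).
by apply: le_trans h2 _; have := cur_e V; lra.
Qed.

Lemma gap_small n : (n <= N)%N -> gap s t n <= 2 * e * lam ^+ (N - n).
Proof.
exact: (deform_finite G cr (circle_pt_ann tau s) (circle_pt_ann tau t) gap_circle).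
Qed.

Lemma gap_2e n : (n <= N)%N -> gap s t n <= 2 * e.
Proof.
move=> nN; apply: le_trans (gap_small nN) _; apply: ler_piMr; first by have := e0; lra.
by apply: exprn_ile1; exact: ltW.
Qed.

(** Chords from [t] are multiplied by [P / Q] at this step, up to the quadratic
    term. Since [P] and [Q] do not depend on [s], they cancel in the ratio of two
    chords from [t]. *)
Lemma gap_step n (P := coefP t n) (Q := coefQ t n) : (n < N)%N ->
  [/\ 0 < P, coef_min <= Q, P <= p%:R * 2 ^+ p.-1,
  P * gap s t n <= gap s t n.+1 * (Q + bend * gap s t n.+1) &
  gap s t n.+1 * (Q - bend * gap s t n.+1) <= P * gap s t n].
Proof.
move=> nN; have e0' := e0; have e1' := e1; have rhoe' := rhoe; have cr' := cr.
have ce : cabs c <= e by lra.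
have [to ta] := deform_ann G cr (circle_pt_ann tau t).
have [so sa] := deform_ann G cr (circle_pt_ann tau s).
have a4 i : ann (4 * e) (deform c (circle_pt tau t) i) by apply: ann_le (ta i); lra.
have [c1 c2] := step_coefs G (a4 n) (a4 n.+1) ce.
have /andP[l1 l1'] := ta n; have /andP[_ l2] := sa n; have /andP[l3' l3] := ta n.+1; have /andP[_ l4] := sa n.+1.
have L := step_linear (to n) (so n) _ _ _ _.
have W : cabs (g t n.+1 - c) <= 2 by apply: le_trans (cabsB _ _) _; rewrite /curve; lra.
have W' : cabs (g s n.+1 - c) <= 2 by apply: le_trans (cabsB _ _) _; rewrite /curve; lra.
have {}L := L (_ : cabs (g t n) <= 2) (_ : cabs (g s n) <= 2) W W'.
have {}L := L ltac:(rewrite /curve; lra) ltac:(rewrite /curve; lra).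
have E : g s n.+1 - c - (g t n.+1 - c) = g s n.+1 - g t n.+1 by ring.
rewrite -/(g t n) -/(g s n) -/(g t n.+1) -/(g s n.+1) E in L.
rewrite /P /Q /coefP /coefQ.
have gn : gap s t n <= gap s t n.+1.
  have := step_contr G (so n) (to n).
  rewrite (_ : _ - c - _ = g s n.+1 - g t n.+1); last by rewrite /curve; ring.
  move=> H; have := H _ _ (gap_2e (ltnW nN)) (gap_2e nN) ce ce.
  move=> {}H; apply: le_trans (H _ _) _.
  - by apply: ann_le (sa n); lra.
  - by apply: ann_le (sa n.+1); lra.
  - by apply: ler_piMl; [exact: cabs_ge0 | exact: ltW].
have g0 : 0 <= gap s t n by exact: cabs_ge0.
have g0' : 0 <= gap s t n.+1 by exact: cabs_ge0.
have sq : gap s t n ^+ 2 <= gap s t n.+1 ^+ 2 by apply: lerXn2r.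
have Tp := taylor_bound_ge0 R p.
have B : taylor_bound R p * gap s t n ^+ 2 + taylor_bound R q * gap s t n.+1 ^+ 2 <=
    gap s t n.+1 * (bend * gap s t n.+1).
  have := ler_wpM2l Tp sq => h; apply: le_trans (lerD h (lexx _)) _.
  by rewrite le_eqVlt; apply/orP; left; apply/eqP; rewrite /bend; ring.
have {}L := le_trans L B.
have d1 := cabs_dist (p%:R * g t n ^+ p.-1 * (g s n - g t n)) (q%:R * (g t n.+1 - c) ^+ q.-1 * (g s n.+1 - g t n.+1)).
have d2 := cabs_dist (q%:R * (g t n.+1 - c) ^+ q.-1 * (g s n.+1 - g t n.+1)) (p%:R * g t n ^+ p.-1 * (g s n - g t n)).
rewrite (cabsC (q%:R * _ * _)) in d2.
rewrite !cabsM !cabs_nat !cabsX -/(gap s t n) -/(gap s t n.+1) in d1 d2.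
split.
- exact: lt_le_trans c2.
- rewrite /coef_min; apply: ler_wpM2l => //; apply: lerXn2r; rewrite ?nnegrE ?invr_ge0 ?cabs_ge0 //.
  by have := cabs_dist (g t n.+1) c; rewrite /curve; lra.
- by apply: ler_wpM2l => //; apply: lerXn2r; rewrite ?nnegrE ?cabs_ge0 // /curve; lra.
- by rewrite mulrDr (mulrC (gap s t n.+1) (q%:R * _)); lra.
- by rewrite mulrBr (mulrC (gap s t n.+1) (q%:R * _)); lra.
Qed.

Definition growth : R := 2 * (p%:R * 2 ^+ p.-1) / coef_min + 1.

Lemma growth_ge1 : 1 <= growth.
Proof.
rewrite /growth lerDr; apply: divr_ge0; last exact: ltW coef_min_gt0.
by rewrite mulr_ge0 // mulr_ge0 // exprn_ge0.
Qed.

Lemma gap_growth n : (n < N)%N -> gap s t n.+1 <= growth * gap s t n.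
Proof.
move=> nN; have [P0 Qm Pm _ H] := gap_step nN.
set P := coefP t n in P0 Pm H; set Q := coefQ t n in Qm H.
have M0 := coef_min_gt0; have g0 : 0 <= gap s t n by exact: cabs_ge0.
have g0' : 0 <= gap s t n.+1 by exact: cabs_ge0.
have h1 : coef_min / 2 <= Q - bend * gap s t n.+1.
  have := ler_wpM2l bend_ge0 (gap_2e nN); have := cur_bend V; lra.
have h2 := le_trans (ler_wpM2l g0' h1) H.
have h3 := le_trans h2 (ler_wpM2r g0 Pm).
have -> : growth * gap s t n = 2 * (p%:R * 2 ^+ p.-1 * gap s t n) / coef_min + gap s t n.
  by rewrite /growth; field; rewrite gt_eqF.
apply: (@le_trans _ _ (2 * (p%:R * 2 ^+ p.-1 * gap s t n) / coef_min)); last by rewrite lerDl.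
by rewrite ler_pdivlMr //; lra.
Qed.

Lemma gap_lower n : (n <= N)%N -> gap s t n <= growth ^+ n * gap s t 0.
Proof.
elim: n => [|n IH] nN; first by rewrite expr0 mul1r.
apply: le_trans (gap_growth nN) _; rewrite exprS -mulrA.
by apply: ler_wpM2l; [apply: le_trans growth_ge1 | exact/IH/ltnW].
Qed.

End Scale.

(** At the last time when the angles are within [s1], the chord of the circle is
    comparable to [s1], and the displacement of the curve from the circle is too
    small to spoil this. *)
Lemma big_scale s t N : dil ^+ N * `|s - t| <= s1 -> s1 < dil ^+ N.+1 * `|s - t| ->
  s1 / (4 * dil) <= gap s t N /\ gap s t N <= 3 * s1.
Proof.
move=> h1 h2; have [b1 b2] := circle_gap (le_trans h1 (cur_s1 V)).
have := curve_circle s t N; rewrite ler_norml => /andP[a1 a2].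
have kr : 2 * (kap * rho) <= s1 / (4 * dil).
  rewrite (ler_pdivlMr _ _ D4); apply: le_trans (cur_rho V).
  by rewrite le_eqVlt; apply/orP; left; apply/eqP; ring.
have lo : s1 / (4 * dil) + s1 / (4 * dil) <= dil ^+ N * `|s - t| / 2.
  have -> : s1 / (4 * dil) + s1 / (4 * dil) = s1 / dil / 2 by field; rewrite gt_eqF.
  by rewrite ler_pM2r ?invr_gt0 // ler_pdivrMr // mulrAC -exprSr ltW.
have s4 : s1 / (4 * dil) <= s1.
  rewrite (ler_pdivrMr _ _ D4); apply: ler_peMr; first exact: ltW.
  by have := D1; lra.
by split; lra.
Qed.

Lemma scale_exists x : 0 < x -> x <= s1 -> exists N, dil ^+ N * x <= s1 /\ s1 < dil ^+ N.+1 * x.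
Proof.
move=> x0 xs; have ex : exists n, s1 < dil ^+ n * x.
  have Di1 : dil^-1 < 1 by rewrite invf_lt1.
  have Di0 : 0 <= dil^-1 by rewrite invr_ge0 ltW.
  have [n nP] := geometric_lt s1 Di0 Di1 x0; exists n.
  have := nP n (leqnn n); rewrite exprVn ltr_pdivrMr ?exprn_gt0 // mulrC.
  by rewrite mulrC.
case: (ex_minnP ex) => -[|N] NP Nmin.
  by rewrite mul1r ltNge xs in NP.
exists N; split=> //; rewrite leNgt; apply/negP => /Nmin; by rewrite ltnn.
Qed.

(** The first factor bounds the ratio of two chords at scale [s1], see
    [big_scale]; the exponential is the distortion of [ratio_telescope]. *)
Definition qc_const : R := 12 * dil * expR (8 * bend * e / coef_min / (1 - lam)).

Lemma qc_const_ge1 : 1 <= qc_const.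
Proof.
apply: mulr_ege1; first by have := D1; lra.
apply: le_trans (expR_ge1Dx _); rewrite lerDl; apply: divr_ge0; last exact: ltW (par_lamB G).
by apply: divr_ge0; [rewrite !mulr_ge0 ?bend_ge0 // ltW | exact: ltW coef_min_gt0].
Qed.

Lemma gap_pos s t : 0 < `|s - t| -> `|s - t| <= s1 -> 0 < gap s t 0.
Proof.
move=> st0 sts; have [N [h1 h2]] := scale_exists st0 sts.
have [b1 _] := big_scale h1 h2.
have := gap_lower h1 (leqnn N) => H.
have : 0 < growth ^+ N * gap s t 0.
  by apply: lt_le_trans (le_trans b1 H); exact: divr_gt0 s10 D4.
by rewrite pmulr_rgt0 // exprn_gt0 // (lt_le_trans ltr01 growth_ge1).
Qed.

(** Iterating forward blows both chords up to scale [s1] at the same time, since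
    the angles are equal; pulling back has bounded distortion because chords
    shrink geometrically backwards, so that the quadratic errors are summable. *)
Lemma gap_compare s s' t : `|s - t| = `|s' - t| -> 0 < `|s - t| -> `|s - t| <= s1 ->
  gap s t 0 <= qc_const * gap s' t 0.
Proof.
move=> E st0 sts; have [N [h1 h2]] := scale_exists st0 sts.
have h1' := h1; have h2' := h2; rewrite E in h1' h2'.
have [_ a1] := big_scale h1 h2; have [b1 _] := big_scale h1' h2'.
have M0 := coef_min_gt0; have e0' := e0.
have posN : 0 < gap s' t N by apply: lt_le_trans b1; exact: divr_gt0 s10 D4.
have pos n : (n <= N)%N -> 0 < gap s' t n.
  move=> nN; rewrite lt0r cabs_ge0 andbT; apply/negP => /eqP z.
  suff Z k : (n + k <= N)%N -> gap s' t (n + k) = 0.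
    by move: posN; rewrite -(subnKC nN) Z ?subnKC // ltxx.
  elim: k => [|k IH]; first by rewrite addn0.
  rewrite addnS => nk; apply/eqP; rewrite eq_le cabs_ge0 andbT.
  by apply: le_trans (gap_growth h1' nk) _; rewrite IH ?mulr0 // ltnW.
pose k := 8 * bend * e / coef_min.
have k0 : 0 <= k by rewrite /k; apply: divr_ge0; [rewrite !mulr_ge0 ?bend_ge0 // ltW | exact: ltW].
have T := @ratio_telescope R (gap s t) (gap s' t) N lam k (ltW lam0) lam1 k0 (fun n => cabs_ge0 _) pos.
have {}T : gap s t 0 * gap s' t N <= gap s' t 0 * gap s t N * expR (k / (1 - lam)).
  apply: T => n nN.
  have [P0 Qm _ H1 _] := gap_step h1 nN; have [_ _ _ _ H2] := gap_step h1' nN.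
  set P := coefP t n in P0 H1 H2; set Q := coefQ t n in Qm H1 H2.
(* the quadratic errors relative to Q, by [gap_small] *)
  pose y := bend * (2 * e * lam ^+ (N - n.+1)) / coef_min.
  have l0 : 0 <= lam ^+ (N - n.+1) by rewrite exprn_ge0 // ltW.
  have l1 : lam ^+ (N - n.+1) <= 1 by rewrite exprn_ile1 // ltW.
  have y0 : 0 <= y.
    by apply: divr_ge0; [rewrite mulr_ge0 ?bend_ge0 // !mulr_ge0 // ltW | exact: ltW].
  have y1 : y <= 2^-1.
    rewrite /y ler_pdivrMr //; apply: (@le_trans _ _ (bend * (2 * e))); last first.
      by rewrite [leRHS]mulrC; exact: cur_bend V.
    by apply: ler_wpM2l; [exact: bend_ge0 | apply: ler_piMr => //; lra].
  have Q0 : 0 < Q by exact: lt_le_trans Qm.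
  have yQ x : x <= 2 * e * lam ^+ (N - n.+1) -> bend * x <= y * Q.
    move=> hx; apply: le_trans (ler_wpM2l bend_ge0 hx) _.
    rewrite (_ : bend * _ = y * coef_min); last by rewrite /y divfK ?gt_eqF.
    exact: ler_wpM2l.
  have {}H1 : P * gap s t n <= gap s t n.+1 * (Q * (1 + y)).
    apply: le_trans H1 _; apply: ler_wpM2l; first exact: cabs_ge0.
    by have := yQ _ (gap_small h1 nN); lra.
  have {}H2 : gap s' t n.+1 * (Q * (1 - y)) <= P * gap s' t n.
    apply: le_trans H2; apply: ler_wpM2l; first exact: cabs_ge0.
    by have := yQ _ (gap_small h1' nN); lra.
  have -> : k * lam ^+ (N - n.+1) = 4 * y by rewrite /k /y; ring.
  have E3 := exp_ratio y0 y1.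
  have yB : 0 < 1 - y by lra.
  have PQ : 0 < P * Q * (1 - y) by exact: mulr_gt0 (mulr_gt0 P0 Q0) yB.
  rewrite -(ler_pM2l PQ).
  have A0 : 0 <= gap s t n.+1 by exact: cabs_ge0.
  have B0 : 0 <= gap s' t n.+1 by exact: cabs_ge0.
  have b0 : 0 <= gap s' t n by exact: cabs_ge0.
  have U1 := ler_wpM2r (mulr_ge0 B0 (ltW (mulr_gt0 Q0 yB))) H1.
  have U2 := ler_wpM2l (mulr_ge0 A0 (mulr_ge0 (ltW Q0) (addr_ge0 ler01 y0))) H2.
  have U3 := ler_wpM2l (mulr_ge0 (mulr_ge0 A0 b0) (ltW (mulr_gt0 P0 Q0))) E3.
  apply: le_trans (le_trans _ U1) (le_trans (le_trans _ U2) (le_trans _ (le_trans U3 _)));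
    by rewrite le_eqVlt; apply/orP; left; apply/eqP; ring.
have E0 := expR_ge0 (k / (1 - lam)).
have b0 : 0 <= gap s' t 0 by exact: cabs_ge0.
have a0 : 0 <= gap s t 0 by exact: cabs_ge0.
have F : 0 < s1 / (4 * dil) by exact: divr_gt0 s10 D4.
rewrite -(ler_pM2r F); apply: le_trans (ler_wpM2l a0 b1) _; apply: le_trans T _.
rewrite mulrAC; apply: le_trans (ler_wpM2l (mulr_ge0 b0 E0) a1) _.
by rewrite le_eqVlt; apply/orP; left; apply/eqP; rewrite /qc_const -/k; field; rewrite gt_eqF.
Qed.

Lemma curve_cont t : forall x : R, 0 < x -> exists2 y : R, 0 < y & forall s, `|s - t| < y -> gap s t 0 < x.
Proof.
move=> x x0; have [N NP] := geometric_lt (2 * e) (ltW lam0) lam1 x0.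
have dN : 0 < dil ^+ N by rewrite exprn_gt0.
exists (s1 / dil ^+ N) => [|s]; first by rewrite divr_gt0.
rewrite ltr_pdivlMr // mulrC => st.
apply: le_lt_trans (gap_small (ltW st) (leq0n N)) _.
by apply: NP; rewrite subn0.
Qed.

Lemma curve_separates (x : R) : 0 < x -> exists2 y : R, 0 < y &
  forall s t, `|s - t| <= s1 -> gap s t 0 < y -> `|s - t| < x.
Proof.
move=> x0; have Di1 : dil^-1 < 1 by rewrite invf_lt1.
have Di0 : 0 <= dil^-1 by rewrite invr_ge0 ltW.
have [M MP] := geometric_lt s1 Di0 Di1 x0.
have gr0 : 0 < growth by exact: lt_le_trans growth_ge1.
have F : 0 < s1 / (4 * dil) by exact: divr_gt0 s10 D4.
exists (s1 / (4 * dil) / growth ^+ M) => [|s t sts].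
  by rewrite divr_gt0 // exprn_gt0.
rewrite ltr_pdivlMr ?exprn_gt0 // => small; rewrite ltNge; apply/negP => xst.
have st0 : 0 < `|s - t| by exact: lt_le_trans xst.
have [N [h1 h2]] := scale_exists st0 sts; have [b1 _] := big_scale h1 h2.
have NM : (N <= M)%N.
  rewrite leqNgt; apply/negP => /ltnW MN; have := MP N MN.
  rewrite exprVn ltr_pdivrMr ?exprn_gt0 // ltNge mulrC => /negP; apply.
  by apply: le_trans h1; apply: ler_wpM2l => //; rewrite exprn_ge0 // ltW.
have := le_trans b1 (gap_lower h1 (leqnn N)).
have := ler_wpM2r (cabs_ge0 (g s 0 - g t 0)) (ler_weXn2l growth_ge1 NM).
by rewrite -/(gap s t 0); lra.
Qed.

(** On an interval of length [s1] the chord eit s - eit t determines |s - t|, and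
    every chord can be blown up to scale [s1]. *)
Lemma curve_qc t0 : exists (I : set R) (phi : C -> C), [/\ open I, is_interval I, I t0,
  quasiconformal qc_const (@eit R @` I) phi & forall t, I t -> g t 0 = phi (eit t)].
Proof.
have s11 := cur_s1 V; have s10' := s10.
pose I : set R := [set` `]t0 - s1 / 2, t0 + s1 / 2[ ].
have IP t : I t <-> `|t - t0| < s1 / 2.
  by rewrite /I /= in_itv /= ltr_distl.
have II s t : I s -> I t -> `|s - t| < s1.
  by move=> /IP + /IP; rewrite !ltr_norml => /andP[? ?] /andP[? ?]; apply/andP; split; lra.
have eit_inj s t : I s -> I t -> eit s = eit t -> s = t.
  move=> Is It E; have st := II _ _ Is It; have := @eit_colip R s t.
  rewrite E subrr cabs0 => /(_ _)/wrap[]; first by lra.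
  move=> h; apply/eqP; rewrite -subr_eq0 -normr_le0; lra.
pose arg z := xget t0 [set t | I t /\ eit t = z].
have argK t : I t -> arg (eit t) = t.
  by move=> It; rewrite /arg; case: xgetP => [s _ [Is E]|/(_ t)[]//]; exact: eit_inj.
pose phi z := g (arg z) 0.
have phiE t : I t -> phi (eit t) = g t 0 by move=> It; rewrite /phi argK.
have chord s t : I s -> I t -> `|s - t| <= 2 * cabs (eit s - eit t).
  by move=> Is It; have st := II _ _ Is It; have := @eit_colip R s t (ltW (lt_le_trans st s11)); lra.
exists I, phi; split.
- exact: interval_open.
- exact: interval_is_interval.
- by apply/IP; rewrite subrr normr0 divr_gt0.
- split.
  + by exists (eit t0), t0 => //; apply/IP; rewrite subrr normr0 divr_gt0.
  + apply: cembedding.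
      move=> _ [t It <-] x x0; have [y y0 H] := curve_cont t x0.
      exists (y / 2); first by rewrite divr_gt0.
      move=> _ [s Is <-] h; rewrite !phiE // cabsC; apply: H.
      by have := chord _ _ Is It; rewrite (cabsC (eit s)); lra.
    move=> x x0; have x2 : 0 < x / 2 by rewrite divr_gt0.
    have [y y0 H] := curve_separates x2; exists y => //.
    move=> _ _ [s Is <-] [t It <-]; rewrite !phiE // => h.
    by apply: le_lt_trans (eit_lip _ _) _; have := H _ _ (ltW (II _ _ Is It)) h; lra.
  + apply: ge_ereal_sup => _ [_ [t It <-] <-].
    apply: ge_ereal_inf; exists (ereal_sup [set distortion (@eit R @` I) phi (eit t) x | x in `]0, 1[ ]).
      exists `]0, 1[%classic => //; exact: right_unit_nbhs.
    apply: ge_ereal_sup => _ [x /= + <-]; rewrite in_itv /= => /andP[x0 _].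
    have st0 s : cabs (eit t - eit s) = x -> 0 < `|s - t|.
      move=> E; rewrite normr_gt0 subr_eq0; apply/eqP => E'.
      by move: E x0; rewrite E' subrr cabs0 => <-; rewrite ltxx.
    apply: distortion_le; first exact: lt_le_trans qc_const_ge1.
      move=> _ [s Is <-] E; rewrite !phiE // cabsC; apply: gap_pos; first exact: st0.
      exact: ltW (II _ _ Is It).
    move=> _ _ [s Is <-] [s' Is' <-] E E'; rewrite !phiE // !(cabsC (g t 0)).
    have h1 := ltW (II _ _ Is It); have h2 := ltW (II _ _ Is' It).
    have hd : `|s - t| = `|s' - t|.
      by apply: eit_dist_inj; [exact: le_trans h1 s11 | exact: le_trans h2 s11 | rewrite E E'].
    exact: (gap_compare hd (st0 _ E) h1).
- by move=> t It; rewrite phiE.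
Qed.

End FixedCurve.
End Curves.

(** * The choice of constants *)

Section SmallNumbers.
Variable R : realType.
Local Notation C := (C R).

Lemma small_pos (s : seq R) : all (fun x => 0 < x) s ->
  exists2 e : R, 0 < e & all (fun x => e <= x) s.
Proof.
elim: s => [_|x s IH /= /andP[x0 /IH[e e0 es]]]; first by exists 1.
exists (Num.min x e); first by rewrite lt_min x0.
rewrite /= ge_min lexx /=; apply: sub_all es => y ey.
by rewrite ge_min ey orbT.
Qed.

Lemma expr1D_le (x : R) n : 0 <= x -> x <= 1 -> (1 + x) ^+ n <= 1 + 2 ^+ n * x.
Proof.
move=> x0 x1; suff : (1 + x) ^+ n <= 1 + (2 ^+ n - 1) * x by lra.
elim: n => [|n IH]; first by rewrite !expr0; lra.
rewrite !exprS; have y0 : 1 <= (2 : R) ^+ n by apply: exprn_ege1; lra.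
have h : (1 + x) * (1 + x) ^+ n <= (1 + x) * (1 + (2 ^+ n - 1) * x) by apply: ler_wpM2l => //; lra.
apply: le_trans h _; move: (2 ^+ n) y0 => y y0.
have : (y - 1) * (x * x) <= (y - 1) * x.
  by apply: ler_wpM2l; [lra | apply: ler_piMl].
by lra.
Qed.

(** There are finitely many roots of unity, so the strict inequalities hold with
    a common margin. *)
Lemma roots_of_unity_gap (q : nat) (r d : R) : (0 < q)%N ->
  (forall w : C, w ^+ q = 1 -> w != 1 -> 2 * d < r * cabs (1 - w)) ->
  exists2 m : R, 0 < m & forall w : C, w ^+ q = 1 -> w != 1 -> 2 * d + m <= r * cabs (1 - w).
Proof.
move=> q0 H; pose w (k : 'I_q) : C := eit (0 / q%:R + 2 * pi * k%:R / q%:R).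
have wP (z : C) : z ^+ q = 1 -> exists k, z = w k by rewrite -eit0 => /(eit_root q0).
pose s := [seq r * cabs (1 - w k) - 2 * d | k <- enum 'I_q & (w k ^+ q == 1) && (w k != 1)].
have [|m m0 ms] := @small_pos s.
  apply/allP => x /mapP[k]; rewrite mem_filter => /andP[/andP[/eqP k1 k2] _] ->.
  by rewrite subr_gt0; exact: H.
exists m => // z z1 zN; have [k E] := wP z z1.
suff /(allP ms) : r * cabs (1 - z) - 2 * d \in s by lra.
by apply/mapP; exists k; rewrite ?E // mem_filter -E z1 eqxx zN mem_enum.
Qed.

Lemma disjoint_disks (a a' : C) (d : R) : 0 <= d ->
  (closed_disk a d `&` closed_disk a' d !=set0 -> a = a') -> a != a' -> 2 * d < cabs (a - a').
Proof.
move=> d0 H aN; rewrite ltNge; apply/negP => h; move/eqP: aN; apply; apply: H.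
have half : cabs ((2 : C)^-1) = 2^-1 by rewrite cabsV cabs_nat.
exists (2^-1 * (a + a')); rewrite /closed_disk /mkset; split.
  rewrite (_ : _ - a = 2^-1 * (a' - a)); last by field.
  by rewrite cabsM half (cabsC a' a); lra.
rewrite (_ : _ - a' = 2^-1 * (a - a')); last by field.
by rewrite cabsM half; lra.
Qed.

End SmallNumbers.

Section Constants.
Variables (R : realType) (p q : nat) (r d : R).
Local Notation C := (C R).
Hypotheses (hq : (2 <= q)%N) (hpq : (q < p)%N).
Local Notation dil := (dil R p q).

Let q0 : (0 < q)%N. Proof. exact: leq_trans hq. Qed.
Let p0 : (0 < p)%N. Proof. exact: ltn_trans hpq. Qed.
Let qR : (0 : R) < q%:R. Proof. by rewrite ltr0n. Qed.
Let pR : (0 : R) < p%:R. Proof. by rewrite ltr0n. Qed.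
Let qpR : (q%:R : R) < p%:R. Proof. by rewrite ltr_nat. Qed.

(** The images of 1 under f_0 on the unit circle are the q-th roots of unity; the
    disks around them and the annulus give all that is used about r and d. *)
Lemma circle_params : inv_class p q r (0 : C) (@unit_circle R) -> bundle_params p q r d (0 : C) ->
  [/\ 0 < r, 0 < d, r + d <= 1, r < 1 & 1 < (2 * r)^-1] /\
  forall w : C, w ^+ q = 1 -> w != 1 -> 2 * d < r * cabs (1 - w).
Proof.
move=> circ [r0 _ _ d0 fit].
have one : @unit_circle R 1 by rewrite /unit_circle /mkset cabs1.
have [/andP[r1 r2] _] := proj2 circ _ one; rewrite cabs1 in r1 r2.
have [[triv sub] _] := fit _ circ _ one.
have img (w : C) : w ^+ q = 1 -> [set ofR r * w | w in corr p q 0 1 `&` @unit_circle R] (ofR r * w).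
  move=> w1; exists w => //; split; first by rewrite /corr /mkset subr0 w1 expr1n.
  rewrite /unit_circle /mkset; have := congr1 (@cabs R) w1; rewrite cabsX cabs1 => /eqP.
  by rewrite pexpr_eq1 ?cabs_ge0 // => /eqP.
have i1 := img 1 (expr1n _ q).
have edge : closed_disk (ofR r * 1) d (ofR (r + d) : C).
  rewrite /closed_disk /mkset mulr1 -ofRB cabs_ofR (_ : r + d - r = d); last by ring.
  by rewrite gtr0_norm.
have rd : r + d <= 1.
  have := sub _ i1 _ edge; rewrite /closed_disk /mkset subr0 cabs_ofR.
  by apply: le_trans; exact: ler_norm.
split; first by split.
move=> w w1 wN; have rN : ofR r != 0 by rewrite -ofR0 (inj_eq (@ofR_inj R)) gt_eqF.
have := @disjoint_disks R (ofR r * 1) (ofR r * w) d (ltW d0) (triv _ _ i1 (img w w1)).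
rewrite -mulrBr cabsM cabs_ofR (gtr0_norm r0); apply.
by rewrite (inj_eq (mulfI rN)) eq_sym.
Qed.

(** The images of z lie on a circle around c whose radius is close to 1, and they
    differ by factors w with w ^ q = 1, so they are nearly as far apart as roots
    of unity. *)
Lemma images_apart (e m : R) (c z w w' : C) : 0 <= r ->
  (forall w : C, w ^+ q = 1 -> w != 1 -> 2 * d + m <= r * cabs (1 - w)) ->
  0 < m -> 0 <= d -> 0 < e -> 4 * e * p%:R <= 1 -> 16 * p%:R * (2 * d + m) * e <= m ->
  ann (4 * e) z -> corr p q c z w -> corr p q c z w' -> r * cabs (w - w') <= 2 * d + m / 2 -> w = w'.
Proof.
move=> r0 gap m0 d0 e0 ep em /andP[z1 _]; rewrite /corr /mkset => E E' h.
apply/eqP; apply/negPn/negP => wN.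
set A := w - c in E; set A' := w' - c in E'.
have wA : w - w' = A - A' by rewrite /A /A'; ring.
have p1 : (1 : R) <= p%:R by rewrite ler1n.
have e4 : 4 * e <= 1 by have := ler_wpM2l (ltW e0) p1; lra.
have low : 1 - p%:R * (4 * e) <= cabs A.
  rewrite leNgt; apply/negP => lt.
  have e40 : 0 <= 4 * e by lra.
  have B := bernoulli_sub p e40 e4.
  have : (1 - 4 * e) ^+ p <= cabs z ^+ p by apply: lerXn2r; rewrite ?nnegrE ?cabs_ge0 //; lra.
  rewrite -cabsX -E cabsX.
  have A1 : cabs A <= 1 by have := mulr_ge0 (ltW pR) e40; lra.
  have : cabs A ^+ q <= cabs A.
    by rewrite -(prednK q0) exprS; apply: ler_piMr; [exact: cabs_ge0 | apply: exprn_ile1 => //; exact: cabs_ge0].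
  by lra.
have AN : A != 0.
  apply/negP => /eqP A0; move/eqP: E; rewrite A0 expr0n gtn_eqF // eq_sym expf_eq0 p0 /= -cabs_eq0 => /eqP z0.
  have : A' ^+ q = 0 by rewrite E'; apply/eqP; rewrite expf_eq0 p0 /= -cabs_eq0 z0.
  move/eqP; rewrite expf_eq0 q0 /= => /eqP A'0; move/negP: wN; apply.
  by rewrite -subr_eq0 wA A0 A'0 subrr.
have root : (A' / A) ^+ q = 1 by rewrite expr_div_n E E' divff // -E expf_neq0.
have rootN : A' / A != 1.
  apply/negP => /eqP H; move/negP: wN; apply; rewrite -subr_eq0.
  have : A' = A by rewrite -[A'](divfK AN) H mul1r.
  by move=> H'; rewrite wA H' subrr.
have := gap _ root rootN => g.
have AA : cabs (w - w') = cabs A * cabs (1 - A' / A).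
  by rewrite -cabsM mulrBr mulr1 mulrCA divff // mulr1 wA.
have g1 := ler_wpM2l (cabs_ge0 A) g.
have D : 0 < 2 * d + m by lra.
have g2 := ler_wpM2r (ltW D) low.
have : cabs A * (r * cabs (1 - A' / A)) = r * cabs (w - w') by rewrite AA; ring.
by lra.
Qed.

Definition mid_lam : R := (q%:R + p%:R) / (2 * p%:R).

Lemma mid_lam_bounds : [/\ 0 < mid_lam, mid_lam < 1 & q%:R < mid_lam * p%:R].
Proof.
have p2 : 0 < 2 * (p%:R : R) by rewrite mulr_gt0.
have qp := qpR; have q0' := qR; have p0' := pR; rewrite /mid_lam; split.
- by rewrite divr_gt0 // addr_gt0.
- by rewrite ltr_pdivrMr // mul1r; lra.
- have -> : (q%:R + p%:R) / (2 * p%:R) * p%:R = (q%:R + p%:R) / (2 : R) by field; rewrite gt_eqF.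
  by lra.
Qed.

(** At e = 0 the inequality reads q <= lam * p, and it is strict by assumption;
    both sides are estimated linearly in e. *)
Lemma contr_small (lam e : R) : 0 < lam -> 0 < e -> 8 * e <= 1 ->
  8 * (q%:R * 2 ^+ q.-1 + lam * (p%:R * p%:R) + lam * taylor_bound R p) * e <= lam * p%:R - q%:R ->
  q%:R * (1 + 8 * e) ^+ q.-1 <= lam * (p%:R * (1 - 8 * e) ^+ p.-1 - taylor_bound R p * (8 * e)).
Proof.
move=> l0 e0 e1 H; have e8 : 0 <= 8 * e by lra.
have h1 := ler_wpM2l (ltW qR) (expr1D_le q.-1 e8 e1).
have h2 := bernoulli_sub p.-1 e8 e1.
have h3 : p.-1%:R * (8 * e) <= p%:R * (8 * e).
  by apply: ler_wpM2r => //; rewrite ler_nat leq_pred.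
have h4 := ler_wpM2l (ltW pR) (le_trans (lerB (lexx 1) h3) h2).
have h5 := ler_wpM2l (ltW l0) h4.
by rewrite mulrBr; lra.
Qed.

(** The constants are chosen in an order that avoids circularity: lam from p and
    q, the margin m from r and d, then e, then b, eta and the scale s1 = e / 2,
    and rho last, small against all of them. *)
Lemma constants (rho1 : R) : 0 < rho1 -> 0 < r -> 0 < d -> r + d <= 1 -> r < 1 -> 1 < (2 * r)^-1 ->
  (forall w : C, w ^+ q = 1 -> w != 1 -> 2 * d < r * cabs (1 - w)) ->
  exists lam e rho m b eta s1 : R,
  [/\ shadow_params p q lam e rho, separation p q e rho r d m b, cycle_params p q e rho eta &
      curve_params p q lam e rho s1] /\
  [/\ rho <= rho1, r < 1 - 2 * e & 1 + 2 * e < (2 * r)^-1].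
Proof.
move=> rho10 r0 d0 rd r1 r2 gap0.
have [m m0 gap] := roots_of_unity_gap q0 gap0.
have [lam [l0 l1 lp]] : exists lam : R, [/\ 0 < lam, lam < 1 & q%:R < lam * p%:R].
  by exists mid_lam; exact: mid_lam_bounds.
have lB : 0 < 1 - lam by rewrite subr_gt0.
have Tp := taylor_bound_ge0 R p; have Tq := taylor_bound_ge0 R q.
have p0' := pR; have q0' := qR.
have pow2 n : 0 < (2 : R) ^+ n by exact: exprn_gt0.
pose K1 : R := 8 * (q%:R * 2 ^+ q.-1 + lam * (p%:R * p%:R) + lam * taylor_bound R p).
have K10 : 0 < K1.
  have h1 : 0 < q%:R * 2 ^+ q.-1 :> R by exact: mulr_gt0.
  have h2 : 0 < lam * (p%:R * p%:R) by rewrite !mulr_gt0.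
  have h3 : 0 <= lam * taylor_bound R p by apply: mulr_ge0 => //; exact: ltW.
  by rewrite /K1; lra.
have cm0 : 0 < coef_min R q by rewrite /coef_min mulr_gt0 // exprn_gt0 // invr_gt0.
have bd0 : 0 <= bend R p q by rewrite addr_ge0.
pose K2 : R := 16 * p%:R * (2 * d + m).
have K20 : 0 < K2 by rewrite /K2; apply: mulr_gt0; [exact: mulr_gt0 | lra].
have small : all (fun x => 0 < x) [:: 16^-1; (lam * p%:R - q%:R) / K1; (4 * p%:R)^-1; m / K2; m / 16;
    (1 - r) / 4; ((2 * r)^-1 - 1) / 4; coef_min R q / 2 / (2 * bend R p q + 1)].
  have s2 : 0 < (lam * p%:R - q%:R) / K1 by rewrite divr_gt0 // subr_gt0.
  have s3 : 0 < (4 * p%:R)^-1 :> R by rewrite invr_gt0 mulr_gt0.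
  have s4 : 0 < m / K2 by exact: divr_gt0.
  have s5 : 0 < m / 16 by exact: divr_gt0.
  have s6 : 0 < (1 - r) / 4 by rewrite divr_gt0 // subr_gt0.
  have s7 : 0 < ((2 * r)^-1 - 1) / 4 by rewrite divr_gt0 // subr_gt0.
  have s8 : 0 < coef_min R q / 2 / (2 * bend R p q + 1).
    by apply: divr_gt0; [exact: divr_gt0 | lra].
  have s1 : 0 < 16^-1 :> R by rewrite invr_gt0.
  by rewrite /= s1 s2 s3 s4 s5 s6 s7 s8.
have [e e0 /=] := small_pos small.
case/and5P=> f1 f2 f3 f4 /and5P[f5 f6 f7 f8 _].
rewrite ler_pdivlMr // in f2; rewrite -[_^-1]div1r ler_pdivlMr ?mulr_gt0 // in f3.
rewrite ler_pdivlMr // in f4; rewrite [leLHS]mulrC in f2.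
rewrite ler_pdivlMr in f8; last by lra.
have e16 : 16 * e <= 1 by lra.
have dil0 : 0 < dil by rewrite /dil divr_gt0.
pose b := Num.min e (e ^+ q / (p%:R * 2 ^+ p.-1)).
have pp0 : 0 < p%:R * 2 ^+ p.-1 :> R by exact: mulr_gt0.
have b0 : 0 < b by rewrite lt_min e0 divr_gt0 // exprn_gt0.
have be : b <= e by rewrite ge_min lexx.
have bq : p%:R * 2 ^+ p.-1 * b <= e ^+ q.
  by rewrite mulrC -ler_pdivlMr // ge_min lexx orbT.
have dq0 : 0 < dil ^+ q by exact: exprn_gt0.
pose eta := Num.min 1 (dil ^+ q)^-1.
have eta0 : 0 < eta by rewrite lt_min ltr01 invr_gt0.
have etaq : dil ^+ q * eta ^+ (p - q) <= 1.
  have n0 : (0 < p - q)%N by rewrite subn_gt0.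
  have h : eta ^+ (p - q) <= eta.
    rewrite -(prednK n0) exprS; apply: ler_piMr; first exact: ltW.
    by apply: exprn_ile1; [exact: ltW | rewrite ge_min lexx].
  apply: le_trans (ler_wpM2l (ltW dq0) h) _.
  by rewrite mulrC -ler_pdivlMr // div1r ge_min lexx orbT.
pose kp := kap lam; have kp0 : 0 <= kp by rewrite /kp /kap divr_ge0 // ltW.
have qq0 : 0 < q%:R * 2 ^+ q.-1 :> R by exact: mulr_gt0.
have g0 : 0 < 16 * dil * (kp + 1) by apply: mulr_gt0; [exact: mulr_gt0 | lra].
have small' : all (fun x => 0 < x) [:: e; rho1; (2 * e) ^+ p * (1 - lam) / (2 * (q%:R * 2 ^+ q.-1));
    e * (1 - lam) / 2; e * eta / (2 * q%:R); e / (2 * 2 ^+ q); e / (16 * dil * (kp + 1))].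
  have s3 : 0 < (2 * e) ^+ p * (1 - lam) / (2 * (q%:R * 2 ^+ q.-1)).
    by apply: divr_gt0; apply: mulr_gt0 => //; apply: exprn_gt0; exact: mulr_gt0.
  have s4 : 0 < e * (1 - lam) / 2 by apply: divr_gt0 => //; exact: mulr_gt0.
  have s5 : 0 < e * eta / (2 * q%:R) by apply: divr_gt0; exact: mulr_gt0.
  have s6 : 0 < e / (2 * 2 ^+ q) by apply: divr_gt0 => //; exact: mulr_gt0.
  have s7 : 0 < e / (16 * dil * (kp + 1)) by exact: divr_gt0.
  by rewrite /= e0 rho10 s3 s4 s5 s6 s7.
have [rho rho0 /=] := small_pos small'.
case/and5P=> r_e r_1 r_root r_shadow /and4P[r_cyc r_cyc1 r_cur _].
rewrite ler_pdivlMr ?mulr_gt0 // in r_root; rewrite ler_pdivlMr // in r_shadow.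
rewrite ler_pdivlMr ?mulr_gt0 // in r_cyc; rewrite ler_pdivlMr ?mulr_gt0 // in r_cyc1.
rewrite ler_pdivlMr // in r_cur.
exists lam, e, rho, (m / 2), b, eta, (e / 2); split; split.
- split=> //.
  + by apply: contr_small => //; lra.
  + by rewrite mulrA ler_pdivrMr //; lra.
  + by rewrite ler_pdivrMr //; lra.
- split=> //; first by lra.
  move=> c z w w' _ za zw zw'.
  by apply: (images_apart (ltW r0) gap m0 (ltW d0) e0 _ _ za zw zw'); rewrite -?/K2; lra.
- split=> //.
  + have h : 0 < q%:R * rho by exact: mulr_gt0.
    by lra.
  + have rho_1 : rho <= 1 by lra.
    apply: le_lt_trans (expr1D_le q (ltW rho0) rho_1) _.
    have h : 0 < 2 ^+ q * rho by exact: mulr_gt0.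
    by lra.
- split; [lra | lra | lra | |].
  + have h : 0 <= dil * rho by apply: mulr_ge0; exact: ltW.
    by rewrite -/kp; move: r_cur h; move: (dil) => D h1 h2; have := mulr_ge0 kp0 h2; lra.
  + by have := mulr_ge0 (ltW e0) (ler01); lra.
- exact: r_1.
- by lra.
- by lra.
Qed.

End Constants.

(** * Julia sets as unions of quasiconformal curves *)
Theorem theorem4p4 (R : realType) (p q : nat)
    (hq : (2 <= q)%N) (hpq : (q < p)%N) (r d : R)
    (hcircle : inv_class p q r (0 : C R) (@unit_circle R))
    (hparams : \forall c \near (0 : C R), bundle_params p q r d c) :
  exists (U : set (C R)) (K : R) (h : C R -> C R * C R -> C R * C R),
    [/\ region U, U 0, 1 <= K,
        forall c, U c -> bundle_params p q r d c &
        the_bundle_motion p q r d U h] /\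
    (forall tau : nat -> 'I_q,
        qc_deformation K U (gamma p r d h tau)) /\
    (forall c, U c ->
        [/\ julia p q c =
              \bigcup_(tau in [set: nat -> 'I_q])
                 range (gamma p r d h tau c),
            hyperbolic_repeller p q c (julia p q c),
            leo p q c (julia p q c) &
            bundle_julia p q r d c (julia p q c)
              (cantor_bundle p q r d c (julia p q c))]).
Proof.
have [rho1 rho10 near] := iffLR (cnbhsP _ _) hparams.
have params0 : bundle_params p q r d (0 : C R) by apply: near; rewrite subrr cabs0.
have [[r0 d0 rd r1 r2] gap] := circle_params hq hcircle params0.
have [lam [e [rho [m [b [eta [s1 [[G S Y V] [rr r_in r_out]]]]]]]]] :=
  constants hq hpq rho10 r0 d0 rd r1 r2 gap.
have le c : disk rho c -> cabs c <= rho by exact: ltW.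
exists (disk rho), (qc_const p q lam e), (motion p q e r d); split; [split|split].
- exact: disk_region.
- by rewrite /disk /mkset cabs0; exact: par_rho0 G.
- exact: (qc_const_ge1 G).
- by move=> c cd; apply: near; rewrite sub0r cabsN; exact: lt_le_trans cd rr.
- split; first exact: (motion_bundle_motion G S r_in r_out).
  by move=> h' H c x; exact: (motion_unique G S H).
- move=> tau; split.
  + move=> t; rewrite (gammaE G S) /curve (move0 G (circle_pt_ann G tau t)).
    by rewrite /circle_pt.
  + move=> t c cd.
    have -> : (fun c => gamma p r d (motion p q e r d) tau c t) = (fun c => deform p q c (circle_pt p tau t) 0%N).
      by apply/funext => c'; exact: (gammaE G S).
    exact: (deform_derivable G (circle_pt_ann G tau t) cd).
  + move=> c t0 cd; have [I [phi [oI iI It qc E]]] := curve_qc G V tau (le _ cd) t0.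
    by exists I, phi; split=> // t It'; rewrite (gammaE G S) E.
move=> c cd; have cr := le _ cd; rewrite (julia_ann G S Y cr); split.
- exact: (ann_curves G S cr).
- exact: (ann_repeller G S cr).
- exact: (ann_leo G S cr).
- exists (bundle_nbhd p q e r d b c), (fmap p q e r d b c); split.
    exact: (bundle_map_fmap G S cr (ann_inv_class G S r_in r_out cr) (ann_expanding G S cr)).
  by move=> W' _ BW WN; exact: (periodic_bundle G S cr BW WN).
Qed.
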